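(* Let $A=(a_1,\ldots,a_n)\in\mathbb{Z}^n$ be a nonzero weight vector such that $\gcd(a_1,\ldots,a_n)=1$. Put $\alpha_j=|a_j|$ for $j=1,\ldots,n$ and $\boldsymbol{\alpha}=(\alpha_1,\ldots,\alpha_n)\in\mathbb{N}^n$. Let $\boldsymbol{\alpha}_{\widehat{j}}\in\mathbb{N}^{n-1}$ be the vector obtained from $\boldsymbol{\alpha}$ by omitting $\alpha_j$, and let $g_j=\gcd(\boldsymbol{\alpha}_{\widehat{j}})$ be the gcd of its entries. Let $\gamma_k(A)$ be the coefficients of the Laurent expansion at $x=1$ $$\operatorname{Hilb}_A^{\mathrm{on}}(x)=\sum_{k=0}^\infty\gamma_k(A)\,(1-x)^{k+2-2n}$$ of the on-shell Hilbert series. Then $$\gamma_0(A)=\frac{s_{(n-2,n-2,n-3,\ldots,1,0)}(\boldsymbol{\alpha})}{s_{(n-1,n-2,\ldots,1,0)}(\boldsymbol{\alpha})},\qquad \gamma_1(A)=0,$$ and $$\gamma_2(A)=\gamma_3(A)=\frac{\gamma_0(A)}{12}+\frac{s_{(n-3,n-3,n-3,n-4,\ldots,1,0)}(\boldsymbol{\alpha})}{12\,s_{(n-1,n-2,\ldots,1,0)}(\boldsymbol{\alpha})}\,S_{\boldsymbol{\alpha}}+\sum_{j=1}^n\frac{(g_j^2-1)\,s_{(n-3,n-3,n-4,\ldots,1,0)}(\boldsymbol{\alpha}_{\widehat{j}})}{12\,s_{(n-2,n-3,\ldots,1,0)}(\boldsymbol{\alpha}_{\widehat{j}})},$$ where $S_{\boldsymbol{\alpha}}=\sum_{i=1}^n\alpha_i^2$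 and $s_\rho$ denotes the Schur polynomial associated to $\rho$.
   Context: The circle $\mathbb{S}^1$ acts on $V=\mathbb{C}^n$ by $t\cdot(z_1,\ldots,z_n)=(t^{a_1}z_1,\ldots,t^{a_n}z_n)$. $\mathbb{R}[V]$ is the $\mathbb{R}$-algebra of real polynomial functions on the real vector space underlying $V$, graded by polynomial degree, and $\mathbb{R}[V]^{\mathbb{S}^1}$ is its subalgebra of invariants. The moment map is $J=\frac12\sum_{j=1}^n a_jz_j\overline{z_j}\in\mathbb{R}[V]^{\mathbb{S}^1}$; $I_J\subset\mathbb{R}[V]$ is the ideal generated by $J$, and $I_J^{\mathbb{S}^1}=I_J\cap\mathbb{R}[V]^{\mathbb{S}^1}$. The on-shell Hilbert series is $\operatorname{Hilb}_A^{\mathrm{on}}(x)=\sum_{i\ge0}\dim_{\mathbb{R}}\bigl(\mathbb{R}[V]^{\mathbb{S}^1}/I_J^{\mathbb{S}^1}\bigr)_i\,x^i$; it is the expansion at $0$ of a rational function, with which it is identified. For $\rho=(\rho_1\ge\cdots\ge\rho_m)\in\mathbb{Z}^m$, the Schur polynomial in $m$ variables is $$s_\rho(x_1,\ldots,x_m)=\frac{\det\bigl(x_i^{\rho_j+m-j}\bigr)_{1\le i,j\le m}}{\det\bigl(x_i^{m-j}\bigr)_{1\le i,j\le m}},$$ a symmetric function in which the division can be carried out, so that it is defined also when some of the variables coincide. The index vectors mean the following. In $n$ variables: $(n-2,n-2,n-3,\ldots,1,0)$ has first entry $n-2$ and $j$th entry $n-j$ for $j\ge2$; $(n-1,n-2,\ldots,1,0)$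 has $j$th entry $n-j$; $(n-3,n-3,n-3,n-4,\ldots,1,0)$ has first and second entries $n-3$ and $j$th entry $n-j$ for $j\ge3$. In $n-1$ variables: $(n-3,n-3,n-4,\ldots,1,0)$ has first entry $n-3$ and $j$th entry $n-1-j$ for $j\ge2$; $(n-2,n-3,\ldots,1,0)$ has $j$th entry $n-1-j$.
   Formalization: The formula for γ_0 is claimed only when s_(n-1,...,1,0)(α) is nonzero (at most one zero weight), and the formula for γ_2 only when n ≥ 2, all its denominators are nonzero and its Schur quotients are defined at α (for n = 2: no zero weight); γ_1 = 0 and γ_2 = γ_3 are unrestricted. *)

(* Defs.v *)
From HB Require Import structures.
From mathcomp Require Export all_boot all_order all_algebra.
From mathcomp Require Export complex mpoly.
From mathcomp Require Export boolp classical_sets reals.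

Set Implicit Arguments.
Unset Strict Implicit.
Unset Printing Implicit Defensive.
Import Order.TTheory GRing.Theory Num.Theory.
Local Open Scope ring_scope.

Section CircleAction.
Variables (R : realType) (n : nat) (a : 'I_n -> int).

(* R[V] is {mpoly R[n + n]}: with z_j = x_j + i y_j, the variable x_j has index
   [lshift n j] and y_j has index [rshift n j].  A polynomial in these variables
   is the same as a polynomial function, as R is infinite. *)
Definition coords (z : 'I_n -> R[i]) (k : 'I_(n + n)) : R :=
  match split k with
  | inl j => complex.Re (z j)
  | inr j => complex.Im (z j)
  end.

Definition circle_act (t : R[i]) (z : 'I_n -> R[i]) (j : 'I_n) : R[i] :=
  t ^ a j * z j.

Definition invariant (p : {mpoly R[n + n]}) : Prop :=
  forall t : R[i], `|t| = 1 ->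
  forall z : 'I_n -> R[i], p.@[coords (circle_act t z)] = p.@[coords z].

(* z_j \overline{z_j} = x_j^2 + y_j^2; see [moment_map_eval]. *)
Definition moment_map : {mpoly R[n + n]} :=
  2^-1 *: \sum_(j < n) (a j)%:~R *: ('X_(lshift n j) ^+ 2 + 'X_(rshift n j) ^+ 2).

Lemma moment_map_eval (z : 'I_n -> R[i]) :
  ((moment_map.@[coords z])%:C =
   2^-1 * \sum_(j < n) (a j)%:~R * (z j * (z j)^*))%C.
Proof.
rewrite /moment_map mevalZ rmorphM /= fmorphV rmorphMn rmorph1; congr (_ * _).
rewrite (raddf_sum (meval (coords z))) raddf_sum; apply: eq_bigr => j _ /=.
rewrite mevalZ rmorphM rmorph_int; congr (_ * _).
rewrite mevalD !rmorphXn /= !mevalXU /coords.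
rewrite -[lshift n j]/(unsplit (inl j)) -[rshift n j]/(unsplit (inr j)) !unsplitK.
by case: (z j) => x y; simpc; rewrite !expr2 [y * x]mulrC addNr.
Qed.

Definition moment_ideal (p : {mpoly R[n + n]}) : Prop :=
  exists q : {mpoly R[n + n]}, p = q * moment_map.

Definition moment_ideal_inv (p : {mpoly R[n + n]}) : Prop :=
  moment_ideal p /\ invariant p.

(* The classes of [b 0], ..., [b (d-1)] form a basis of the component of degree
   [i] of R[V]^{S^1} / I_J^{S^1}.  The ideal is homogeneous, so this component
   consists of the classes of the homogeneous invariants of degree [i]. *)
Definition onshell_basis (i d : nat) (b : 'I_d -> {mpoly R[n + n]}) : Prop :=
  [/\ forall k, invariant (b k) /\ b k \is i.-homog,
      forall c : 'I_d -> R,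
        moment_ideal_inv (\sum_(k < d) c k *: b k) -> forall k, c k = 0
    & forall p, invariant p -> p \is i.-homog ->
        exists c : 'I_d -> R, moment_ideal_inv (p - \sum_(k < d) c k *: b k)].

Definition onshell_dim (i : nat) : nat :=
  xget 0%N [set d : nat | exists b : 'I_d -> {mpoly R[n + n]}, onshell_basis i b].

End CircleAction.

Section Series.
Variable R : realType.

(* Coefficients of the product of a polynomial by the formal power series with
   coefficients [u]. *)
Definition conv (p : {poly R}) (u : nat -> R) (k : nat) : R :=
  \sum_(j < k.+1) p`_j * u (k - j)%N.

(* P / Q = \sum_k u_k x^k *)
Definition expansion_at0 (P Q : {poly R}) (u : nat -> R) : Prop :=
  Q`_0 != 0 /\ forall k, conv Q u k = P`_k.

(* P / Q = \sum_k u_k (1 - x)^(k - m) as a Laurent series in y = 1 - x: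
   this is Q(1 - y) * \sum_k u_k y^k = y^m * P(1 - y), with Q nonzero. *)
Definition expansion_at1 (m : nat) (P Q : {poly R}) (u : nat -> R) : Prop :=
  Q != 0 /\ forall k, conv (Q \Po (1 - 'X)) u k = ('X^m * (P \Po (1 - 'X)))`_k.

(* [gamma] is the family of Laurent coefficients at x = 1, starting at the
   exponent 2 - 2n, of the rational function whose expansion at 0 is the
   on-shell Hilbert series. *)
Definition onshell_laurent (n : nat) (a : 'I_n -> int) (gamma : nat -> R) : Prop :=
  exists P Q : {poly R},
    expansion_at0 P Q (fun i => (onshell_dim R a i)%:R) /\
    expansion_at1 (2 * n - 2) P Q gamma.

End Series.

Section Schur.
Variable R : realType.

(* [f] can be written as P / Q with Q(x) <> 0, and P(x) / Q(x) = v. *)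
Definition has_value (m : nat) (f : {fraction {mpoly R[m]}}) (x : 'I_m -> R)
    (v : R) : Prop :=
  exists P Q : {mpoly R[m]},
    [/\ Q.@[x] != 0, f = tofrac P / tofrac Q & v = P.@[x] / Q.@[x]].

Lemma has_value_uniq (m : nat) (f : {fraction {mpoly R[m]}}) (x : 'I_m -> R)
  (v w : R) : has_value f x v -> has_value f x w -> v = w.
Proof.
move=> [P [Q [Qx fE ->]]] [P' [Q' [Q'x fE' ->]]].
have nz (S : {mpoly R[m]}) : S.@[x] != 0 -> tofrac S != 0.
  by move=> Sx; rewrite tofrac_eq0; apply: contraNneq Sx => ->; rewrite meval0.
move/eqP: fE'; rewrite fE eqr_div ?nz // -!tofracM tofrac_eq => /eqP e.
by apply/eqP; rewrite eqr_div // -!mevalM e.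
Qed.

(* Indices start at 0, whence [m - j.+1] for the exponent m - j. *)
Definition alternant (m : nat) (rho : 'I_m -> int) : {fraction {mpoly R[m]}} :=
  \det (\matrix_(i < m, j < m)
          (tofrac ('X_i : {mpoly R[m]})) ^ (rho j + m%:Z - (j.+1)%:Z)).

Definition schur_frac (m : nat) (rho : 'I_m -> int) : {fraction {mpoly R[m]}} :=
  alternant rho / alternant (fun=> 0).

(* Laurent polynomials occur when [rho] has negative entries; these are not
   defined everywhere. *)
Definition schur_defined (m : nat) (rho : 'I_m -> int) (x : 'I_m -> R) : Prop :=
  exists v, has_value (schur_frac rho) x v.

Definition schur (m : nat) (rho : 'I_m -> int) (x : 'I_m -> R) : R :=
  xget 0 [set v | has_value (schur_frac rho) x v].

End Schur.

(* (m-1, m-2, ..., 1, 0) *)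
Definition idx_delta (m : nat) (j : 'I_m) : int := m%:Z - (j.+1)%:Z.

(* (m-2, m-2, m-3, ..., 1, 0) *)
Definition idx_two (m : nat) (j : 'I_m) : int :=
  if (j < 1)%N then m%:Z - 2 else m%:Z - (j.+1)%:Z.

(* (m-3, m-3, m-3, m-4, ..., 1, 0) *)
Definition idx_three (m : nat) (j : 'I_m) : int :=
  if (j < 2)%N then m%:Z - 3 else m%:Z - (j.+1)%:Z.

Definition omit (T : Type) (n : nat) (x : 'I_n -> T) (j : 'I_n) : 'I_n.-1 -> T :=
  fun i => x (lift j i).

Definition gcd_vec (n : nat) (x : 'I_n -> nat) : nat := \big[gcdn/0%N]_(j < n) x j.

(* Main.v *)
(* The invariants are spanned by the monomials of weight zero in the [z_j] and
   their conjugates, and [J] is not a zero divisor. So [dim = c_i - c_(i-2)],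
   where [c_i] counts the pairs [(u, v)] with [|u| + |v| = i] and [alpha.u =
   alpha.v]: the Hilbert series is [(1 - x^2)] times the diagonal [x_1 = ... =
   x_n = x] of a rational function in [x_1, ..., x_n]. At generic [x_k]
   partial fractions turn that function into a sum, over [j] and the
   [alpha_j]-th roots of unity, of products over [k != j] of the kernels [(1 -
   x^2) / ((1 - x w)(1 - x / w))]. Put [x_k = q^(B_k)] with [q = (1 - u) / (1
   + u)] and the ratios [alpha_k / B_k] pairwise distinct: the kernels are odd
   in [u], so the expansion in [u] has only every other coefficient, which is
   why [gamma_1 = 0] and [gamma_2 = gamma_3], and its first two coefficients
   are explicit sums over [j]; the roots of unity enter through [sum 1 / ((1 -
   w)(1 - 1/w)) = (g^2 - 1) / 12] over [w^g = 1], [w <> 1]. Lagrange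
   interpolation at the nodes [(alpha_k / B_k)^2] identifies those sums with
   ratios of alternants. Finally [B_k = B_k(s)] is polynomial in [s] with
   [B_k(0) = 1] and is admissible for infinitely many [s], so both sides are
   rational in [s] and agree at [s = 0], where all [x_k] coincide. *)
From HB Require Import structures.
Require Import Defs.
From mathcomp Require Import all_boot all_order all_algebra.
From mathcomp Require Import perm separable cyclotomic complex mpoly ring zify.
From mathcomp Require Import boolp classical_sets reals.
Import Order.TTheory GRing.Theory Num.Theory.
Set Implicit Arguments.
Unset Strict Implicit.
Unset Printing Implicit Defensive.
Local Open Scope ring_scope.

(** The obstacle is that equal weights make poles collide on the diagonal, so the residue formula is
    available only off it, while the theorem lives on it. The bridge is a numerator known before any
    residue is taken: [hilb_denom] lies in the ideal generated by the product of the 1 - x_j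
    Z^(alpha_j) and by its reciprocal polynomial, with integral cofactors. This yields one integral
    polynomial [Phi], which can be evaluated at power series as well as at numbers where the poles
    are distinct. Its values at x_k = (1 - y)^(B_k(s)) have coefficients polynomial in s, so passing
    to s = 0 is an identity of rational functions. The constant 12 is 3 * 4: the kernels contribute
    1/3, and u^2 = y^2/4 + ... contributes 1/4. The expansion gives 12 gamma_2 = sum_l g_l^2 v_l -
    (n - 1) gamma_0, where v_l is the Schur quotient of the weights without the l-th one. The stated
    form follows by writing g_l^2 = (g_l^2 - 1) + 1 and from sum_l v_l = n gamma_0 + S s_three /
    s_delta, which comes from summing x_j^2 - x_l^2 over l under a Lagrange sum. *)

Section Ideal.
Variable S : comPzRingType.

Definition ideal2 (f g w : S) := exists uv : S * S, w = uv.1 * f + uv.2 * g.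

Lemma ideal2_mull (f1 f2 g w1 w2 : S) :
  ideal2 f1 g w1 -> ideal2 f2 g w2 -> ideal2 (f1 * f2) g (w1 * w2).
Proof.
move=> [[u1 v1] /= ->] [[u2 v2] /= ->].
exists (u1 * u2, u1 * f1 * v2 + v1 * u2 * f2 + v1 * g * v2) => /=; ring.
Qed.

Lemma ideal2C (f g w : S) : ideal2 f g w -> ideal2 g f w.
Proof. by move=> [[u v] /= ->]; exists (v, u); rewrite addrC. Qed.

(** Explicit cofactors stand in for a resultant: relations between single factors suffice to place
    the product of all [w i j] in the ideal of the two products. *)
Lemma ideal2_prod (I J : Type) (r : seq I) (s : seq J) (P : pred I) (Q : pred J)
    (f : I -> S) (g : J -> S) (w : I -> J -> S) :
  (forall i j, P i -> Q j -> ideal2 (f i) (g j) (w i j)) ->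
  ideal2 (\prod_(i <- r | P i) f i) (\prod_(j <- s | Q j) g j)
         (\prod_(i <- r | P i) \prod_(j <- s | Q j) w i j).
Proof.
have one h : ideal2 1 h 1 by exists (1, 0); rewrite mul0r addr0 mulr1.
move=> fgw; elim/big_rec2: _ => [|i wi fi Pi IH]; first exact: one.
apply: ideal2_mull IH; apply/ideal2C.
elim/big_rec2: _ => [|j wj gj Qj IHj]; first exact: one.
by apply: ideal2_mull IHj; apply/ideal2C/fgw.
Qed.

End Ideal.

(** * The coefficientwise pairing of two polynomials *)

Section Pairing.
Variable S : comNzRingType.
Implicit Types A B C g : {poly S}.

(** The constant term in Z of A(Z) B(1/Z). For A = B = 1 / [kernel_poly] it sums over the pairs of
    exponent vectors of equal weight. *)
Definition coef_pairing A B : S := \sum_(r < size A) A`_r * B`_r.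

Lemma coef_pairingE N A B : (forall r, (N <= r)%N -> A`_r * B`_r = 0) ->
  coef_pairing A B = \sum_(r < N) A`_r * B`_r.
Proof.
move=> ABN; pose F r := A`_r * B`_r.
have ext M M' : (forall r, (M <= r)%N -> F r = 0) -> (M <= M')%N ->
    \sum_(r < M) F r = \sum_(r < M') F r.
  move=> FM le_MM'; rewrite (big_ord_widen M' F le_MM') big_mkcond /=.
  by apply: eq_bigr => r _; case: ltnP => // /FM.
have FA r : (size A <= r)%N -> F r = 0.
  by move=> le_Ar; rewrite /F nth_default // mul0r.
rewrite /coef_pairing (ext (size A) (maxn (size A) N)) ?leq_maxl //.
by rewrite -(ext N (maxn (size A) N)) ?leq_maxr.
Qed.

Lemma coef_pairingEr A B : coef_pairing A B = \sum_(r < size B) A`_r * B`_r.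
Proof.
by apply: coef_pairingE => r le_Br; rewrite (nth_default _ le_Br) mulr0.
Qed.

Lemma coef_pairingDr A B C :
  coef_pairing A (B + C) = coef_pairing A B + coef_pairing A C.
Proof.
by rewrite -big_split; apply: eq_bigr => r _; rewrite coefD mulrDr.
Qed.

Lemma coef_pairingZr A (c : S) B : coef_pairing A (c%:P * B) = c * coef_pairing A B.
Proof.
rewrite mulr_sumr; apply: eq_bigr => r _; rewrite mulrC coefCM; ring.
Qed.

Lemma coef_pairing_drop A g a (x : S) :
  coef_pairing A (('X^a - x%:P) * g) =
  coef_pairing (drop_poly a ((1 - x *: 'X^a) * A)) g.
Proof.
have [N N_def] : {N | N = (size A + size g + a)%N} by exists (size A + size g + a)%N.
rewrite (@coef_pairingE (N + a)); last first.
  by move=> r le_Nr; rewrite nth_default ?mul0r // (leq_trans _ le_Nr) // N_def -!addnA leq_addr.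
rewrite [RHS](@coef_pairingE N); last first.
  move=> r le_Nr; rewrite [g`_r]nth_default ?mulr0 // (leq_trans _ le_Nr) //.
  by rewrite N_def addnAC addnC leq_addr.
under eq_bigr => r _.
  rewrite mulrBl coefB coefXnM coefCM mulrBr; over.
under [RHS]eq_bigr => r _.
  rewrite coef_drop_poly mulrBl mul1r coefB -scalerAl coefZ coefXnM ltnNge leq_addl.
  rewrite addnK mulrBl; over.
rewrite !sumrB; congr (_ - _); last first.
  rewrite big_split_ord /= [X in _ + X]big1 ?addr0.
    by apply: eq_bigr => r _; ring.
  move=> r _; rewrite nth_default ?mul0r // (@leq_trans N) ?leq_addr //.
    by rewrite N_def -addnA leq_addr.
rewrite addnC big_split_ord /= big1 ?add0r; last first.
  by move=> r _; rewrite ltn_ord mulr0.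
by apply: eq_bigr => r _; rewrite ltnNge leq_addr /= addKn addnC.
Qed.

(** As C has degree at most m, the coefficients of C * A from index a + m on only involve those of A
    from index a on. *)
Lemma drop_poly_mul m C A a : (size C <= m.+1)%N ->
  drop_poly m (C * drop_poly a A) = drop_poly (a + m) (C * A).
Proof.
move=> sC; apply/polyP => r; rewrite !coef_drop_poly !coefM.
have trunc N (F : nat -> S) : (m <= N)%N ->
    (\sum_(j < N.+1) C`_j * F j) = \sum_(j < m.+1) C`_j * F j.
  move=> le_mN; rewrite [RHS](big_ord_widen N.+1 (fun j => C`_j * F j)) //.
  rewrite [RHS]big_mkcond; apply: eq_bigr => j _ /=.
  by case: ltnP => // lt_mj; rewrite nth_default ?mul0r // (leq_trans sC).
rewrite (trunc _ (fun j => (drop_poly a A)`_(r + m - j))) ?leq_addl //.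
rewrite (trunc _ (fun j => A`_(r + (a + m) - j))); last by lia.
apply: eq_bigr => j _; rewrite coef_drop_poly.
by congr (_ * A`_ _); have := ltn_ord j; lia.
Qed.

Lemma size_prod_1subXn (I : Type) (r : seq I) (P : pred I) (x : I -> S) (a : I -> nat) :
  (size (\prod_(i <- r | P i) (1 - x i *: 'X^(a i)))%R <=
   (\sum_(i <- r | P i) a i).+1)%N.
Proof.
elim: r => [|j r IH]; first by rewrite !big_nil size_polyC; case: (_ != 0).
rewrite !big_cons; case: ifP => // _.
apply: leq_trans (size_polyMleq _ _) _.
have: (size (1 - x j *: 'X^(a j))%R <= (a j).+1)%N.
  apply: leq_trans (size_polyD _ _) _; rewrite geq_max size_poly1 /= size_polyN.
  by apply: leq_trans (size_scale_leq _ _) _; rewrite size_polyXn.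
by move=> /leq_add/(_ IH); rewrite -subn1 leq_subLR add1n addnS addSn.
Qed.

(* The adjoint of multiplication by [X^a - x] is, up to a shift, multiplication
   by the reciprocal polynomial [1 - x X^a]. *)
Lemma coef_pairing_adjoint (I : Type) (r : seq I) (P : pred I) (x : I -> S)
    (a : I -> nat) A g :
  coef_pairing A (\prod_(i <- r | P i) ('X^(a i) - (x i)%:P) * g) =
  coef_pairing (drop_poly (\sum_(i <- r | P i) a i)
     (\prod_(i <- r | P i) (1 - x i *: 'X^(a i)) * A)) g.
Proof.
elim: r A => [|i r IH] A; first by rewrite !big_nil !mul1r drop_poly0l.
rewrite !big_cons; case: ifP => // Pi.
rewrite -mulrA coef_pairing_drop IH drop_poly_mul ?mulrA 1?[_ * (1 - _)]mulrC //.
exact: size_prod_1subXn.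
Qed.

End Pairing.

(** * A universal numerator for the Hilbert series *)

Section Kernel.
Variables (n : nat) (al : 'I_n -> nat).

(** Only nonzero weights occur, so that the constant term is 1 and the polynomial is invertible as a
    power series. The weights 0 are restored in [onshell_den] and [theta_den]. *)
Definition kernel_poly (S : comNzRingType) (x : 'I_n -> S) : {poly S} :=
  \prod_(j | (0 < al j)%N) (1 - x j *: 'X^(al j)).

Definition dual_kernel_poly (S : comNzRingType) (x : 'I_n -> S) : {poly S} :=
  \prod_(j | (0 < al j)%N) ('X^(al j) - (x j)%:P).

Definition hilb_denom (S : comNzRingType) (x : 'I_n -> S) : S :=
  \prod_(j | (0 < al j)%N) \prod_(k | (0 < al k)%N)
    (1 - x j ^+ al k * x k ^+ al j).

(** A polynomial substitute for the power series 1 / [kernel_poly x], correct up to degree N. *)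
Definition trunc_inverse (S : comNzRingType) (x : 'I_n -> S) (N : nat) : {poly S} :=
  \prod_(j | (0 < al j)%N) \sum_(m < N.+1) (x j *: 'X^(al j)) ^+ m.

(** With a = al j and b = al k, write 1 - x_j^b x_k^a = (1 - x_j^b Z^(ab)) + x_j^b (Z^(ab) - x_k^a).
    The first bracket is divisible by 1 - x_j Z^a, the second by Z^b - x_k. *)
Lemma hilb_denom_ideal (S : comNzRingType) (x : 'I_n -> S) :
  ideal2 (kernel_poly x) (dual_kernel_poly x) (hilb_denom x)%:P.
Proof.
rewrite /hilb_denom rmorph_prod; under eq_bigr do rewrite rmorph_prod.
apply: ideal2_prod => j k _ _ /=.
set a := al j; set b := al k; set xj := x j; set xk := x k.
have -> : (1 - xj ^+ b * xk ^+ a)%:P =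
    (1 - (xj *: 'X^a) ^+ b) + (xj ^+ b)%:P * ('X^b ^+ a - xk%:P ^+ a).
  rewrite exprZn -exprM -exprM polyCB polyC1 polyCM -mul_polyC mulrBr.
  by rewrite -[xk%:P ^+ a]rmorphXn /= [(b * a)%N]mulnC addrA subrK.
rewrite -[1 in X in ideal2 _ _ X](expr1n _ b) !subrXX.
set s := \sum_(i < b) _; set t := \sum_(i < a) _.
by exists (s, (xj ^+ b)%:P * t) => /=; ring.
Qed.

Definition evz (S : comNzRingType) (x : 'I_n -> S) : {mpoly int[n]} -> S :=
  mmap intr x.

Section Eval.
Variables (S : comNzRingType) (x : 'I_n -> S).

Fact evz_is_additive : zmod_morphism (evz x).
Proof. exact: mmap_is_additive. Qed.

Fact evz_is_multiplicative : monoid_morphism (evz x).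
Proof. by have [eM e1] := mmap_is_multiplicative x (intr : {rmorphism int -> S}). Qed.

HB.instance Definition _ :=
  GRing.isZmodMorphism.Build {mpoly int[n]} S (evz x) evz_is_additive.
HB.instance Definition _ :=
  GRing.isMonoidMorphism.Build {mpoly int[n]} S (evz x) evz_is_multiplicative.

Lemma evzX j : evz x 'X_j = x j.
Proof. by rewrite /evz mmapX mmap1U. Qed.

Lemma map_trunc_inverse N :
  map_poly (evz x) (trunc_inverse (fun j => 'X_j) N) = trunc_inverse x N.
Proof.
rewrite rmorph_prod; apply: eq_bigr => j _; rewrite rmorph_sum /=.
by apply: eq_bigr => m _; rewrite rmorphXn /= map_polyZ map_polyXn /= evzX.
Qed.

Lemma map_kernel_poly :
  map_poly (evz x) (kernel_poly (fun j => 'X_j)) = kernel_poly x.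
Proof.
rewrite rmorph_prod; apply: eq_bigr => j _.
by rewrite rmorphB rmorph1 /= map_polyZ map_polyXn /= evzX.
Qed.

Lemma map_dual_kernel_poly :
  map_poly (evz x) (dual_kernel_poly (fun j => 'X_j)) = dual_kernel_poly x.
Proof.
rewrite rmorph_prod; apply: eq_bigr => j _.
by rewrite rmorphB /= map_polyXn map_polyC /= evzX.
Qed.

Lemma evz_hilb_denom : evz x (hilb_denom (fun j => 'X_j)) = hilb_denom x.
Proof.
rewrite rmorph_prod; apply: eq_bigr => j _; rewrite rmorph_prod.
by apply: eq_bigr => k _; rewrite rmorphB rmorph1 rmorphM !rmorphXn /= !evzX.
Qed.

End Eval.

Lemma evz_morph (S S' : comNzRingType) (f : {rmorphism S -> S'}) (x : 'I_n -> S) p :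
  f (evz x p) = evz (f \o x) p.
Proof.
rewrite /evz /mmap rmorph_sum; apply: eq_bigr => m _.
rewrite rmorphM rmorph_int /mmap1 rmorph_prod; congr (_ * _).
by apply: eq_bigr => j _; rewrite rmorphXn.
Qed.

Lemma mul_kernel_trunc_inverse (S : comNzRingType) (x : 'I_n -> S) N :
  kernel_poly x * trunc_inverse x N =
  \prod_(j | (0 < al j)%N) (1 - (x j *: 'X^(al j)) ^+ N.+1).
Proof.
rewrite -big_split; apply: eq_bigr => j _ /=.
by rewrite -opprB mulNr -subrX1 opprB.
Qed.

Definition eq_upto (S : comNzRingType) m (p q : {poly S}) :=
  forall r, (r < m)%N -> p`_r = q`_r.

Lemma eq_upto_mul (S : comNzRingType) m (p q p' q' : {poly S}) :
  eq_upto m p q -> eq_upto m p' q' -> eq_upto m (p * p') (q * q').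
Proof.
move=> pq pq' r lt_rm; rewrite !coefM; apply: eq_bigr => i _.
by have := ltn_ord i; rewrite ltnS => lt_ir; rewrite pq ?pq' //; lia.
Qed.

Lemma eq_upto_prod (S : comNzRingType) m (I : Type) (s : seq I) (P : pred I)
    (p q : I -> {poly S}) :
  (forall i, P i -> eq_upto m (p i) (q i)) ->
  eq_upto m (\prod_(i <- s | P i) p i) (\prod_(i <- s | P i) q i).
Proof.
by move=> pq; elim/big_rec2: _ => [//|i p' q' /pq /eq_upto_mul]; apply.
Qed.

Lemma coef_geometric (S : comNzRingType) (c : S) a m r :
  (r < a * m)%N -> ((c *: 'X^a) ^+ m)`_r = 0.
Proof.
move=> lt_r; rewrite exprZn -exprM coefZ coefXn.
by rewrite (ltn_eqF lt_r) mulr0.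
Qed.

Lemma mul_kernel_trunc_upto (S : comNzRingType) (x : 'I_n -> S) N :
  eq_upto N.+1 (kernel_poly x * trunc_inverse x N) 1.
Proof.
rewrite mul_kernel_trunc_inverse => r lt_r.
transitivity ((\prod_(j | (0 < al j)%N) (1 : {poly S}))`_r); last by rewrite big1.
move: r lt_r; apply: eq_upto_prod => j al_j r lt_r; rewrite coefB coef_geometric ?subr0 //.
by rewrite (leq_trans lt_r) // leq_pmull.
Qed.

Lemma trunc_inverse_upto (S : comNzRingType) (x : 'I_n -> S) N0 N :
  (N0 <= N)%N -> eq_upto N0.+1 (trunc_inverse x N) (trunc_inverse x N0).
Proof.
move=> le_N; apply: eq_upto_prod => j al_j r lt_r.
rewrite [in RHS](big_ord_widen N.+1 (fun m => (x j *: 'X^(al j)) ^+ m)) //.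
rewrite [in RHS]big_mkcond !coef_sum; apply: eq_bigr => m _.
case: ltnP => // lt_m; rewrite coef0 coef_geometric //.
by rewrite (leq_trans lt_r) // (leq_trans lt_m) // leq_pmull.
Qed.

Lemma kernel_poly0 (S : comNzRingType) (x : 'I_n -> S) : (kernel_poly x)`_0 = 1.
Proof.
have := @mul_kernel_trunc_upto S x 0 0%N isT.
rewrite coef1 coefM big_ord1 [X in _ * X](_ : _ = 1) ?mulr1 //.
rewrite /trunc_inverse big1 ?coef1 // => j _.
by rewrite big_ord1 expr0.
Qed.

(** Let C and C' be the two kernel polynomials and A = 1 / C. Then <A, (U C + V C') A> = <A, U> +
    <A, C' V A>, and by adjunction the last term is the pairing of V A with a shift of C A = 1,
    which is 0. Truncating A only adds errors divisible by X^(N+1). *)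
Lemma mul_hilb_denom_pairing (R : comNzRingType) (x : 'I_n -> {poly R})
    (U V : {poly {poly R}}) N k :
  (exists j, 0 < al j)%N -> (forall j, x j = 'X) -> (k <= N)%N ->
  (hilb_denom x)%:P = U * kernel_poly x + V * dual_kernel_poly x ->
  (hilb_denom x * coef_pairing (trunc_inverse x N) (trunc_inverse x N))`_k
  = (coef_pairing (trunc_inverse x N) U)`_k.
Proof.
move=> [j0 al_j0] xX le_kN eUV; set A := trunc_inverse x N.
pose m : {poly R} := 'X^(N.+1).
have [Z CAZ] : exists Z, kernel_poly x * A = 1 + m%:P * Z.
  rewrite mul_kernel_trunc_inverse.
  elim/big_ind: _ => [|_ _ [z1 ->] [z2 ->]|j _]; first by exists 0; rewrite mulr0 addr0.
    by exists (z1 + z2 + m%:P * z1 * z2); ring.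
  by exists (- 'X^(al j * N.+1)); rewrite exprZn -exprM xX -/m mulrN mul_polyC.
have d_gt0 : (0 < \sum_(j | (0 < al j)%N) al j)%N.
  by rewrite (bigD1 j0) //= addn_gt0 al_j0.
rewrite -coef_pairingZr eUV.
have -> : (U * kernel_poly x + V * dual_kernel_poly x) * A =
  U + m%:P * (U * Z) + dual_kernel_poly x * (V * A).
  by have := CAZ; move: (kernel_poly x) (dual_kernel_poly x) => C C' E; ring: E.
rewrite 2!coef_pairingDr coef_pairing_adjoint -/(kernel_poly x) CAZ.
(* The shift is positive because some weight is nonzero, so it removes the term 1. *)
have -> : drop_poly (\sum_(j | (0 < al j)%N) al j) (1 + m%:P * Z) =
    m%:P * drop_poly (\sum_(j | (0 < al j)%N) al j) Z.
  apply/polyP => r; rewrite !(coef_drop_poly, coefCM, coefD, coef1) addn_eq0.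
  by rewrite (gtn_eqF d_gt0) andbF add0r.
set D := drop_poly _ Z.
have -> : coef_pairing (m%:P * D) (V * A) = m * coef_pairing D (V * A).
  rewrite (@coef_pairingE _ (size D)); last first.
    by move=> r le_r; rewrite coefCM [D`_r]nth_default ?mulr0 ?mul0r.
  by rewrite /coef_pairing mulr_sumr; apply: eq_bigr => r _; rewrite coefCM mulrA.
rewrite coef_pairingZr !coefD ![(m * _)`_k]coefXnM !ltnS !le_kN.
by rewrite !addr0.
Qed.

(* In [hilb_numeratorP], the second clause is the value of the Hilbert series at
   numbers [x], for a partial fraction decomposition of the inverse of
   [kernel_poly x] with poles [1 / p i] and residues given by [e]. *)
Lemma hilb_numeratorP : (exists j, 0 < al j)%N ->
  exists Phi : {mpoly int[n]},
  [/\ forall R : comNzRingType, exists N0, forall N k, (N0 <= N)%N -> (k <= N)%N ->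
        let x := fun=> 'X : {poly R} in
        (hilb_denom x * coef_pairing (trunc_inverse x N) (trunc_inverse x N))`_k
        = (evz x Phi)`_k
    & forall (K : fieldType) (x : 'I_n -> K) (I : eqType) (s : seq I) (e p : I -> K),
        (forall r, \sum_(k < r.+1) (kernel_poly x)`_k *
            (\sum_(i <- s) e i * p i ^+ (r - k)) = (r == 0%N)%:R) ->
        {in s, forall i, (dual_kernel_poly x).[p i] = 0} ->
        {in s, forall i, (kernel_poly x).[p i] != 0} ->
        evz x Phi = hilb_denom x * \sum_(i <- s) e i / (kernel_poly x).[p i] ].
Proof.
move=> al_gt0.
have [[U V] /= eUV] := hilb_denom_ideal (fun j => 'X_j : {mpoly int[n]}).
pose N0 := size U.
exists (\sum_(r < N0) (trunc_inverse (fun j => 'X_j) N0)`_r * U`_r); split.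
  move=> R; exists N0 => N k le_N le_kN; set x : 'I_n -> {poly R} := fun=> 'X.
  have eUVx : (hilb_denom x)%:P = map_poly (evz x) U * kernel_poly x +
      map_poly (evz x) V * dual_kernel_poly x.
    rewrite -map_kernel_poly -map_dual_kernel_poly -!rmorphM -rmorphD /= -eUV.
    by rewrite map_polyC /= evz_hilb_denom.
  rewrite (mul_hilb_denom_pairing al_gt0 (fun=> erefl) le_kN eUVx); congr (polyseq _)`_k.
  rewrite rmorph_sum (@coef_pairingE _ N0) => [|r le_r]; last first.
    by rewrite coef_map /= [U`_r]nth_default ?rmorph0 ?mulr0.
  apply: eq_bigr; move=> r _; rewrite rmorphM -!coef_map /= map_trunc_inverse.
  rewrite (@trunc_inverse_upto _ x _ _ le_N r) // ltnS ltnW //.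
move=> K x I s e p e_conv C'p Cp.
set A := trunc_inverse x N0; set C := kernel_poly x in e_conv Cp *.
(* Both sequences are inverse to [C], whose constant coefficient is 1, and so obey the same
   recurrence. *)
have A_e r : (r <= N0)%N -> A`_r = \sum_(i <- s) e i * p i ^+ r.
  elim/ltn_ind: r => r IH le_r.
  have := @mul_kernel_trunc_upto K x N0 r le_r; rewrite coef1 -(e_conv r) coefM.
  rewrite !big_ord_recl !subn0 /C kernel_poly0 !mul1r.
  rewrite [X in _ + X](eq_bigr (fun k : 'I_r => (kernel_poly x)`_(lift ord0 k) *
     (\sum_(i <- s) e i * p i ^+ (r - lift ord0 k)))); first by move/addIr.
  move=> k _; rewrite -/A IH //=; last by lia.
  by have := ltn_ord k; rewrite /bump /=; lia.
(* At [p i] the dual kernel vanishes, and with it the cofactor [V]. *)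
have eUVp i : i \in s -> hilb_denom x = (map_poly (evz x) U).[p i] * C.[p i].
  move=> s_i; rewrite -[LHS](hornerC _ (p i)) -evz_hilb_denom.
  rewrite -[(evz x _)%:P](map_polyC (evz x)) /= eUV rmorphD !rmorphM /=.
  by rewrite map_kernel_poly map_dual_kernel_poly hornerD !hornerM C'p // mulr0 addr0.
rewrite mulr_sumr [RHS](eq_big_seq (fun i => e i *
    \sum_(r < N0) (map_poly (evz x) U)`_r * p i ^+ r)); last first.
  move=> i s_i; rewrite /= mulrCA [hilb_denom x](eUVp i) // mulfK ?Cp //.
  by rewrite (@horner_coef_wide _ N0) ?size_poly.
rewrite rmorph_sum; under [RHS]eq_bigr do rewrite mulr_sumr.
rewrite exchange_big; apply: eq_bigr => r _ /=.
rewrite rmorphM -!coef_map /= map_trunc_inverse -/A A_e 1?ltnW // mulr_suml.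
by apply: eq_bigr => i _; rewrite mulrAC mulrA mulrAC.
Qed.

End Kernel.

(** * Roots of unity and partial fractions *)

Section UnityRoots.
Variable K : numClosedFieldType.

Fact unity_roots_key (m : nat) : {r : seq K |
  'X^m - 1 = lead_coef ('X^m - 1 : {poly K}) *: \prod_(z <- r) ('X - z%:P)}.
Proof. exact: closed_field_poly_normal. Qed.

Definition unity_roots (m : nat) : seq K := sval (unity_roots_key m).

Variable m : nat.
Hypothesis m_gt0 : (0 < m)%N.

Lemma unity_rootsE : 'X^m - 1 = \prod_(z <- unity_roots m) ('X - z%:P).
Proof.
rewrite {1}(svalP (unity_roots_key m)) -/(unity_roots m).
by rewrite (monicP (monicXnsubC _ m_gt0)) scale1r.
Qed.

Lemma mem_unity_roots z : (z \in unity_roots m) = (z ^+ m == 1).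
Proof.
by rewrite -root_prod_XsubC -unity_rootsE /root !hornerE subr_eq0.
Qed.

Lemma unity_roots_uniq : uniq (unity_roots m).
Proof.
rewrite -separable_prod_XsubC -unity_rootsE.
by apply: separable_Xn_sub_1; rewrite pnatr_eq0 -lt0n.
Qed.

Lemma size_unity_roots : size (unity_roots m) = m.
Proof.
have := congr1 (fun p : {poly K} => size p) unity_rootsE.
by rewrite size_XnsubC // size_prod_XsubC => -[].
Qed.

End UnityRoots.

(** The Poisson kernel, that is, the sum of x^|k| w^k over all integers k. *)
Definition fourier_kernel (K : fieldType) (x w : K) : K :=
  (1 - x ^+ 2) / ((1 - x * w) * (1 - x / w)).

Section PartialFraction.
Variables (K : numClosedFieldType) (n : nat) (al : 'I_n -> nat) (x q : 'I_n -> K).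
Hypothesis al_gt0 : exists j, (0 < al j)%N.
Hypothesis q_neq0 : forall j, q j != 0.
Hypothesis qx : forall j, (0 < al j)%N -> q j ^+ al j = x j.
Hypothesis x_indep : forall j k, (0 < al j)%N -> (0 < al k)%N -> j != k ->
  x j ^+ al k != x k ^+ al j.
Hypothesis x_small : forall j k, (0 < al j)%N -> (0 < al k)%N ->
  x j ^+ al k * x k ^+ al j != 1.

(** A pair (j, z) stands for the root z q_j of Z^(al j) = x_j. The inverses of these roots are the
    poles of 1 / [kernel_poly]. *)
Let nodes : seq ('I_n * K) :=
  [seq (j, z) | j <- enum [pred j | (0 < al j)%N], z <- unity_roots K (al j)].
Let node (i : 'I_n * K) : K := i.2 * q i.1.

Let mem_nodes (i : 'I_n * K) :
  i \in nodes -> (0 < al i.1)%N /\ i.2 ^+ al i.1 = 1.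
Proof.
case/allpairsPdep => j [z []]; rewrite mem_enum => al_j z_mu -> /=.
by split=> //; apply/eqP; rewrite -mem_unity_roots.
Qed.

Let nodeX (i : 'I_n * K) : i \in nodes -> node i ^+ al i.1 = x i.1.
Proof. by case/mem_nodes => al_i z1; rewrite /node exprMn z1 mul1r qx. Qed.

Let node_neq0 (i : 'I_n * K) : i \in nodes -> node i != 0.
Proof.
case/mem_nodes => al_i z1; rewrite /node mulf_neq0 ?q_neq0 //.
by apply: contra_eq_neq z1 => ->; rewrite expr0n gtn_eqF // eq_sym oner_neq0.
Qed.

Let nodeXk (i : 'I_n * K) (k : 'I_n) : i \in nodes ->
  (node i ^+ al k) ^+ al i.1 = x i.1 ^+ al k.
Proof. by move=> s_i; rewrite exprAC nodeX. Qed.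

Let node_indep (i : 'I_n * K) (k : 'I_n) : i \in nodes -> (0 < al k)%N ->
  k != i.1 -> node i ^+ al k != x k.
Proof.
move=> s_i al_k neq_ki; have [al_i _] := mem_nodes s_i.
have := x_indep al_i al_k; rewrite eq_sym => /(_ neq_ki); apply: contraNneq => E.
by rewrite -nodeXk // E.
Qed.

Let node_small (i : 'I_n * K) (k : 'I_n) : i \in nodes -> (0 < al k)%N ->
  1 - x k * node i ^+ al k != 0.
Proof.
move=> s_i al_k; have [al_i _] := mem_nodes s_i.
rewrite subr_eq0; have := x_small al_i al_k; apply: contraNneq => E.
by rewrite -nodeXk // -exprMn mulrC -E expr1n.
Qed.

Let node_inj : {in nodes &, injective node}.
Proof.
move=> i i' s_i s_i' E; have [al_i z1] := mem_nodes s_i.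
have [al_i' _] := mem_nodes s_i'.
have eq_1 : i'.1 = i.1.
  by apply/eqP/negPn/negP => /(node_indep s_i al_i'); rewrite E nodeX // eqxx.
move: E; rewrite /node eq_1 => /(mulIf (q_neq0 _)).
by case: i i' eq_1 {s_i s_i' al_i z1 al_i'} => [j z] [j' z'] /= -> ->.
Qed.

Let nodes_uniq : uniq nodes.
Proof.
apply: allpairs_uniq_dep => [|j|[j z] [j' z'] _ _ /= [-> ->] //].
  exact: enum_uniq.
by rewrite mem_enum => al_j; apply: unity_roots_uniq.
Qed.

Let sum_nodes (F : 'I_n * K -> K) :
  \sum_(i <- nodes) F i =
  \sum_(j | (0 < al j)%N) \sum_(z <- unity_roots K (al j)) F (j, z).
Proof.
rewrite /nodes big_allpairs_dep big_enum; exact: eq_bigl.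
Qed.

Let size_nodes : size nodes = (\sum_(j | (0 < al j)%N) al j)%N.
Proof.
rewrite /nodes size_allpairs_dep sumnE big_map big_enum /=.
by apply: eq_bigr => j al_j; rewrite size_unity_roots.
Qed.

Let cofactor_poly (i : 'I_n * K) : {poly K} :=
  (\sum_(m < al i.1) (node i *: 'X) ^+ m) *
  \prod_(k | (0 < al k)%N && (k != i.1)) (1 - x k *: 'X^(al k)).

Let cofactor_polyE (i : 'I_n * K) : i \in nodes ->
  kernel_poly al x = (1 - node i *: 'X) * cofactor_poly i.
Proof.
move=> s_i; have [al_i _] := mem_nodes s_i.
rewrite /kernel_poly (bigD1 i.1) //= mulrA; congr (_ * _).
by rewrite -[1 - node i *: _]opprB mulNr -subrX1 opprB exprZn nodeX.
Qed.

(** The coefficient of 1 / (1 - p Z) in the partial fractions, for p = [node i]: the inverse of the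
    cofactor at Z = 1/p, where its geometric sum equals [al i.1]. *)
Let residue (i : 'I_n * K) : K :=
  ((al i.1)%:R * \prod_(k | (0 < al k)%N && (k != i.1)) (1 - x k / node i ^+ al k))^-1.

Let cofactor_poly_node (i i' : 'I_n * K) : i \in nodes -> i' \in nodes ->
  residue i * (cofactor_poly i).[(node i')^-1] = (i == i')%:R.
Proof.
move=> s_i s_i'; have [al_i _] := mem_nodes s_i; have [al_i' _] := mem_nodes s_i'.
case: eqVneq => [<-|neq_ii'].
  rewrite /cofactor_poly hornerM horner_prod horner_sum.
  have -> : \sum_(m < al i.1) ((node i *: 'X) ^+ m).[(node i)^-1] = (al i.1)%:R.
    rewrite (eq_bigr (fun=> 1)) ?sumr_const ?card_ord // => m _.
    by rewrite horner_exp hornerZ hornerX mulfV ?expr1n // node_neq0.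
  rewrite /residue [X in _ * (_ * X)](eq_bigr (fun k => 1 - x k / node i ^+ al k)); last first.
    by move=> k _; rewrite !hornerE exprVn.
  rewrite mulVf // mulf_neq0 ?pnatr_eq0 -?lt0n //.
  apply/prodf_neq0 => k /andP[al_k neq_k]; rewrite subr_eq0 eq_sym.
  apply: contra (node_indep s_i al_k neq_k) => /eqP E.
  by rewrite -[x k](divfK (_ : node i ^+ al k != 0)) ?E ?mul1r // expf_neq0 ?node_neq0.
have /eqP : (kernel_poly al x).[(node i')^-1] = 0.
  rewrite (cofactor_polyE s_i') hornerM [X in X * _](_ : _ = 0) ?mul0r //.
  by rewrite !hornerE mulfV ?node_neq0 ?subrr.
rewrite (cofactor_polyE s_i) hornerM mulf_eq0 => /orP[|/eqP ->]; last by rewrite mulr0.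
rewrite !hornerE subr_eq0 => /eqP E.
have /(node_inj s_i s_i') : node i = node i'.
  by rewrite -[node i](mulfVK (node_neq0 s_i')) -E mul1r.
by move/eqP; rewrite (negPf neq_ii').
Qed.

(** Lagrange interpolation of the constant 1: the two sides agree at the inverse of each node, and
    their degrees are less than the number of nodes. *)
Let sum_cofactor_poly : \sum_(i <- nodes) residue i *: cofactor_poly i = 1.
Proof.
apply/eqP; rewrite -subr_eq0; apply/eqP.
have d_gt0 : (0 < \sum_(j | (0 < al j)%N) al j)%N.
  by have [j0 al_j0] := al_gt0; rewrite (bigD1 j0) //= addn_gt0 al_j0.
apply: (@roots_geq_poly_eq0 _ _ [seq (node i)^-1 | i <- nodes]).
- apply/allP => _ /mapP[i s_i ->]; rewrite /root !hornerE horner_sum.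
  rewrite (big_rem i) //= hornerZ cofactor_poly_node // eqxx.
  rewrite big_seq big1 ?addr0 ?subrr // => i'; rewrite mem_rem_uniq // inE.
  by case/andP => /negPf neq_i s_i'; rewrite hornerZ cofactor_poly_node ?neq_i.
- by rewrite map_inj_in_uniq // => i i' s_i s_i' /invr_inj; apply: node_inj.
rewrite size_map size_nodes; apply: leq_trans (size_polyD _ _) _.
rewrite geq_max size_polyN size_poly1 d_gt0 andbT.
rewrite big_seq; apply: (leq_trans (size_sum _ _ _)).
apply/bigmax_leqP_seq => i _ s_i; have [al_i _] := mem_nodes s_i.
apply: leq_trans (size_scale_leq _ _) _.
apply: leq_trans (size_polyMleq _ _) _.
have s1 : (size (\sum_(m < al i.1) (node i *: 'X) ^+ m)%R <= al i.1)%N.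
  apply: (leq_trans (size_sum _ _ _)); apply/bigmax_leqP_seq => m _ _.
  rewrite exprZn; apply: leq_trans (size_scale_leq _ _) _.
  by rewrite size_polyXn.
have := leq_add s1 (size_prod_1subXn (index_enum 'I_n)
  (fun k => (0 < al k)%N && (k != i.1)) x al).
rewrite addnS => s2.
rewrite [X in (_ <= X)%N](bigD1 i.1) //=.
by rewrite -subn1 leq_subLR add1n; apply: leq_trans s2 _.
Qed.

(** The decomposition of 1 / [kernel_poly] into terms [residue i] / (1 - [node i] Z), read
    coefficient by coefficient. *)
Let sum_node_powers r : \sum_(k < r.+1) (kernel_poly al x)`_k *
   (\sum_(i <- nodes) residue i * node i ^+ (r - k)) = (r == 0%N)%:R.
Proof.
have conv i : i \in nodes ->
    \sum_(k < r.+1) (kernel_poly al x)`_k * node i ^+ (r - k) = (cofactor_poly i)`_r.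
  move=> s_i; elim: r => [|r IH].
    rewrite big_ord1 mulr1 (cofactor_polyE s_i) coefM big_ord1.
    by rewrite coefB coef1 coefZ coefX mulr0 subr0 mul1r.
  rewrite big_ord_recr /= subnn mulr1.
  rewrite (eq_bigr (fun k : 'I_r.+1 => (kernel_poly al x)`_k * node i ^+ (r - k) * node i)).
    rewrite -mulr_suml IH [in LHS](cofactor_polyE s_i) mulrBl mul1r coefB.
    by rewrite -scalerAl coefZ coefXM /= mulrC; ring.
  move=> k _; have le_kr : (k <= r)%N by rewrite -ltnS ltn_ord.
    by rewrite subSn // exprSr mulrA.
under eq_bigr do rewrite mulr_sumr.
rewrite exchange_big /= -coef1 -sum_cofactor_poly coef_sum; apply: eq_big_seq => i s_i.
rewrite coefZ -conv // mulr_sumr; apply: eq_bigr => k _; ring.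
Qed.

Lemma sum_fourier_kernels (Phi : {mpoly int[n]}) :
  (forall (K : fieldType) (x : 'I_n -> K) (I : eqType) (s : seq I) (e p : I -> K),
     (forall r, \sum_(k < r.+1) (kernel_poly al x)`_k *
         (\sum_(i <- s) e i * p i ^+ (r - k)) = (r == 0%N)%:R) ->
     {in s, forall i, (dual_kernel_poly al x).[p i] = 0} ->
     {in s, forall i, (kernel_poly al x).[p i] != 0} ->
     evz x Phi = hilb_denom al x * \sum_(i <- s) e i / (kernel_poly al x).[p i]) ->
  evz x Phi * \prod_(k | (0 < al k)%N) (1 - x k ^+ 2) =
  hilb_denom al x * \sum_(j | (0 < al j)%N) (al j)%:R^-1 *
    \sum_(z <- unity_roots K (al j)) \prod_(k | (0 < al k)%N && (k != j))
       fourier_kernel (x k) ((z * q j) ^+ al k).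
Proof.
move=> /(_ K x _ nodes residue node sum_node_powers) ->.
- rewrite -mulrA; congr (_ * _); rewrite sum_nodes mulr_suml.
  apply: eq_bigr => j al_j; rewrite mulr_suml mulr_sumr; apply: eq_big_seq => z z_mu.
  have s_i : (j, z) \in nodes.
    by apply/allpairsPdep; exists j, z; rewrite mem_enum.
  pose p := node (j, z); have pX : p ^+ al j = x j := nodeX s_i.
  (* The factor of index j takes the value 1 - x_j^2 at p and cancels its counterpart in the product
     on the left. The factors k <> j pair up with those of the residue into Poisson kernels. *)
  have -> : (kernel_poly al x).[p] = (1 - x j ^+ 2) *
      \prod_(k | (0 < al k)%N && (k != j)) (1 - x k * p ^+ al k).
    rewrite /kernel_poly horner_prod (bigD1 j) //= !hornerE pX; congr (_ * _).
    by apply: eq_bigr => k _; rewrite !hornerE.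
  have x2 : 1 - x j ^+ 2 != 0 by have := node_small s_i al_j; rewrite (nodeX s_i).
  rewrite [X in _ * X = _](bigD1 j) //= mulrA /residue /= -/p invfM [(_ * \prod_(_ | _) _)^-1]invfM.
  rewrite -!mulrA; congr (_ * _); rewrite [(1 - x j ^+ 2)^-1 * _]mulrCA.
  rewrite [_^-1 * ((1 - x j ^+ 2) * _)]mulKf //.
  rewrite -!prodfV -!big_split; apply: eq_bigr => k /andP[al_k neq_k] /=.
  by rewrite /fourier_kernel -/p invfM; ring.
- move=> i s_i; have [al_i _] := mem_nodes s_i.
  rewrite /dual_kernel_poly horner_prod (bigD1 i.1) //= !hornerE nodeX //.
  by rewrite subrr mul0r.
move=> i s_i; rewrite /kernel_poly horner_prod; apply/prodf_neq0 => k al_k.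
by rewrite !hornerE node_small.
Qed.

End PartialFraction.

(** * Second order expansions at 0 of rational functions *)

Section Cofinite.
Variable K : numFieldType.

(** The exceptions are zeros of a nonzero polynomial: conjunctions become products, substitutions
    become compositions, and no topology enters. *)
Definition cofinitely (P : K -> Prop) :=
  exists2 D : {poly K}, D != 0 & forall u, D.[u] != 0 -> P u.

Lemma cofinitelyT (P : K -> Prop) : (forall u, P u) -> cofinitely P.
Proof. by move=> allP; exists 1; rewrite ?oner_neq0. Qed.

Lemma cofinitely_and (P1 P2 P : K -> Prop) :
  cofinitely P1 -> cofinitely P2 -> (forall u, P1 u -> P2 u -> P u) -> cofinitely P.
Proof.
move=> [D1 D1_neq0 P1D] [D2 D2_neq0 P2D] P12.
exists (D1 * D2) => [|u]; first by rewrite mulf_neq0.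
by rewrite hornerM mulf_eq0 negb_or => /andP[/P1D ? /P2D ?]; apply: P12.
Qed.

Lemma cofinitely_imp (P1 P : K -> Prop) :
  cofinitely P1 -> (forall u, P1 u -> P u) -> cofinitely P.
Proof. by move=> P1c P1P; apply: (cofinitely_and P1c P1c) => u /P1P. Qed.

Lemma cofinitely_all (I : eqType) (s : seq I) (P : I -> K -> Prop) :
  {in s, forall i, cofinitely (P i)} -> cofinitely (fun u => {in s, forall i, P i u}).
Proof.
elim: s => [|i s IH] Ps; first exact: cofinitelyT.
have Pi : cofinitely (P i) by apply: Ps; rewrite mem_head.
have IH' : cofinitely (fun u => {in s, forall i, P i u}).
  by apply: IH => j s_j; apply: Ps; rewrite inE s_j orbT.
apply: (cofinitely_and Pi IH') => u Piu Psu j.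
by rewrite inE => /orP[/eqP -> //|/Psu].
Qed.

Lemma cofinitely_fin (I : finType) (P : I -> K -> Prop) :
  (forall i, cofinitely (P i)) -> cofinitely (fun u => forall i, P i u).
Proof.
move=> cP; have := @cofinitely_all I (enum I) P (fun i _ => cP i).
by move/cofinitely_imp; apply => u Pu i; apply: Pu; rewrite mem_enum.
Qed.

Lemma cofinitely_neq0 (p : {poly K}) : p != 0 -> cofinitely (fun u => p.[u] != 0).
Proof. by move=> p_neq0; exists p. Qed.

Lemma poly_nat_eq0 (p : {poly K}) : (forall m : nat, p.[m%:R] = 0) -> p = 0.
Proof.
move=> p0; apply: (@roots_geq_poly_eq0 _ p [seq m%:R | m <- iota 0 (size p)]).
- by apply/allP => _ /mapP[m _ ->]; rewrite /root p0.
- by rewrite map_inj_uniq ?iota_uniq // => m m' /eqP; rewrite eqr_nat => /eqP.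
by rewrite size_map size_iota.
Qed.

Lemma cofinitely_poly_eq (p q : {poly K}) : cofinitely (fun u => p.[u] = q.[u]) -> p = q.
Proof.
move=> [D D_neq0 pq]; apply/eqP; rewrite -subr_eq0.
have /eqP : D * (p - q) = 0.
  apply: poly_nat_eq0 => m; rewrite hornerM hornerD hornerN.
  have [->|/pq ->] := eqVneq D.[m%:R] 0; first by rewrite mul0r.
  by rewrite subrr mulr0.
by rewrite mulf_eq0 (negPf D_neq0).
Qed.

(* [jet f a c] says that, outside finitely many points, [f] is a rational
   function regular at 0, with [f u = a + c u^2 + O(u^3)]. *)
Definition jet (f : K -> K) (a c : K) := exists P Q : {poly K}, Q.[0] != 0 /\
  cofinitely (fun u => f u * Q.[u] = (a + c * u ^+ 2) * Q.[u] + u ^+ 3 * P.[u]).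

Lemma eq_jet (f g : K -> K) a c :
  cofinitely (fun u => f u = g u) -> jet f a c -> jet g a c.
Proof.
move=> fg [P [Q [Q0 fPQ]]]; exists P, Q; split=> //.
by apply: (cofinitely_and fg fPQ) => u ->.
Qed.

Lemma jet_cst a : jet (fun=> a) a 0.
Proof.
exists 0, 1; rewrite hornerC oner_neq0; split=> //; apply: cofinitelyT => u.
by rewrite !hornerE.
Qed.

Lemma jet_sqr : jet (fun u => u ^+ 2) 0 1.
Proof.
exists 0, 1; rewrite hornerC oner_neq0; split=> //; apply: cofinitelyT => u.
by rewrite !hornerE.
Qed.

Lemma jetD f g a c a' c' : jet f a c -> jet g a' c' ->
  jet (fun u => f u + g u) (a + a') (c + c').
Proof.
move=> [P [Q [Q0 fPQ]]] [P' [Q' [Q'0 gPQ]]].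
exists (P * Q' + P' * Q), (Q * Q'); rewrite hornerM mulf_neq0 //; split=> //.
apply: (cofinitely_and fPQ gPQ) => u E E'; rewrite hornerD !hornerM.
by ring: E E'.
Qed.

Lemma jetM f g a c a' c' : jet f a c -> jet g a' c' ->
  jet (fun u => f u * g u) (a * a') (a * c' + c * a').
Proof.
move=> [P [Q [Q0 fPQ]]] [P' [Q' [Q'0 gPQ]]].
(* These are the terms of order at least 3 of the product, divided by u^3; the last one comes from
   (c u^2)(c' u^2). *)
exists (P * Q' * (a'%:P + c' *: 'X^2) + (a%:P + c *: 'X^2) * Q * P'
  + 'X^3 * P * P' + (c * c') *: ('X * Q * Q')), (Q * Q').
rewrite hornerM mulf_neq0 //; split=> //.
apply: (cofinitely_and fPQ gPQ) => u E E'; rewrite !hornerE /=.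
transitivity ((f u * Q.[u]) * (g u * Q'.[u])); first by ring.
rewrite E E'; ring.
Qed.

Lemma jetV f a c : a != 0 -> jet f a c -> jet (fun u => (f u)^-1) a^-1 (- c / a ^+ 2).
Proof.
move=> a_neq0 [P [Q [Q0 fPQ]]].
pose N := (a%:P + c *: 'X^2) * Q + 'X^3 * P.
have NE u : N.[u] = (a + c * u ^+ 2) * Q.[u] + u ^+ 3 * P.[u] by rewrite !hornerE.
have N0 : N.[0] != 0 by rewrite NE !expr0n /= mulr0 mul0r !addr0 mulf_neq0.
have p_neq0 (p : {poly K}) : p.[0] != 0 -> p != 0.
  by apply: contraNneq => ->; rewrite horner0.
exists (- a^-1 *: P + (c ^+ 2 / a ^+ 2) *: ('X * Q) + (c / a ^+ 2) *: ('X^2 * P)), N.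
split=> //; apply: (cofinitely_and fPQ (cofinitely_and (cofinitely_neq0 (p_neq0 _ Q0))
  (cofinitely_neq0 (p_neq0 _ N0)) (fun u => @conj _ _))) => u E [Qu Nu].
have fu : f u != 0 by apply: contraNneq Nu => fu0; rewrite NE -E fu0 mul0r.
have -> : (f u)^-1 * N.[u] = Q.[u] by rewrite NE -E mulKf.
rewrite NE !hornerE /=; field.
by rewrite a_neq0.
Qed.

Lemma jet_sum (I : Type) (r : seq I) (P : pred I) (f : I -> K -> K) (a c : I -> K) :
  (forall i, P i -> jet (f i) (a i) (c i)) ->
  jet (fun u => \sum_(i <- r | P i) f i u) (\sum_(i <- r | P i) a i)
      (\sum_(i <- r | P i) c i).
Proof.
move=> fj; elim: r => [|i r IH].
  rewrite !big_nil; apply: eq_jet (jet_cst 0).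
  by apply: cofinitelyT => u; rewrite big_nil.
rewrite !big_cons; case: ifP => Pi; last first.
  by apply: eq_jet IH; apply: cofinitelyT => u; rewrite big_cons Pi.
by apply: eq_jet (jetD (fj _ Pi) IH); apply: cofinitelyT => u; rewrite big_cons Pi.
Qed.

Lemma jet_sum_seq (I : eqType) (r : seq I) (f : I -> K -> K) (a c : I -> K) :
  {in r, forall i, jet (f i) (a i) (c i)} ->
  jet (fun u => \sum_(i <- r) f i u) (\sum_(i <- r) a i) (\sum_(i <- r) c i).
Proof.
move=> fj; have := jet_sum r (P := fun i => i \in r) fj; rewrite -!big_seq.
by apply: eq_jet; apply: cofinitelyT => u; rewrite -big_seq.
Qed.

(** Leibniz's rule. As [r] has no repetition, the condition [i != l] removes exactly one factor. *)
Lemma jet_prod (I : eqType) (r : seq I) (P : pred I) (f : I -> K -> K) (a c : I -> K) :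
  uniq r -> (forall i, P i -> jet (f i) (a i) (c i)) ->
  jet (fun u => \prod_(i <- r | P i) f i u) (\prod_(i <- r | P i) a i)
      (\sum_(l <- r | P l) c l * \prod_(i <- r | P i && (i != l)) a i).
Proof.
move=> r_uniq fj; elim: r r_uniq => [_|i r IH /=/andP[r'i /IH {}IH]].
  rewrite !big_nil; apply: eq_jet (jet_cst 1).
  by apply: cofinitelyT => u; rewrite big_nil.
have neq_i l : l \in r -> i != l by apply: contraTneq => <-.
rewrite !big_cons eqxx andbF; case: ifP => Pi; last first.
  rewrite [X in jet _ _ X](eq_bigr (fun l => c l *
    \prod_(i <- r | P i && (i != l)) a i)); last by move=> l _; rewrite big_cons Pi.
  by apply: eq_jet IH; apply: cofinitelyT => u; rewrite big_cons Pi.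
rewrite [X in jet _ _ (X + _)](_ : _ = c i * \prod_(i <- r | P i) a i); last first.
  congr (_ * _); rewrite big_seq_cond [in RHS]big_seq_cond.
  by apply: eq_bigl => l; case: (boolP (l \in r)) => // /neq_i; rewrite eq_sym => ->; rewrite andbT.
rewrite [X in jet _ _ (_ + X)](_ : _ = a i * \sum_(l <- r | P l)
    c l * \prod_(i <- r | P i && (i != l)) a i); last first.
  rewrite mulr_sumr [LHS]big_seq_cond [RHS]big_seq_cond; apply: eq_bigr => l /andP[/neq_i neq_il _].
  by rewrite big_cons Pi neq_il mulrCA.
rewrite addrC; apply: eq_jet (jetM (fj _ Pi) IH).
by apply: cofinitelyT => u; rewrite big_cons Pi.
Qed.

End Cofinite.

(** * The Poisson kernel in the Cayley parameter *)

Section KernelJets.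
Variable K : numFieldType.
Implicit Types (u w : K) (f g : K -> K).

(* The Cayley parameter turns the symmetry [x |-> 1 / x] into [u |-> - u]. *)
Definition cayley u : K := (1 - u) / (1 + u).

Lemma cofinitely_id : cofinitely (fun u => u != 0).
Proof.
apply: (@cofinitely_imp _ (fun u => ('X : {poly K}).[u] != 0)) => [|u].
  by apply: cofinitely_neq0; rewrite polyX_eq0.
by rewrite hornerX.
Qed.

Lemma cofinitely_lin (c : K) : cofinitely (fun u => 1 + c * u != 0).
Proof.
have /cofinitely_neq0 : (1 + c *: 'X : {poly K}) != 0.
  apply: contraTneq (oner_neq0 K) => /(congr1 (fun p : {poly K} => p.[0])).
  by rewrite !hornerE => ->; rewrite eqxx.
by move/cofinitely_imp; apply => u; rewrite !hornerE.
Qed.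

Lemma cofinitely_addr1 : cofinitely (fun u => 1 + u != 0).
Proof.
by apply: cofinitely_imp (cofinitely_lin 1) _ => u; rewrite mul1r.
Qed.

Lemma cofinitely_cayley_neq0 : cofinitely (fun u => cayley u != 0).
Proof.
apply: (cofinitely_and (cofinitely_lin (-1)) cofinitely_addr1) => u.
by rewrite mulN1r /cayley => u1 u2; rewrite mulf_neq0 ?invr_neq0.
Qed.

Lemma cofinitely_cayleyX (c : K) e : (1 + 1) ^+ e != 0 :> K -> (e = 0%N -> c != 1) ->
  cofinitely (fun u => cayley u ^+ e != c).
Proof.
move=> two_neq0 ce; have D_neq0 : (1 - 'X) ^+ e - c *: (1 + 'X) ^+ e != 0 :> {poly K}.
  (* For e > 0 the value at 1 forces c = 0, and then the value at 0 is 1. For e = 0 the polynomial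
     is the constant 1 - c. *)
  apply/eqP => /(congr1 (fun p : {poly K} => (p.[1], p.[0]))).
  rewrite !hornerE subrr subr0 !expr1n mulr1.
  case: e two_neq0 ce => [_ /(_ erefl) c1|e two_neq0 _] [E1 E2].
    by move: E2 c1 => /eqP; rewrite subr_eq0 eq_sym => /eqP ->; rewrite eqxx.
  move/eqP: E1; rewrite expr0n /= sub0r oppr_eq0 mulf_eq0 (negPf two_neq0) orbF => /eqP c0.
  by move: E2; rewrite c0 subr0 => /eqP; rewrite oner_eq0.
apply: (cofinitely_and (cofinitely_neq0 D_neq0) cofinitely_addr1) => u.
rewrite !hornerE subr_eq0 /cayley => Du u1.
apply: contraNneq Du => <-; rewrite expr_div_n divfK ?expf_neq0 //.
Qed.

(** The first order analogue of [jet], that is f u = b + O(u), with no condition on the linear term.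
    It is enough for a factor that is multiplied by u^2, as in [jet_regular]. *)
Definition regular f (b : K) := exists P Q : {poly K}, Q.[0] != 0 /\
  cofinitely (fun u => f u * Q.[u] = b * Q.[u] + u * P.[u]).

Lemma eq_regular f g b : cofinitely (fun u => f u = g u) -> regular f b -> regular g b.
Proof.
move=> fg [P [Q [Q0 fPQ]]]; exists P, Q; split=> //.
by apply: (cofinitely_and fg fPQ) => u ->.
Qed.

Lemma regular_cst b : regular (fun=> b) b.
Proof.
exists 0, 1; rewrite hornerC oner_neq0; split=> //; apply: cofinitelyT => u.
by rewrite !hornerE.
Qed.

Lemma regularD f g b b' : regular f b -> regular g b' ->
  regular (fun u => f u + g u) (b + b').
Proof.
move=> [P [Q [Q0 fPQ]]] [P' [Q' [Q'0 gPQ]]].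
exists (P * Q' + P' * Q), (Q * Q'); rewrite hornerM mulf_neq0 //; split=> //.
apply: (cofinitely_and fPQ gPQ) => u E E'; rewrite hornerD !hornerM.
by ring: E E'.
Qed.

Lemma regularM f g b b' : regular f b -> regular g b' ->
  regular (fun u => f u * g u) (b * b').
Proof.
move=> [P [Q [Q0 fPQ]]] [P' [Q' [Q'0 gPQ]]].
exists (b' *: (P * Q') + b *: (Q * P') + 'X * P * P'), (Q * Q').
rewrite hornerM mulf_neq0 //; split=> //.
apply: (cofinitely_and fPQ gPQ) => u E E'; rewrite !hornerE /=.
transitivity ((f u * Q.[u]) * (g u * Q'.[u])); first by ring.
rewrite E E'; ring.
Qed.

Lemma regularV f b : b != 0 -> regular f b -> regular (fun u => (f u)^-1) b^-1.
Proof.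
move=> b_neq0 [P [Q [Q0 fPQ]]].
pose N := b *: Q + 'X * P.
have NE u : N.[u] = b * Q.[u] + u * P.[u] by rewrite !hornerE.
have N0 : N.[0] != 0 by rewrite NE mul0r addr0 mulf_neq0.
have N_neq0 : N != 0 by apply: contraNneq N0 => ->; rewrite horner0.
exists (- b^-1 *: P), N; split=> //.
apply: (cofinitely_and fPQ (cofinitely_neq0 N_neq0)) => u E Nu.
have fu : f u != 0 by apply: contraNneq Nu => fu0; rewrite NE -E fu0 mul0r.
have -> : (f u)^-1 * N.[u] = Q.[u] by rewrite NE -E mulKf.
by rewrite NE !hornerE /=; field.
Qed.

Lemma regular_sum (I : Type) (r : seq I) f (F : I -> K -> K) (b : I -> K) :
  (forall i, regular (F i) (b i)) ->
  regular (fun u => \sum_(i <- r) F i u) (\sum_(i <- r) b i).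
Proof.
move=> Fb; elim: r => [|i r IH].
  rewrite big_nil; apply: eq_regular (regular_cst 0).
  by apply: cofinitelyT => u; rewrite big_nil.
rewrite big_cons; apply: eq_regular (regularD (Fb i) IH).
by apply: cofinitelyT => u; rewrite big_cons.
Qed.

Lemma regularX f b e : regular f b -> regular (fun u => f u ^+ e) (b ^+ e).
Proof.
move=> fb; elim: e => [|e IH]; first exact: regular_cst.
rewrite exprS; apply: eq_regular (regularM fb IH).
by apply: cofinitelyT => u; rewrite exprS.
Qed.

Lemma jet_regular f b : regular f b -> jet (fun u => u ^+ 2 * f u) 0 b.
Proof.
move=> [P [Q [Q0 fPQ]]]; exists P, Q; split=> //.
apply: cofinitely_imp fPQ _ => u E; rewrite -mulrA E; ring.
Qed.

Lemma regular_addr1V : regular (fun u => (1 + u)^-1) 1.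
Proof.
rewrite -[1 in X in regular _ X]invr1; apply: regularV; first exact: oner_neq0.
exists 1, 1; rewrite hornerC oner_neq0; split=> //.
by apply: cofinitelyT => u; rewrite !hornerE.
Qed.

Lemma regular_cayley : regular cayley 1.
Proof.
rewrite -[1 in X in regular _ X]mulr1; apply: (@regularM (fun u => 1 - u)); last first.
  exact: regular_addr1V.
exists (-1), 1; rewrite hornerC oner_neq0; split=> //.
by apply: cofinitelyT => u; rewrite !hornerE; ring.
Qed.

(** Geometric sum, with 1 - [cayley u] = 2 u / (1 + u). *)
Lemma regular_sub_cayleyX e : regular (fun u => (1 - cayley u ^+ e) / u) (2 * e%:R).
Proof.
have := regularM (regularM (regular_cst 2) regular_addr1V)
  (@regular_sum _ (index_iota 0 e) id _ _ (fun i => regularX i regular_cayley)).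
rewrite mulr1 [X in regular _ (_ * X)](_ : _ = e%:R); last first.
  by under eq_bigr do rewrite expr1n; rewrite sumr_const_nat subn0.
apply: eq_regular; apply: (cofinitely_and cofinitely_id cofinitely_addr1) => u u0 u1.
rewrite -[1 - _ ^+ _]opprB subrX1 big_mkord -mulNr opprB [RHS]mulrAC; congr (_ * _).
by rewrite /cayley; field; rewrite u0 u1.
Qed.

Lemma regularB f g b b' : regular f b -> regular g b' ->
  regular (fun u => f u - g u) (b - b').
Proof.
move=> fb gb; rewrite -mulN1r.
apply: eq_regular (regularD fb (regularM (regular_cst (-1)) gb)).
by apply: cofinitelyT => u; rewrite mulN1r.
Qed.

(** The denominator does not vanish at u = 0, while the numerator is 1 - q^(2B) = 4 B u + O(u^2):
    such a factor has no constant term. *)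
Lemma jet_fourier_kernel_neq1 (B C : nat) (om : K) : om != 0 -> om != 1 ->
  jet (fun u => u * fourier_kernel (cayley u ^+ B) (om * cayley u ^+ C))
      0 (4 * B%:R / ((1 - om) * (1 - om^-1))).
Proof.
move=> om0 om1.
have cX e : regular (fun u => cayley u ^+ e) 1.
  by rewrite -[1 in X in regular _ X](expr1n _ e); apply/regularX/regular_cayley.
have cXC : regular (fun u => om * cayley u ^+ C) om.
  by rewrite -[om in X in regular _ X]mulr1; apply: (regularM (regular_cst om)).
have d1 : regular (fun u => 1 - cayley u ^+ B * (om * cayley u ^+ C)) (1 - om).
  by rewrite -[om in X in regular _ X]mul1r; apply: (regularB (regular_cst 1) (regularM (cX B) cXC)).
have d2 : regular (fun u => 1 - cayley u ^+ B / (om * cayley u ^+ C)) (1 - om^-1).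
  rewrite -[om^-1 in X in regular _ X]mul1r.
  by apply: (regularB (regular_cst 1) (regularM (cX B) (regularV om0 cXC))).
have d12 : (1 - om) * (1 - om^-1) != 0.
  by rewrite mulf_neq0 // subr_eq0 eq_sym // invr_eq1.
have := jet_regular (regularM (regular_sub_cayleyX (B * 2)) (regularV d12 (regularM d1 d2))).
rewrite [2 * _](_ : _ = 4 * B%:R); last by rewrite natrM; ring.
apply: eq_jet; apply: cofinitely_imp cofinitely_id _ => u u0.
have cancel_u (a d : K) : u ^+ 2 * (a / u / d) = u * (a / d).
  rewrite expr2 -mulrA; congr (_ * _); rewrite mulrA; congr (_ * _).
  by rewrite mulrC divfK.
by rewrite cancel_u /fourier_kernel exprM.
Qed.

(** For u = tanh t one has [cayley u] = exp(-2t), and this is tanh(B t). *)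
Definition tanh_cayley B u : K := (1 - cayley u ^+ B) / (1 + cayley u ^+ B).

Lemma cofinitely_cayleyX_neq1 e : (0 < e)%N -> cofinitely (fun u => cayley u ^+ e != 1).
Proof.
move=> e_gt0; apply: cofinitely_cayleyX => [|e0]; last by rewrite e0 in e_gt0.
by rewrite expf_neq0 // -[1 + 1]/(2%:R) pnatr_eq0.
Qed.

Lemma cofinitely_addr_cayleyX e : cofinitely (fun u => 1 + cayley u ^+ e != 0).
Proof.
have two_neq0 : 1 + 1 != 0 :> K by rewrite -[1 + 1]/(2%:R) pnatr_eq0.
apply: cofinitely_imp (@cofinitely_cayleyX (-1) e _ _) _ => [||u].
- by rewrite expf_neq0.
- by rewrite eq_sym -addr_eq0.
by rewrite addrC addr_eq0.
Qed.

(** Induction by the addition formula tanh((B+1)t) = (tanh(Bt) + u) / (1 + u tanh(Bt)). *)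
Lemma jet_tanh_cayley B :
  jet (fun u => tanh_cayley B u / u) B%:R ((B%:R - B%:R ^+ 3) / 3).
Proof.
elim: B => [|B IH].
  rewrite expr0n subrr mul0r; apply: eq_jet (jet_cst 0).
  by apply: cofinitelyT => u; rewrite /tanh_cayley expr0 subrr !mul0r.
have j1 := jetD IH (jet_cst 1).
have j2 := jetD (jet_cst 1) (jetM (jet_sqr K) IH).
have := jetM j1 (jetV _ j2); rewrite !(mul0r, mul1r, mulr0, addr0, add0r) => /(_ (oner_neq0 K)).
rewrite invr1 mulr1 expr1n divr1.
rewrite [X in jet _ _ X](_ : _ = (B.+1%:R - B.+1%:R ^+ 3) / 3); last first.
  by rewrite -!natr1; field.
rewrite natr1; apply: eq_jet.
apply: (cofinitely_and (cofinitely_and cofinitely_id cofinitely_addr1 (fun u => @conj _ _))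
  (cofinitely_and (cofinitely_addr_cayleyX B) (cofinitely_addr_cayleyX B.+1)
     (fun u => @conj _ _))) => u [u0 u1].
rewrite /tanh_cayley exprSr; move: (cayley u ^+ B) => X [X1 X2].
have E : (1 + X) + u * (1 - X) = (1 + u) * (1 + X * cayley u).
  by rewrite /cayley; field.
have E_neq0 : (1 + X) + u * (1 - X) != 0 by rewrite E mulf_neq0.
rewrite /cayley in X2 *; field; rewrite u0 u1 X1 andbT /=.
by have -> : 1 + u + X * (1 - u) = 1 + X + u * (1 - X) by ring.
Qed.

Lemma cofinitely_cayleyX_inj (B C : nat) : B != C ->
  cofinitely (fun u => cayley u ^+ B != cayley u ^+ C).
Proof.
move=> neq_BC; wlog lt_BC : B C neq_BC / (B < C)%N.
  move=> IH; case: (ltngtP B C) neq_BC => // [lt_BC|lt_CB] _.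
    by apply: IH; rewrite // ltn_eqF.
  by apply: cofinitely_imp (IH C B _ lt_CB) _ => [|u]; rewrite 1?ltn_eqF 1?eq_sym.
have CB_gt0 : (0 < C - B)%N by rewrite subn_gt0.
apply: (cofinitely_and cofinitely_cayley_neq0 (cofinitely_cayleyX_neq1 CB_gt0)).
move=> u w0; apply: contraNneq => E; apply/eqP/(mulfI (expf_neq0 B w0)).
by rewrite mulr1 -exprD subnKC ?(ltnW lt_BC).
Qed.

(** If S and T are the [tanh_cayley] of B and C, the kernel is S (1 - T^2) / (S^2 - T^2). Its
    expansion then follows from those of S/u and T/u. *)
Lemma jet_fourier_kernel_eq1 (B C : nat) : B != C ->
  let kappa : K := B%:R / (B%:R ^+ 2 - C%:R ^+ 2) in
  jet (fun u => u * fourier_kernel (cayley u ^+ B) (cayley u ^+ C))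
      kappa ((B%:R - kappa) / 3).
Proof.
move=> neq_BC kappa; pose b : K := B%:R; pose c : K := C%:R.
have bc : b ^+ 2 - c ^+ 2 != 0.
  by rewrite subr_eq0 -!natrX eqr_nat eqn_exp2r.
have jB := jet_tanh_cayley B; have jC := jet_tanh_cayley C.
have jBC := jetD (jetM jB jB) (jetM (jet_cst (-1)) (jetM jC jC)).
have j1 := jetD (jet_cst 1) (jetM (jet_cst (-1)) (jetM (jet_sqr K) (jetM jC jC))).
have nz : b * b + - 1 * (c * c) != 0.
  by rewrite mulN1r -!expr2.
have := jetM (jetM jB j1) (jetV nz jBC); rewrite -/b -/c.
rewrite [X in jet _ X _](_ : _ = kappa); last first.
  by rewrite /kappa -/b -/c; field; rewrite bc.
rewrite [X in jet _ _ X](_ : _ = (B%:R - kappa) / 3); last first.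
  by rewrite /kappa -/b -/c; field; rewrite bc.
apply: eq_jet.
have dBC := cofinitely_cayleyX_inj neq_BC.
have BC_gt0 : (0 < B + C)%N by rewrite addn_gt0; move: neq_BC; clear; case: B C => [|?] [|?].
apply: (cofinitely_and (cofinitely_and cofinitely_id cofinitely_cayley_neq0
    (fun u => @conj _ _)) (cofinitely_and (cofinitely_and dBC
      (cofinitely_cayleyX_neq1 BC_gt0) (fun u => @conj _ _))
    (cofinitely_and (cofinitely_addr_cayleyX B) (cofinitely_addr_cayleyX C)
     (fun u => @conj _ _)) (fun u => @conj _ _))) => u [u0 w0] [[XY]].
have : cayley u ^+ C != 0 by rewrite expf_neq0.
rewrite exprD /tanh_cayley /fourier_kernel.
move: (cayley u ^+ B) (cayley u ^+ C) XY => X Y XY Y0 XY1 [X1 Y1].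
have YX : Y - X != 0 by rewrite subr_eq0 eq_sym.
have XY1' : 1 - X * Y != 0 by rewrite subr_eq0 eq_sym.
field; rewrite Y0 YX XY1' u0 Y1 X1 /=.
rewrite (_ : _ + _ = 4 * (Y - X) * (1 - X * Y)); last by ring.
by rewrite !mulf_neq0 // pnatr_eq0.
Qed.
End KernelJets.

(** * Sums over roots of unity *)

Lemma expr_gcdn_eq1 (F : fieldType) (x : F) a b :
  x ^+ a = 1 -> x ^+ b = 1 -> x ^+ gcdn a b = 1.
Proof.
case: a => [|a] xa xb; first by rewrite gcd0n.
have [m _ /dvdnP[q E]] := Bezoutl b (ltn0Sn a).
have : x ^+ (gcdn a.+1 b + m * b) = 1 by rewrite E mulnC exprM xa expr1n.
by rewrite exprD mulnC exprM xb expr1n mulr1.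
Qed.

Lemma dvdn_gcd_vec n (f : 'I_n -> nat) i : (gcd_vec f %| f i)%N.
Proof. by rewrite /gcd_vec (bigD1 i) //= dvdn_gcdl. Qed.

Lemma expr_gcd_vec_eq1 (F : fieldType) (x : F) n (f : 'I_n -> nat) :
  (x ^+ gcd_vec f == 1) = [forall i, x ^+ f i == 1].
Proof.
apply/eqP/forallP => [E i|E].
  by have /dvdnP[q ->] := dvdn_gcd_vec f i; rewrite mulnC exprM E expr1n.
rewrite /gcd_vec; elim/big_ind: _ => [|a b|i _]; first exact: expr0.
  exact: expr_gcdn_eq1.
exact/eqP.
Qed.

Lemma expr_gcd_omit_eq1 (F : fieldType) (x : F) n (f : 'I_n -> nat) l :
  (x ^+ gcd_vec (omit f l) == 1) = [forall (k | k != l), x ^+ f k == 1].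
Proof.
rewrite expr_gcd_vec_eq1; apply/forallP/forall_inP => [E k|E i].
  by rewrite eq_sym => /unlift_some[i -> _]; apply: E.
by apply: E; rewrite eq_sym neq_lift.
Qed.

Section RootSums.
Variable K : numClosedFieldType.
Variable g : nat.
Hypothesis g_gt0 : (0 < g)%N.
Local Notation mu := (unity_roots K g).

Lemma unity_roots_reindex (h F : K -> K) : {in mu &, injective h} ->
  (forall z, z ^+ g = 1 -> h z ^+ g = 1) ->
  \sum_(z <- mu) F (h z) = \sum_(z <- mu) F z.
Proof.
move=> h_inj hmu; rewrite -[LHS](big_map h xpredT F); apply: perm_big.
have h_uniq : uniq (map h mu) by rewrite map_inj_in_uniq // unity_roots_uniq.
have h_sub : {subset map h mu <= mu}.
  move=> _ /mapP[z z_mu ->]; move: z_mu; rewrite !mem_unity_roots //.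
  by move=> /eqP/hmu/eqP.
have [|_ h_mem] := uniq_min_size h_uniq h_sub; first by rewrite size_map.
by apply: uniq_perm => //; apply: unity_roots_uniq.
Qed.

Lemma unity_root_neq0 (z : K) : z ^+ g = 1 -> z != 0.
Proof.
apply: contra_eq_neq => ->; rewrite expr0n gtn_eqF // eq_sym oner_neq0 //.
Qed.

(** Orthogonality of characters: multiplying the summation variable by z multiplies the sum by
    z^(i-j), which is not 1 for a suitable root z. *)
Lemma sum_unity_root_powers i j : (i < g)%N -> (j < g)%N ->
  \sum_(z <- mu) z ^+ i * z^-1 ^+ j = (i == j)%:R * g%:R.
Proof.
move=> lt_ig lt_jg.
have [<-|neq_ij] := eqVneq i j.
  rewrite mul1r (eq_big_seq (fun=> 1)) ?big_const_seq ?count_predT ?size_unity_roots //.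
    by rewrite iter_addr_0.
  move=> w; rewrite mem_unity_roots // => /eqP/unity_root_neq0 w0.
  by rewrite -exprMn mulfV ?expr1n.
(* The polynomial X^i - X^j is nonzero of degree less than g, so it cannot vanish at all g roots of
   unity. *)
have [z z1 z_neq] : exists2 z : K, z ^+ g = 1 & z ^+ i != z ^+ j.
  have p_neq0 : 'X^i - 'X^j != 0 :> {poly K}.
    apply/eqP => /(congr1 (fun p : {poly K} => p`_i)).
    rewrite coefB !coefXn coef0 eqxx (negPf neq_ij) subr0 => /eqP.
    by rewrite oner_eq0.
  have : ~~ all (root ('X^i - 'X^j)) mu.
    apply: contraNN p_neq0 => mu_roots; apply/eqP.
    apply: roots_geq_poly_eq0 mu_roots (unity_roots_uniq K g_gt0) _.
    rewrite size_unity_roots //; apply: leq_trans (size_polyD _ _) _.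
    by rewrite size_polyN !size_polyXn geq_max lt_ig.
  case/allPn => z; rewrite mem_unity_roots // => /eqP z1.
  by rewrite /root !hornerE subr_eq0; exists z.
have z_neq0 : z != 0 := unity_root_neq0 z1.
have zij : z ^+ i * z^-1 ^+ j != 1.
  apply: contraNneq z_neq; rewrite exprVn => /(canRL (mulfVK (expf_neq0 _ z_neq0))).
  by rewrite mul1r => ->.
have := @unity_roots_reindex (fun w => z * w) (fun w => w ^+ i * w^-1 ^+ j) _ _.
rewrite mul0r => /(_ _ _)/eqP.
rewrite (eq_bigr (fun w => z ^+ i * z^-1 ^+ j * (w ^+ i * w^-1 ^+ j))); last first.
  by move=> w _; rewrite invfM !exprMn; ring.
rewrite -mulr_sumr -subr_eq0 -{2}[\sum_(_ <- _) _]mul1r -mulrBl mulf_eq0 subr_eq0.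
rewrite (negPf zij) => E; apply/eqP/E => [w w' _ _|w w1].
  exact: mulfI.
by rewrite exprMn w1 z1 mulr1.
Qed.

(** The finite Fourier form of g / (w - 1), valid at each root of unity w <> 1. *)
Let weighted_sum (w : K) : K := \sum_(i < g) i%:R * w ^+ i.

Let weighted_sumE w : w ^+ g = 1 -> w != 1 -> (w - 1) * weighted_sum w = g%:R.
Proof.
move=> w1 neq_w1.
have sum0 : \sum_(i < g) w ^+ i = 0.
  have /eqP := subrX1 w g; rewrite w1 subrr eq_sym mulf_eq0 subr_eq0 (negPf neq_w1).
  by move/eqP.
have part m : (w - 1) * (\sum_(i < m) i%:R * w ^+ i) =
    m%:R * w ^+ m - w * \sum_(i < m) w ^+ i.
  elim: m => [|m IH]; first by rewrite !big_ord0; ring.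
  by rewrite !big_ord_recr /= mulrDr IH -natr1 exprS; ring.
by rewrite /weighted_sum part w1 sum0 mulr0 subr0 mulr1.
Qed.

(* Parseval's identity for [weighted_sum]. *)
Lemma sum_unity_roots_dedekind :
  \sum_(w <- mu | w != 1) ((1 - w) * (1 - w^-1))^-1 = (g%:R ^+ 2 - 1) / 12.
Proof.
have g_neq0 : g%:R != 0 :> K by rewrite pnatr_eq0 -lt0n.
have parseval : \sum_(w <- mu) weighted_sum w * weighted_sum w^-1 =
    g%:R * \sum_(i < g) i%:R ^+ 2.
  under eq_bigr => w _ do rewrite mulr_suml; rewrite exchange_big mulr_sumr /=.
  apply: eq_bigr => i _; under eq_bigr => w _ do rewrite mulr_sumr.
  rewrite exchange_big /= (bigD1 i) //= [X in _ + X]big1 ?addr0 => [|j neq_ji].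
    rewrite (eq_bigr (fun w => i%:R ^+ 2 * (w ^+ i * w^-1 ^+ i))); last by move=> w _; ring.
    by rewrite -mulr_sumr sum_unity_root_powers // eqxx mul1r mulrC.
  rewrite (eq_bigr (fun w => i%:R * j%:R * (w ^+ i * w^-1 ^+ j))); last by move=> w _; ring.
  by rewrite -mulr_sumr sum_unity_root_powers // eq_sym (negPf (neq_ji : j != i :> nat)) mul0r mulr0.
have sum1 m : \sum_(i < m) (i%:R : K) = m%:R * (m%:R - 1) / 2.
  elim: m => [|m IH]; first by rewrite big_ord0 !mul0r.
  by rewrite big_ord_recr /= IH -natr1; field.
have sum2 m : \sum_(i < m) (i%:R : K) ^+ 2 = m%:R * (m%:R - 1) * (2 * m%:R - 1) / 6.
  elim: m => [|m IH]; first by rewrite big_ord0 !mul0r.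
  by rewrite big_ord_recr /= IH -natr1; field.
have mu1 : 1 \in mu by rewrite mem_unity_roots // expr1n.
(* The term w = 1 is (g (g - 1) / 2)^2; removing it from g times the sum of the i^2 leaves g^2 (g^2
   - 1) / 12. *)
move: parseval; rewrite (bigD1_seq 1) ?unity_roots_uniq //= sum2 invr1.
have -> : weighted_sum 1 = g%:R * (g%:R - 1) / 2.
  by rewrite -sum1; apply: eq_bigr => i _; rewrite expr1n mulr1.
rewrite big_seq_cond (eq_bigr (fun w => g%:R ^+ 2 * ((1 - w) * (1 - w^-1))^-1)).
  rewrite -big_seq_cond -mulr_sumr => /(canRL (addKr _)) E.
  by apply: (mulfI (expf_neq0 2 g_neq0)); rewrite E; field.
move=> w /andP[]; rewrite mem_unity_roots // => /eqP w1 neq_w1.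
have w0 := unity_root_neq0 w1.
have E1 := weighted_sumE w1 neq_w1.
have E2 : (w^-1 - 1) * weighted_sum w^-1 = g%:R.
  by apply: weighted_sumE; rewrite ?exprVn ?w1 ?invr1 // invr_eq1.
have d1 : 1 - w != 0 by rewrite subr_eq0 eq_sym.
have d2 : 1 - w^-1 != 0 by rewrite subr_eq0 eq_sym invr_eq1.
apply: (mulIf (mulf_neq0 d1 d2)); rewrite mulfVK ?mulf_neq0 // expr2 -{1}E1 -E2; ring.
Qed.

End RootSums.

(** * Second order expansion of the residue sum *)

Section ThetaLead.
Variables (F : fieldType) (n : nat) (al B E : 'I_n -> nat).

(** The constant term of u times the kernel of index k at the node of index j with z = 1, where
    [E j] is B j / al j. *)
Definition kappa (j k : 'I_n) : F :=
  (B k)%:R / ((B k)%:R ^+ 2 - (E j * al k)%:R ^+ 2).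

Definition theta_lead : F :=
  \sum_(j | (0 < al j)%N) (al j)%:R^-1 * \prod_(k | k != j) kappa j k.

Definition theta_lead_omit (l : 'I_n) : F :=
  \sum_(j | (0 < al j)%N && (j != l))
    (al j)%:R^-1 * \prod_(k | (k != j) && (k != l)) kappa j k.

End ThetaLead.

Section ThetaExpansion.
Variables (K : numClosedFieldType) (n : nat) (al B E : 'I_n -> nat).
Hypothesis EB : forall j, (0 < al j)%N -> (E j * al j)%N = B j.
Hypothesis B_indep : forall j k, (0 < al j)%N -> k != j ->
  (B k * al j != B j * al k)%N.
Hypothesis gcd_al : gcd_vec al = 1%N.

(** The residue sum times u^(n-1): each of the n - 1 kernels has at most a simple pole at u = 0. *)
Definition theta (u : K) : K :=
  \sum_(j | (0 < al j)%N) (al j)%:R^-1 *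
    \sum_(z <- unity_roots K (al j)) \prod_(k | k != j)
      (u * fourier_kernel (cayley u ^+ B k) ((z * cayley u ^+ E j) ^+ al k)).

Local Notation kappa := (kappa K al B E).
Local Notation theta_lead := (theta_lead K al B E).
Local Notation theta_lead_omit := (theta_lead_omit K al B E).

Let second (j k : 'I_n) (om : K) : K :=
  if om == 1 then ((B k)%:R - kappa j k) / 3
  else 4 * (B k)%:R / ((1 - om) * (1 - om^-1)).

Lemma prod_if_forall (I : finType) (P b : pred I) (a : I -> K) :
  \prod_(k | P k) (if b k then a k else 0) =
  if [forall (k | P k), b k] then \prod_(k | P k) a k else 0.
Proof.
case: ifPn => [/forall_inP all_b|]; first by apply: eq_bigr => k /all_b ->.
by rewrite negb_forall_in => /exists_inP[k Pk /negPf bk]; rewrite (bigD1 k) //= bk mul0r.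
Qed.

Let jet_factor j z k : (0 < al j)%N -> z ^+ al j = 1 -> k != j ->
  jet (fun u => u * fourier_kernel (cayley u ^+ B k) ((z * cayley u ^+ E j) ^+ al k))
      (if z ^+ al k == 1 then kappa j k else 0) (second j k (z ^+ al k)).
Proof.
move=> al_j z1 neq_kj; rewrite /second.
have om0 : z ^+ al k != 0 by rewrite expf_neq0 ?(unity_root_neq0 al_j z1).
have BC : B k != (E j * al k)%N.
  apply: contra (B_indep al_j neq_kj) => /eqP ->.
  by rewrite -EB // mulnAC.
case: eqVneq => om1.
  apply: eq_jet (jet_fourier_kernel_eq1 K BC).
  by apply: cofinitelyT => u; rewrite [(z * _) ^+ _]exprMn om1 mul1r exprM.
apply: eq_jet (jet_fourier_kernel_neq1 (B k) (E j * al k) om0 om1).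
by apply: cofinitelyT => u; rewrite [(z * _) ^+ _]exprMn exprM.
Qed.

(** As g is prime to [al l], the map z |-> z^(al l) permutes the roots. The roots other than 1
    contribute 4 B_l (g^2 - 1) / 12, and the root 1 contributes (B_l - kappa) / 3. *)
Let sum_second j l g : (0 < g)%N -> coprime g (al l) -> 
  \sum_(z <- unity_roots K g) second j l (z ^+ al l) =
  (g%:R ^+ 2 * (B l)%:R - kappa j l) / 3.
Proof.
move=> g_gt0 co_g; rewrite (unity_roots_reindex g_gt0 (h := fun z => z ^+ al l)).
- have mu1 : 1 \in unity_roots K g by rewrite mem_unity_roots // expr1n.
  rewrite (bigD1_seq 1) ?unity_roots_uniq //= {1}/second eqxx.
  rewrite (eq_bigr (fun w => 4 * (B l)%:R * ((1 - w) * (1 - w^-1))^-1)); last first.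
    by move=> w /negPf w1; rewrite /second w1.
  by rewrite -mulr_sumr sum_unity_roots_dedekind //; field.
- move=> z z'; rewrite !mem_unity_roots // => /eqP z1 /eqP z'1 zz'.
  have z'0 := unity_root_neq0 g_gt0 z'1.
  apply: (mulIf (invr_neq0 z'0)); rewrite mulfV // -[LHS]expr1 -(eqP co_g).
  apply: expr_gcdn_eq1; first by rewrite exprMn exprVn z1 z'1 invr1 mulr1.
  by rewrite exprMn exprVn zz' mulfV ?expf_neq0.
by move=> z z1; rewrite exprAC z1 expr1n.
Qed.

Lemma gcd_omit_coprime l : coprime (gcd_vec (omit al l)) (al l).
Proof.
rewrite /coprime -dvdn1 -gcd_al /gcd_vec; apply/dvdn_biggcdP => k _.
have [->|] := eqVneq k l; first exact: dvdn_gcdr.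
rewrite eq_sym => /unlift_some[i -> _]; apply: dvdn_trans (dvdn_gcdl _ _) _.
exact: (dvdn_gcd_vec (omit al l)).
Qed.

Lemma gcd_omit_gt0 j l : (0 < al j)%N -> j != l -> (0 < gcd_vec (omit al l))%N.
Proof.
rewrite eq_sym => al_j /unlift_some[i ji _].
have := dvdn_gcd_vec (omit al l) i; rewrite /omit -ji => /dvdn_gt0; exact.
Qed.

(** A factor k with z^(al k) <> 1 has no constant term. Hence the leading coefficient only sees the
    z with z^(al k) = 1 for all k, that is z = 1 as the gcd is 1. In the coefficient of u^2 one
    index l is exempt, and z runs through the roots of unity of order dividing the gcd of the other
    weights. The term in n - 1 collects the [kappa j l], one for each l <> j. *)
Lemma jet_theta : jet theta theta_lead
  (3^-1 * (\sum_l (gcd_vec (omit al l))%:R ^+ 2 * (B l)%:R * theta_lead_omit l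
           - (n%:R - 1) * theta_lead)).
Proof.
pose first j (z : K) := \prod_(k | k != j) (if z ^+ al k == 1 then kappa j k else 0).
pose snd j (z : K) := \sum_(l | l != j) second j l (z ^+ al l) *
  \prod_(k | (k != j) && (k != l)) (if z ^+ al k == 1 then kappa j k else 0).
have : jet theta
    (\sum_(j | (0 < al j)%N) (al j)%:R^-1 * \sum_(z <- unity_roots K (al j)) first j z)
    (\sum_(j | (0 < al j)%N) (al j)%:R^-1 * \sum_(z <- unity_roots K (al j)) snd j z).
  apply: jet_sum => j al_j.
  have := jetM (jet_cst (al j)%:R^-1) (@jet_sum_seq K K (unity_roots K (al j)) _ (first j) (snd j) _).
  rewrite mul0r addr0; apply=> z; rewrite mem_unity_roots // => /eqP z1.
  apply: jet_prod => [|k neq_kj]; first exact: index_enum_uniq.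
  exact: jet_factor.
have -> : \sum_(j | (0 < al j)%N) (al j)%:R^-1 *
    \sum_(z <- unity_roots K (al j)) first j z = theta_lead.
  apply: eq_bigr => j al_j; congr (_ * _).
  have mu1 : 1 \in unity_roots K (al j) by rewrite mem_unity_roots // expr1n.
  rewrite (bigD1_seq 1) ?unity_roots_uniq //= [X in _ + X]big_seq_cond big1 ?addr0.
    by apply: eq_bigr => k _; rewrite expr1n eqxx.
  move=> z /andP[]; rewrite mem_unity_roots // => /eqP z1 neq_z1.
  rewrite /first prod_if_forall ifF //; apply: contraNF neq_z1 => /forall_inP all1.
  rewrite -[z]expr1 -gcd_al expr_gcd_vec_eq1; apply/forallP => k.
  by have [->|/all1 //] := eqVneq k j; rewrite z1.
rewrite [X in jet _ _ X](_ : _ = \sum_(j | (0 < al j)%N) (al j)%:R^-1 *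
    \sum_(l | l != j) (((gcd_vec (omit al l))%:R ^+ 2 * (B l)%:R - kappa j l) / 3 *
      \prod_(k | (k != j) && (k != l)) kappa j k)); last first.
  apply: eq_bigr => j al_j; congr (_ * _); rewrite exchange_big /=.
  apply: eq_bigr => l neq_lj; have neq_jl : j != l by rewrite eq_sym.
  have g_gt0 := gcd_omit_gt0 al_j neq_jl.
  rewrite -(sum_second j g_gt0 (gcd_omit_coprime l)) mulr_suml.
  rewrite [LHS](bigID (fun z : K => z ^+ gcd_vec (omit al l) == 1)) /=.
  rewrite [X in _ + X]big_seq_cond [X in _ + X]big1 ?addr0; last first.
    move=> z /andP[]; rewrite mem_unity_roots // => /eqP z1.
    rewrite expr_gcd_omit_eq1 prod_if_forall => /negPf not1; rewrite ifF ?mulr0 //.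
    apply: contraFF not1 => /forall_inP all1; apply/forall_inP => k neq_kl.
    by have [->|neq_kj] := eqVneq k j; rewrite ?z1 // all1 ?neq_kj.
  rewrite -big_filter [LHS](perm_big (unity_roots K (gcd_vec (omit al l)))) /=.
    apply: eq_big_seq => z; rewrite mem_unity_roots // expr_gcd_omit_eq1.
    move=> /forall_inP all1; congr (_ * _); rewrite prod_if_forall ifT //.
    by apply/forall_inP => k /andP[_ /all1].
  apply: uniq_perm; rewrite ?filter_uniq ?unity_roots_uniq // => z.
  rewrite mem_filter !mem_unity_roots // andb_idr // expr_gcd_omit_eq1.
  by move/forall_inP; apply.
suff -> : \sum_(j | (0 < al j)%N) (al j)%:R^-1 *
    \sum_(l | l != j) (((gcd_vec (omit al l))%:R ^+ 2 * (B l)%:R - kappa j l) / 3 *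
      \prod_(k | (k != j) && (k != l)) kappa j k) =
  3^-1 * (\sum_l (gcd_vec (omit al l))%:R ^+ 2 * (B l)%:R * theta_lead_omit l
           - (n%:R - 1) * theta_lead) by [].
transitivity (\sum_(j | (0 < al j)%N) 3^-1 * ((al j)%:R^-1 * (\sum_(l | l != j)
    (gcd_vec (omit al l))%:R ^+ 2 * (B l)%:R * \prod_(k | (k != j) && (k != l)) kappa j k)
    - (n%:R - 1) * ((al j)%:R^-1 * \prod_(k | k != j) kappa j k))).
  apply: eq_bigr => j al_j.
  have -> : (n%:R - 1) * ((al j)%:R^-1 * \prod_(k | k != j) kappa j k) =
      (al j)%:R^-1 * \sum_(l | l != j) kappa j l * \prod_(k | (k != j) && (k != l)) kappa j k.
    rewrite mulrCA; congr (_ * _).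
    rewrite [RHS](eq_bigr (fun=> \prod_(k | k != j) kappa j k)) => [|l neq_lj]; last first.
      by rewrite [RHS](bigD1 l).
    rewrite sumr_const cardC1 card_ord -[RHS]mulr_natl; congr (_ * _).
    by rewrite -[n in LHS](ltn_predK (ltn_ord j)) -natr1 addrK.
  rewrite -mulrBr mulrCA -sumrB; congr (_ * _); rewrite mulr_sumr.
  by apply: eq_bigr => l _; field.
rewrite -mulr_sumr; congr (_ * _); rewrite sumrB -mulr_sumr; congr (_ - _).
under eq_bigr => j _ do rewrite mulr_sumr.
rewrite (exchange_big_dep predT) //=; apply: eq_bigr => l _.
rewrite mulr_sumr; apply: eq_big => [j|j _]; first by rewrite eq_sym.
by rewrite mulrCA.
Qed.

End ThetaExpansion.

(** * Back from the Cayley parameter to y = 1 - x *)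

Section ChangeOfVariable.
Variable K : numFieldType.

Lemma cofinitely_opp (P : K -> Prop) :
  cofinitely P -> cofinitely (fun u => P (- u)).
Proof.
move=> [D D_neq0 PD]; exists (D \Po (- 'X)) => [|u].
  by rewrite comp_poly2_eq0 // size_polyN size_polyX.
by rewrite horner_comp !hornerE; apply: PD.
Qed.

(** Evenness gives P(u) Q(-u) + P(-u) Q(u) = 0 for the remainder u^3 P/Q; hence P(0) = 0 and one
    more power of u splits off. *)
Lemma jet_even (f : K -> K) a c :
  cofinitely (fun u => f (- u) = f u) -> jet f a c ->
  exists P Q : {poly K}, Q.[0] != 0 /\
    cofinitely (fun u => f u * Q.[u] = (a + c * u ^+ 2) * Q.[u] + u ^+ 4 * P.[u]).
Proof.
move=> f_even [P [Q [Q0 fPQ]]].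
have PQ0 : P * (Q \Po (- 'X)) + (P \Po (- 'X)) * Q = 0.
  apply: cofinitely_poly_eq; apply: (cofinitely_and (cofinitely_and f_even
    (cofinitely_id K) (fun u => @conj _ _)) (cofinitely_and fPQ (cofinitely_opp fPQ)
    (fun u => @conj _ _))) => u [fu u0] [E E'].
  rewrite !hornerE !horner_comp !hornerE; apply: (mulfI (expf_neq0 3 u0)).
  rewrite fu in E'.
  transitivity ((f u * Q.[u]) * Q.[- u] - (f u * Q.[- u]) * Q.[u]); last by ring.
  by rewrite E E'; ring.
have P0 : root P 0.
  have /(congr1 (fun p : {poly K} => p.[0])) := PQ0.
  rewrite !hornerE !horner_comp !hornerE oppr0 -mulr2n => /eqP.
  by rewrite mulrn_eq0 /= mulf_eq0 (negPf Q0) orbF.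
have [P1 P1E] := factor_theorem P 0 P0; exists P1, Q; split=> //.
by apply: cofinitely_imp fPQ _ => u ->; rewrite P1E hornerM hornerXsubC subr0; ring.
Qed.

(** The parameter u with [cayley u] = 1 - y. *)
Definition half_shift (y : K) : K := y / (2 - y).

Lemma cofinitely_sub2 : cofinitely (fun y : K => 2 - y != 0).
Proof.
have D : 2%:P - 'X != 0 :> {poly K}.
  apply: contraNneq (_ : (2 : K) != 0) => [/(congr1 (fun p : {poly K} => p.[0]))|].
    by rewrite hornerD hornerN hornerX hornerC subr0 horner0 => ->.
  by rewrite pnatr_eq0.
by apply: cofinitely_imp (cofinitely_neq0 D) _ => y; rewrite !hornerE.
Qed.

Lemma half_shift_poly (p : {poly K}) : exists (q : {poly K}) e,
  forall y : K, 2 - y != 0 -> q.[y] = (2 - y) ^+ e * p.[half_shift y].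
Proof.
elim/poly_ind: p => [|p c [q [e IH]]].
  by exists 0, 0%N => y _; rewrite !horner0 mulr0.
exists (q * 'X + c *: (2%:P - 'X) ^+ e.+1), e.+1 => y y2.
by rewrite !hornerE IH // /half_shift exprS /=; field.
Qed.

Lemma cofinitely_half_shift (P : K -> Prop) :
  cofinitely P -> cofinitely (fun y => P (half_shift y)).
Proof.
move=> [D D_neq0 PD]; have [q [e qE]] := half_shift_poly D.
have q_neq0 : q != 0.
  apply: contraNneq D_neq0 => q0; apply/eqP/poly_nat_eq0 => m.
  have m1 : 1 + m%:R != 0 :> K by rewrite -(natrD _ 1 m) pnatr_eq0.
  pose y : K := 2 * m%:R / (1 + m%:R).
  have y2E : 2 - y = 2 / (1 + m%:R) by rewrite /y; field.
  have y2 : 2 - y != 0 by rewrite y2E mulf_neq0 ?invr_eq0 ?pnatr_eq0.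
  have yE : half_shift y = m%:R by rewrite /half_shift y2E /y; field.
  have /eqP := qE y y2; rewrite q0 horner0 yE eq_sym mulf_eq0 => /orP[|/eqP //].
  by rewrite expf_eq0 (negPf y2) andbF.
apply: (cofinitely_and (cofinitely_neq0 q_neq0) cofinitely_sub2) => y qy y2.
by apply: PD; apply: contraNneq qy => Dy; rewrite qE // Dy mulr0.
Qed.

Lemma coef_mul_eq0 (D F : {poly K}) m : D.[0] != 0 ->
  (forall i, (i < m)%N -> (D * F)`_i = 0) -> forall i, (i < m)%N -> F`_i = 0.
Proof.
rewrite horner_coef0 => D0 DF i; elim/ltn_ind: i => i IH lt_im.
have := DF i lt_im; rewrite coefM big_ord_recl subn0 big1 ?addr0 => [/eqP|k _].
  by rewrite mulf_eq0 (negPf D0) => /eqP.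
by have := ltn_ord k; rewrite lift0 => lt_ki; rewrite IH ?mulr0 //; lia.
Qed.

(** The start of a + c u^2 at u = y / (2 - y), since u^2 = (y^2 + y^3) / 4 + O(y^4). Its missing
    linear term gives gamma_1 = 0, and its two equal coefficients give gamma_2 = gamma_3. *)
Definition even_series (a c : K) : {poly K} := a%:P + (c / 4) *: ('X^2 + 'X^3).

Lemma even_jet_series (f : K -> K) a c (T V : {poly K}) m :
  cofinitely (fun u => f (- u) = f u) -> jet f a c ->
  (forall i, (i < m)%N -> V`_i = 0) ->
  cofinitely (fun y => T.[y] = V.[y] * f (half_shift y)) ->
  forall i, (i < m + 4)%N -> T`_i = (V * even_series a c)`_i.
Proof.
move=> f_even jf V0 TV; have [P [Q [Q0 fPQ]]] := jet_even f_even jf.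
have [P1 [e1 P1E]] := half_shift_poly P; have [Q1 [e2 Q1E]] := half_shift_poly Q.
pose D := (2%:P - 'X) ^+ (e1 + 4) * Q1.
(* The second summand is due to y^2 / (2 - y)^2 - (y^2 + y^3) / 4 = y^4 (3 - y) / (4 (2 - y)^2). *)
pose N := (2%:P - 'X) ^+ e2 * P1 +
  (c / 4) *: ((3%:P - 'X) * (2%:P - 'X) ^+ (e1 + 2) * Q1).
have two_neq0 : (2 : K) != 0 by rewrite pnatr_eq0.
have D0 : D.[0] != 0.
  rewrite hornerM Q1E subr0 // /half_shift mul0r !hornerE /= subr0.
  by rewrite !mulf_neq0 // expf_neq0.
have DTV : D * (T - V * even_series a c) = 'X^4 * (V * N).
  apply: cofinitely_poly_eq; apply: (cofinitely_and (cofinitely_and TV cofinitely_sub2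
    (fun u => @conj _ _)) (cofinitely_half_shift fPQ)) => y [E y2] fE.
  rewrite /D /N /even_series !hornerE /= P1E // Q1E // E /half_shift in fE *.
  set v := y / (2 - y) in fE *.
  have -> : (2 - y) ^+ (e1 + 4) * ((2 - y) ^+ e2 * Q.[v]) *
     (V.[y] * f v - V.[y] * (a + c / 4 * (y ^+ 2 + y ^+ 3))) =
     (2 - y) ^+ (e1 + e2) * V.[y] * ((2 - y) ^+ 4 * (f v * Q.[v])
       - (2 - y) ^+ 4 * Q.[v] * (a + c / 4 * (y ^+ 2 + y ^+ 3))).
    by rewrite !exprD; ring.
  rewrite fE !exprD /v; field.
  by rewrite y2.
move=> i lt_i; apply/eqP; rewrite -subr_eq0 -coefB; apply/eqP.
apply: (coef_mul_eq0 D0 (m := m + 4)) => // k lt_k; rewrite DTV coefXnM.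
case: ltnP => // le_4k; rewrite coefM big1 // => j _; rewrite V0 ?mul0r //.
by have := ltn_ord j; rewrite ltnS; lia.
Qed.

End ChangeOfVariable.

Lemma rmorph_hilb_denom n (al : 'I_n -> nat) (S S' : comNzRingType)
    (f : {rmorphism S -> S'}) (x : 'I_n -> S) :
  f (hilb_denom al x) = hilb_denom al (f \o x).
Proof.
rewrite rmorph_prod; apply: eq_bigr => j _; rewrite rmorph_prod.
by apply: eq_bigr => k _; rewrite rmorphB rmorph1 rmorphM !rmorphXn.
Qed.

(** * The residue sum as a quotient of polynomials in y *)

Section ThetaSeries.
Variables (K : numClosedFieldType) (n : nat) (al B E : 'I_n -> nat).
Hypothesis al_gt0 : exists j, (0 < al j)%N.
Hypothesis EB : forall j, (0 < al j)%N -> (E j * al j)%N = B j.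
Hypothesis B_gt0 : forall j, (0 < B j)%N.
Hypothesis B_indep : forall j k, (0 < al j)%N -> k != j ->
  (B k * al j != B j * al k)%N.
Local Notation theta := (@theta K n al B E).

Lemma cayleyN (u : K) : cayley (- u) = (cayley u)^-1.
Proof. by rewrite /cayley opprK invf_div. Qed.

Lemma fourier_kernelV (x v : K) : x != 0 -> v != 0 ->
  fourier_kernel x^-1 v^-1 = - fourier_kernel x v.
Proof.
move=> x0 v0; rewrite /fourier_kernel invrK.
have -> : (1 - x^-1 * v^-1) * (1 - x^-1 * v) = (1 - x * v) * (1 - x / v) / x ^+ 2.
  by field; rewrite x0.
rewrite invfM invrK mulrCA -[RHS]mulNr [RHS]mulrC; congr (_ * _).
by field.
Qed.

(** The change u |-> -u inverts q. After z |-> 1/z each kernel changes sign, and so does the factor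
    u in front of it. *)
Lemma theta_even : cofinitely (fun u => theta (- u) = theta u).
Proof.
apply: cofinitely_imp (cofinitely_cayley_neq0 K) _ => u w0.
apply: eq_bigr => j al_j; congr (_ * _).
rewrite -[RHS](unity_roots_reindex al_j (h := fun z => z^-1)).
- apply: eq_big_seq => z; rewrite mem_unity_roots // => /eqP z1.
  have z0 := unity_root_neq0 al_j z1.
  apply: eq_bigr => k _; rewrite cayleyN !exprVn.
  have -> : z / cayley u ^+ E j = (z^-1 * cayley u ^+ E j)^-1.
    by rewrite invfM invrK.
  have d0 : z^-1 * cayley u ^+ E j != 0 by rewrite mulf_neq0 ?invr_eq0 // expf_neq0.
  by rewrite exprVn fourier_kernelV ?mulrNN // expf_neq0.
- by move=> z z' _ _; apply: invr_inj.
by move=> z z1; rewrite exprVn z1 invr1.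
Qed.

(** With [theta_den], a fraction for [theta] at x_k = (1 - y)^(b k): the powers of y and 2 - y come
    from u^(n-1), and each weight 0 brings (1 - x_k^2) / (1 - x_k)^2. Both polynomials make sense
    for all b, in particular for b = 1, where poles may collide. *)
Definition theta_num (Phi : {mpoly int[n]}) (b : 'I_n -> nat) : {poly K} :=
  'X^(n.-1) * evz (fun k => (1 - 'X) ^+ b k) Phi *
  \prod_k (1 - (1 - 'X) ^+ (b k * 2)).

Definition theta_den (b : 'I_n -> nat) : {poly K} :=
  (2%:P - 'X) ^+ n.-1 * hilb_denom al (fun k => (1 - 'X) ^+ b k) *
  \prod_(k | al k == 0%N) (1 - (1 - 'X) ^+ b k) ^+ 2.

Lemma theta_numE (Phi : {mpoly int[n]}) :
  (forall (K : fieldType) (x : 'I_n -> K) (I : eqType) (s : seq I) (e p : I -> K),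
     (forall r, \sum_(k < r.+1) (kernel_poly al x)`_k *
         (\sum_(i <- s) e i * p i ^+ (r - k)) = (r == 0%N)%:R) ->
     {in s, forall i, (dual_kernel_poly al x).[p i] = 0} ->
     {in s, forall i, (kernel_poly al x).[p i] != 0} ->
     evz x Phi = hilb_denom al x * \sum_(i <- s) e i / (kernel_poly al x).[p i]) ->
  cofinitely (fun y => (theta_num Phi B).[y] = (theta_den B).[y] * theta (half_shift y)).
Proof.
move=> PhiP.
have cI (j k : 'I_n) : cofinitely (fun u : K => (0 < al j)%N -> k != j ->
    cayley u ^+ (B k * al j) != cayley u ^+ (B j * al k)).
  case: (boolP ((0 < al j)%N && (k != j))) => [/andP[al_j neq_kj]|no]; last first.
    by apply: cofinitelyT => u al_j neq_kj; rewrite al_j neq_kj in no.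
  by apply: cofinitely_imp (cofinitely_cayleyX_inj K (B_indep al_j neq_kj)) _.
have cS (j k : 'I_n) : cofinitely (fun u : K => (0 < al j)%N ->
    cayley u ^+ (B k * al j + B j * al k) != 1).
  case: (posnP (al j)) => [->|al_j]; first exact: cofinitelyT.
  have e_gt0 : (0 < B k * al j + B j * al k)%N by rewrite addn_gt0 muln_gt0 B_gt0 al_j.
  by apply: cofinitely_imp (cofinitely_cayleyX_neq1 K e_gt0) _.
have cB (k : 'I_n) : cofinitely (fun u : K => cayley u ^+ B k != 1).
  exact: cofinitely_cayleyX_neq1.
have := cofinitely_half_shift (cofinitely_and (cofinitely_and
  (cofinitely_fin (fun j => cofinitely_fin (cI j)))
  (cofinitely_fin (fun j => cofinitely_fin (cS j))) (fun u => @conj _ _))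
  (cofinitely_and (cofinitely_fin cB) (cofinitely_cayley_neq0 K) (fun u => @conj _ _))
  (fun u => @conj _ _)).
move/cofinitely_and => /(_ _ _ (cofinitely_sub2 K)); apply=> y [[xI xS] [xB w0]] y2.
have wE : cayley (half_shift y) = 1 - y.
  have two_neq0 : (2 : K) != 0 by rewrite pnatr_eq0.
  rewrite /cayley /half_shift.
  have -> : 1 + y / (2 - y) = 2 / (2 - y) by field.
  by field; rewrite y2.
set u := half_shift y in xI xS xB w0 wE *; set w := cayley u in xI xS xB w0 wE *.
pose x k := w ^+ B k; pose q k := w ^+ E k.
have evE (p : {poly K}) : p.[y] = horner_eval y p by [].
have xE k : ((1 - 'X) ^+ B k).[y] = x k by rewrite !hornerE -wE.
have evP : (evz (fun k => (1 - 'X) ^+ B k) Phi).[y] = evz x Phi.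
  rewrite evE evz_morph; congr (mmap _ _ _); apply: funext => k /=.
  exact: xE.
have evW : (hilb_denom al (fun k => (1 - 'X) ^+ B k)).[y] = hilb_denom al x.
  rewrite evE rmorph_hilb_denom; congr hilb_denom; apply: funext => k /=.
  exact: xE.
have qx j : (0 < al j)%N -> q j ^+ al j = x j.
  by move=> al_j; rewrite /q /x -exprM EB.
have q_neq0 j : q j != 0 by rewrite expf_neq0.
have x_indep j k : (0 < al j)%N -> (0 < al k)%N -> j != k ->
    x j ^+ al k != x k ^+ al j.
  by move=> al_j _ neq_jk; rewrite /x -!exprM eq_sym xI // eq_sym.
have x_small j k : (0 < al j)%N -> (0 < al k)%N -> x j ^+ al k * x k ^+ al j != 1.
  by move=> al_j _; rewrite /x -!exprM -exprD addnC xS.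
have {x_indep x_small q_neq0} key := sum_fourier_kernels al_gt0 q_neq0 qx x_indep x_small PhiP.
pose zeros := \prod_(k | al k == 0%N) ((1 - x k ^+ 2) / (1 - x k) ^+ 2).
have thetaE : theta u = u ^+ n.-1 * zeros *
    \sum_(j | (0 < al j)%N) (al j)%:R^-1 *
    \sum_(z <- unity_roots K (al j)) \prod_(k | (0 < al k)%N && (k != j))
       fourier_kernel (x k) ((z * q j) ^+ al k).
  rewrite mulr_sumr; apply: eq_bigr => j al_j; rewrite mulrCA; congr (_ * _).
  rewrite mulr_sumr; apply: eq_bigr => z _; rewrite big_split /=.
  rewrite prodr_const cardC1 card_ord -mulrA; congr (_ * _).
  rewrite (bigID (fun k => al k == 0%N)) /=; congr (_ * _); last first.
    by apply: eq_bigl => k; rewrite -lt0n andbC.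
  apply: eq_big => [k|k /andP[_ /eqP al_k]].
    by rewrite andb_idl // => /eqP al_k; apply: contraTneq al_j => <-; rewrite al_k.
  by rewrite /fourier_kernel al_k expr0 divr1 mulr1 expr2.
have numE : (\prod_k (1 - (1 - 'X) ^+ (B k * 2))).[y] =
    \prod_(k | al k == 0%N) (1 - x k ^+ 2) * \prod_(k | (0 < al k)%N) (1 - x k ^+ 2).
  rewrite horner_prod (bigID (fun k => al k == 0%N)) /=; congr (_ * _).
    by apply: eq_bigr => k _; rewrite hornerD hornerN hornerC exprM horner_exp xE.
  apply: eq_big => k; first by rewrite -lt0n.
  by rewrite hornerD hornerN hornerC exprM horner_exp xE.
have denE : (\prod_(k | al k == 0%N) (1 - (1 - 'X) ^+ B k) ^+ 2).[y] =
    \prod_(k | al k == 0%N) (1 - x k) ^+ 2.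
  rewrite horner_prod; apply: eq_bigr => k _.
  by rewrite horner_exp hornerD hornerN hornerC xE.
have zerosE : \prod_(k | al k == 0%N) (1 - x k) ^+ 2 * zeros =
    \prod_(k | al k == 0%N) (1 - x k ^+ 2).
  rewrite -big_split; apply: eq_bigr => k _ /=; rewrite mulrC divfK //.
  by rewrite expf_neq0 // subr_eq0 eq_sym xB.
have yE : ((2%:P - 'X) ^+ n.-1).[y] * u ^+ n.-1 = y ^+ n.-1.
  rewrite horner_exp hornerD hornerN hornerX hornerC -exprMn /u /half_shift.
  by rewrite mulrC divfK.
rewrite /theta_num /theta_den !hornerM evP evW thetaE numE denE hornerXn -yE.
transitivity (((2%:P - 'X) ^+ n.-1).[y] * u ^+ n.-1 * \prod_(k | al k == 0%N) (1 - x k ^+ 2)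
  * (evz x Phi * \prod_(k | (0 < al k)%N) (1 - x k ^+ 2))); first by ring.
by rewrite key -zerosE; ring.
Qed.

End ThetaSeries.

(** * Rational dependence on the scaling parameter s *)

Section RationalLimit.
Variables (K : numFieldType) (good : pred nat).
Hypothesis good_unbounded : forall m, exists2 s, (m <= s)%N & good s.

Definition eventually (P : nat -> Prop) :=
  cofinitely (fun x : K => forall s : nat, x = s%:R -> good s -> P s).

Lemma eventuallyT (P : nat -> Prop) : (forall s, good s -> P s) -> eventually P.
Proof. by move=> allP; apply: cofinitelyT => x s _ /allP. Qed.

Lemma eventually_and (P1 P2 P : nat -> Prop) : eventually P1 -> eventually P2 ->
  (forall s, P1 s -> P2 s -> P s) -> eventually P.
Proof.
move=> e1 e2 P12; apply: (cofinitely_and e1 e2) => x p1 p2 s xs gs.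
by apply: P12; [apply: p1 xs gs|apply: p2 xs gs].
Qed.

Lemma eventually_poly (p : {poly K}) : p != 0 -> eventually (fun s => p.[s%:R] != 0).
Proof.
by move=> p_neq0; apply: cofinitely_imp (cofinitely_neq0 p_neq0) _ => x px s <-.
Qed.

Lemma poly_good_eq0 (p : {poly K}) : (forall s, good s -> p.[s%:R] = 0) -> p = 0.
Proof.
move=> p0.
have [rs [rs_good rs_uniq rs_size]] : exists rs : seq nat,
    [/\ all good rs, uniq rs & size rs = size p].
  elim: (size p) => [|k [rs [rs_good rs_uniq rs_size]]]; first by exists [::].
  have [s le_s gs] := good_unbounded (\max_(i <- rs) i).+1.
  exists (s :: rs); rewrite /= gs rs_good rs_uniq rs_size; split=> //.
  rewrite andbT; apply/negP => rs_s.
  have : (s <= \max_(i <- rs) i)%N by rewrite (big_rem s) //= leq_maxl.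
  by rewrite leqNgt le_s.
apply: (@roots_geq_poly_eq0 _ p [seq s%:R | s <- rs]).
- by apply/allP => _ /mapP[s /(allP rs_good) gs ->]; rewrite /root p0.
- by rewrite map_inj_uniq // => m m' /eqP; rewrite eqr_nat => /eqP.
by rewrite size_map rs_size.
Qed.

Lemma eventually_poly_eq (p q : {poly K}) :
  eventually (fun s => p.[s%:R] = q.[s%:R]) -> p = q.
Proof.
move=> [D D_neq0 pq]; apply/eqP; rewrite -subr_eq0.
have /eqP : D * (p - q) = 0.
  apply: poly_good_eq0 => s gs; rewrite hornerM hornerD hornerN.
  have [->|/pq/(_ s erefl gs) ->] := eqVneq D.[s%:R] 0; first by rewrite mul0r.
  by rewrite subrr mulr0.
by rewrite mulf_eq0 (negPf D_neq0).
Qed.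

(* [rational_limit f v]: [f] agrees, at the good integers but finitely many of
   them, with a rational function regular at 0, whose value at 0 is [v]. *)
Definition rational_limit (f : nat -> K) (v : K) := exists p q : {poly K},
  [/\ q.[0] != 0, p.[0] = v * q.[0] & eventually (fun s => f s * q.[s%:R] = p.[s%:R])].

Lemma rational_limit_uniq f v w : rational_limit f v -> rational_limit f w -> v = w.
Proof.
move=> [p [q [q0 pq0 fpq]]] [p' [q' [q'0 pq'0 fpq']]].
have /(congr1 (fun p : {poly K} => p.[0])) : p * q' = p' * q.
  apply: eventually_poly_eq; apply: (eventually_and fpq fpq') => s E E'.
  by rewrite !hornerM -E -E' mulrAC.
rewrite !hornerM pq0 pq'0 -!mulrA [q'.[0] * _]mulrC => /mulIf; apply.
by rewrite mulf_neq0.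
Qed.

Lemma eq_rational_limit f g v : eventually (fun s => f s = g s) ->
  rational_limit f v -> rational_limit g v.
Proof.
move=> fg [p [q [q0 pq0 fpq]]]; exists p, q; split=> //.
by apply: (eventually_and fg fpq) => s ->.
Qed.

Lemma rational_limit_poly (p : {poly K}) : rational_limit (fun s => p.[s%:R]) p.[0].
Proof.
exists p, 1; rewrite hornerC oner_neq0 mulr1; split=> //.
by apply: eventuallyT => s _; rewrite hornerC mulr1.
Qed.

Lemma rational_limit_cst c : rational_limit (fun=> c) c.
Proof.
have := rational_limit_poly c%:P; rewrite hornerC; apply: eq_rational_limit.
by apply: eventuallyT => s _; rewrite hornerC.
Qed.

Lemma rational_limitD f g v w : rational_limit f v -> rational_limit g w ->
  rational_limit (fun s => f s + g s) (v + w).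
Proof.
move=> [p [q [q0 pq0 fpq]]] [p' [q' [q'0 pq'0 fpq']]].
exists (p * q' + p' * q), (q * q'); split; first by rewrite hornerM mulf_neq0.
  by rewrite !(hornerD, hornerM) pq0 pq'0; ring.
by apply: (eventually_and fpq fpq') => s E E'; rewrite !(hornerD, hornerM) -E -E'; ring.
Qed.

Lemma rational_limitM f g v w : rational_limit f v -> rational_limit g w ->
  rational_limit (fun s => f s * g s) (v * w).
Proof.
move=> [p [q [q0 pq0 fpq]]] [p' [q' [q'0 pq'0 fpq']]].
exists (p * p'), (q * q'); split; first by rewrite hornerM mulf_neq0.
  by rewrite !(hornerD, hornerM) pq0 pq'0; ring.
by apply: (eventually_and fpq fpq') => s E E'; rewrite !(hornerD, hornerM) -E -E'; ring.
Qed.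

Lemma rational_limitV f v : v != 0 -> rational_limit f v ->
  rational_limit (fun s => (f s)^-1) v^-1.
Proof.
move=> v0 [p [q [q0 pq0 fpq]]].
have p0 : p.[0] != 0 by rewrite pq0 mulf_neq0.
have p_neq0 : p != 0 by apply: contraNneq p0 => ->; rewrite horner0.
exists q, p; split=> //; first by rewrite pq0 mulKf.
apply: (eventually_and fpq (eventually_poly p_neq0)) => s <-.
by rewrite mulf_eq0 negb_or => /andP[fs _]; rewrite mulKf.
Qed.

Lemma rational_limit_sum (I : Type) (r : seq I) (P : pred I) (f : I -> nat -> K) (v : I -> K) :
  (forall i, P i -> rational_limit (f i) (v i)) ->
  rational_limit (fun s => \sum_(i <- r | P i) f i s) (\sum_(i <- r | P i) v i).
Proof.
move=> fv; elim: r => [|i r IH].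
  rewrite big_nil; apply: eq_rational_limit (rational_limit_cst 0).
  by apply: eventuallyT => s _; rewrite big_nil.
rewrite big_cons; case: ifP => Pi; last first.
  by apply: eq_rational_limit IH; apply: eventuallyT => s _; rewrite big_cons Pi.
apply: eq_rational_limit (rational_limitD (fv _ Pi) IH).
by apply: eventuallyT => s _; rewrite big_cons Pi.
Qed.

Lemma rational_limit_prod (I : Type) (r : seq I) (P : pred I) (f : I -> nat -> K) (v : I -> K) :
  (forall i, P i -> rational_limit (f i) (v i)) ->
  rational_limit (fun s => \prod_(i <- r | P i) f i s) (\prod_(i <- r | P i) v i).
Proof.
move=> fv; elim: r => [|i r IH].
  rewrite big_nil; apply: eq_rational_limit (rational_limit_cst 1).
  by apply: eventuallyT => s _; rewrite big_nil.
rewrite big_cons; case: ifP => Pi; last first.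
  by apply: eq_rational_limit IH; apply: eventuallyT => s _; rewrite big_cons Pi.
apply: eq_rational_limit (rational_limitM (fv _ Pi) IH).
by apply: eventuallyT => s _; rewrite big_cons Pi.
Qed.

Lemma rational_limitX f v e : rational_limit f v ->
  rational_limit (fun s => f s ^+ e) (v ^+ e).
Proof.
move=> fv; elim: e => [|e IH]; first exact: rational_limit_cst.
rewrite exprS; apply: eq_rational_limit (rational_limitM fv IH).
by apply: eventuallyT => s _; rewrite exprS.
Qed.

Lemma rational_limit_meval m (p : {mpoly K[m]}) (f : 'I_m -> nat -> K) (v : 'I_m -> K) :
  (forall i, rational_limit (f i) (v i)) ->
  rational_limit (fun s => p.@[fun i => f i s]) p.@[v].
Proof.
move=> fv; rewrite mevalE; apply: eq_rational_limit (rational_limit_sum (msupp p)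
  (P := xpredT) (fun t _ => rational_limitM (rational_limit_cst p@_t)
    (rational_limit_prod (index_enum 'I_m) (P := xpredT)
      (fun i _ => rational_limitX (t i) (fv i))))).
by apply: eventuallyT => s _; rewrite mevalE.
Qed.

Definition coef_polynomial (F : nat -> {poly K}) :=
  forall i, exists p : {poly K}, forall s, (F s)`_i = p.[s%:R].

Lemma coef_polynomial_limit F i : coef_polynomial F ->
  rational_limit (fun s => (F s)`_i) (F 0%N)`_i.
Proof.
move=> /(_ i)[p pE]; rewrite pE; apply: eq_rational_limit (rational_limit_poly p).
by apply: eventuallyT => s _; rewrite pE.
Qed.

Lemma coef_polynomial_cst c : coef_polynomial (fun=> c).
Proof. by move=> i; exists (c`_i)%:P => s; rewrite hornerC. Qed.

Lemma coef_polynomialB F G : coef_polynomial F -> coef_polynomial G ->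
  coef_polynomial (fun s => F s - G s).
Proof.
move=> Fp Gp i; have [p pE] := Fp i; have [q qE] := Gp i.
by exists (p - q) => s; rewrite coefB pE qE hornerD hornerN.
Qed.

Lemma coef_polynomial_sum (I : Type) (r : seq I) (F : I -> nat -> {poly K}) :
  (forall i, coef_polynomial (F i)) -> coef_polynomial (fun s => \sum_(i <- r) F i s).
Proof.
move=> Fp k; elim: r => [|i r [q qE]].
  by exists 0 => s; rewrite big_nil coef0 horner0.
have [p pE] := Fp i k.
by exists (p + q) => s; rewrite big_cons coefD pE qE hornerD.
Qed.

Lemma coef_polynomialM F G : coef_polynomial F -> coef_polynomial G ->
  coef_polynomial (fun s => F s * G s).
Proof.
move=> Fp Gp i; have [p pE] := choice Fp; have [q qE] := choice Gp.
exists (\sum_(k < i.+1) p k * q (i - k)%N) => s.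
by rewrite coefM horner_sum; apply: eq_bigr => k _; rewrite pE qE hornerM.
Qed.

Lemma coef_polynomialX F e : coef_polynomial F -> coef_polynomial (fun s => F s ^+ e).
Proof.
move=> Fp; elim: e => [|e IH]; first exact: coef_polynomial_cst.
move=> i; have [p pE] := coef_polynomialM Fp IH i.
by exists p => s; rewrite exprS pE.
Qed.

Lemma coef_polynomial_prod (I : Type) (r : seq I) (P : pred I) (F : I -> nat -> {poly K}) :
  (forall i, coef_polynomial (F i)) ->
  coef_polynomial (fun s => \prod_(i <- r | P i) F i s).
Proof.
move=> Fp; elim: r => [|i r IH] k.
  by have [p pE] := coef_polynomial_cst 1 k; exists p => s; rewrite big_nil -pE.
case: (boolP (P i)) => Pi; last first.
  by have [p pE] := IH k; exists p => s; rewrite big_cons (negPf Pi) pE.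
have [p pE] := coef_polynomialM (Fp i) IH k.
by exists p => s; rewrite big_cons Pi pE.
Qed.

Lemma binomial_poly l : exists p : {poly K}, forall s, 'C(s, l)%:R = p.[s%:R].
Proof.
elim: l => [|l [p pE]]; first by exists 1 => s; rewrite bin0 hornerC.
have l_neq0 : l.+1%:R != 0 :> K by rewrite pnatr_eq0.
exists (l.+1%:R^-1 *: (('X - l%:R%:P) * p)) => s.
rewrite hornerZ hornerM hornerD hornerN hornerX hornerC -pE; apply: (mulfI l_neq0).
rewrite mulVKf // -natrM mul_bin_left natrM.
case: (leqP l s) => [le_ls|lt_sl]; first by rewrite natrB.
by rewrite bin_small // !mulr0.
Qed.

(** In (1 + X h)^s the coefficient of X^i only involves the binomials C(s, l) with l <= i, which are
    polynomials in s. *)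
Lemma coef_polynomial_exp (F : {poly K}) a b : F`_0 = 1 ->
  coef_polynomial (fun s => F ^+ (a + b * s)).
Proof.
move=> F0.
suff Fs : coef_polynomial (fun s => (F ^+ b) ^+ s).
  move=> i; have [p pE] := coef_polynomialM (coef_polynomial_cst (F ^+ a)) Fs i.
  by exists p => s; rewrite exprD exprM pE.
have : (F ^+ b)`_0 = 1 by rewrite -horner_coef0 horner_exp horner_coef0 F0 expr1n.
move: (F ^+ b) => {F F0} F F0.
have [h hE] : exists h, F = 1 + 'X * h.
  have /factor_theorem[h hE] : root (F - 1) 0.
    by rewrite /root hornerD hornerN hornerC horner_coef0 F0 subrr.
  by exists h; rewrite mulrC -['X]subr0 -hE addrC subrK.
move=> i; have [p pE] := choice binomial_poly.
exists (\sum_(l < i.+1) (('X * h) ^+ l)`_i *: p l) => s.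
rewrite hE exprDn_comm; last by rewrite /GRing.comm mul1r mulr1.
rewrite horner_sum coef_sum.
pose G l := (('X * h) ^+ l)`_i * 'C(s, l)%:R.
(* A range containing both l <= s and l <= i: the terms vanish for l > s by the binomial, and for l
   > i by the factor X^l. *)
transitivity (\sum_(l < s.+1 + i.+1) G l).
  rewrite big_split_ord /= [X in _ + X]big1 ?addr0.
    by apply: eq_bigr => l _; rewrite expr1n mul1r coefMn /G mulr_natr.
  by move=> l _; rewrite /G bin_small ?mulr0 // leq_addr.
rewrite addnC big_split_ord /= [X in _ + X]big1 ?addr0.
  by apply: eq_bigr => l _; rewrite hornerZ -pE.
by move=> l _; rewrite /G exprMn coefXnM leq_addr mul0r.
Qed.

End RationalLimit.

Section OrderAtZero.
Variable K : fieldType.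

Definition order_at0 m (p : {poly K}) := exists2 r : {poly K}, p = 'X^m * r & r.[0] != 0.

Lemma order_at0M m m' (p q : {poly K}) : order_at0 m p -> order_at0 m' q ->
  order_at0 (m + m') (p * q).
Proof.
move=> [r -> r0] [r' -> r'0]; exists (r * r'); last by rewrite hornerM mulf_neq0.
by rewrite exprD; ring.
Qed.

Lemma order_at0_prod (I : Type) (s : seq I) (P : pred I) (m : I -> nat) (p : I -> {poly K}) :
  (forall i, P i -> order_at0 (m i) (p i)) ->
  order_at0 (\sum_(i <- s | P i) m i) (\prod_(i <- s | P i) p i).
Proof.
move=> mp; elim/big_rec2: _ => [|i m' p' /mp/order_at0M]; last exact.
by exists 1; rewrite ?mulr1 // hornerC oner_neq0.
Qed.

Lemma order_at0_coef m p : order_at0 m p ->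
  (forall i, (i < m)%N -> p`_i = 0) /\ p`_m != 0.
Proof.
move=> [r -> r0]; split=> [i lt_im|]; first by rewrite coefXnM lt_im.
by rewrite coefXnM ltnn subnn -horner_coef0.
Qed.

End OrderAtZero.

Lemma order_at0_1subX (K : numFieldType) c : (0 < c)%N ->
  order_at0 1 (1 - (1 - 'X) ^+ c : {poly K}).
Proof.
move=> c_gt0; exists (\sum_(i < c) (1 - 'X) ^+ i).
  by rewrite -[LHS]opprB subrX1 -mulNr opprB opprD opprK addNKr expr1.
rewrite horner_sum (eq_bigr (fun=> 1)) => [|i _].
  by rewrite sumr_const card_ord pnatr_eq0 -lt0n.
by rewrite horner_exp hornerD hornerN hornerX hornerC subr0 expr1n.
Qed.

(** * Admissible exponents and the passage to s = 0 *)

Section Family.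
Variables (n : nat) (al : 'I_n -> nat).

Definition prod_weights : nat := \prod_(j | (0 < al j)%N) al j.

(* At the good values of [s] the exponents [scale s] are divisible by all
   nonzero weights, and the ratios [al j / scale s j] are pairwise distinct. *)
Definition scale (s : nat) (k : 'I_n) : nat := 1 + (1 + prod_weights * k.+1) * s.
Definition coscale (s : nat) (j : 'I_n) : nat := scale s j %/ al j.
Definition good_scale : pred nat :=
  [pred s | ((\sum_j al j).*2 < s)%N && (prod_weights %| s.+1)%N].

Lemma prod_weights_gt0 : (0 < prod_weights)%N.
Proof. exact: prodn_cond_gt0. Qed.

Lemma good_scale_unbounded m : exists2 s, (m <= s)%N & good_scale s.
Proof.
pose N := (m + (\sum_j al j).*2).+2; pose L := prod_weights.
have le_N : (N <= L * N)%N by rewrite leq_pmull // prod_weights_gt0.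
have NL : (0 < L * N)%N by apply: leq_trans le_N.
exists (L * N).-1; first by rewrite -ltnS prednK // (leq_trans _ le_N) // /N !ltnS leqW ?leq_addr.
rewrite /good_scale /= prednK // dvdn_mulr // andbT -ltnS prednK //.
by rewrite (leq_trans _ le_N) // /N !ltnS leq_addl.
Qed.

Lemma scale_gt0 s k : (0 < scale s k)%N. Proof. by []. Qed.

Lemma scale0 k : scale 0 k = 1%N. Proof. by rewrite /scale muln0. Qed.

(** With L = [prod_weights], [scale s j] is (s + 1) + L (j + 1) s, and L divides both terms for good
    s. *)
Lemma coscaleE s j : good_scale s -> (0 < al j)%N -> (coscale s j * al j)%N = scale s j.
Proof.
case/andP => _ dvd_L al_j; apply: divnK.
have dvd_al : (al j %| prod_weights)%N by rewrite /prod_weights (bigD1 j) //= dvdn_mulr.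
rewrite /scale mulnDl mul1n addnA add1n dvdn_add ?(dvdn_trans dvd_al) //.
by rewrite -mulnA dvdn_mulr.
Qed.

(** With X = 1 + L (k + 1) and Y = 1 + L (j + 1), an equality would read al j - al k = s (Y al k - X
    al j). As s exceeds al j + al k, both sides vanish, whence al j = al k and X = Y. *)
Lemma scale_indep s j k : good_scale s -> (0 < al j)%N -> k != j ->
  (scale s k * al j != scale s j * al k)%N.
Proof.
case/andP => s_big _ al_j neq_kj.
have le_al i : (al i <= \sum_i al i)%N by rewrite (bigD1 i) //= leq_addr.
have s_big' : (al j + al k < s)%N.
  by apply: leq_ltn_trans s_big; rewrite -addnn leq_add.
have neq_kj' : (k : nat) <> j by move/val_inj/eqP; rewrite (negPf neq_kj).
have L_gt0 := prod_weights_gt0.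
apply/eqP; rewrite /scale; move: (prod_weights) L_gt0 => L L_gt0.
set X := (1 + L * k.+1)%N; set Y := (1 + L * j.+1)%N => E.
have XY : (X * al j = Y * al k)%N.
  apply/eqP; rewrite eqn_leq; apply/andP; split; rewrite leqNgt; apply/negP; nia.
have al_jk : al j = al k by nia.
move: XY; rewrite -al_jk => /eqP; rewrite eqn_pmul2r // => /eqP.
by rewrite /X /Y; nia.
Qed.

Section Limit.
Variable K : numClosedFieldType.
Hypothesis al_gt0 : exists j, (0 < al j)%N.
Hypothesis gcd_al : gcd_vec al = 1%N.
Variable Phi : {mpoly int[n]}.
Hypothesis PhiP : forall (K : fieldType) (x : 'I_n -> K) (I : eqType) (s : seq I) (e p : I -> K),
     (forall r, \sum_(k < r.+1) (kernel_poly al x)`_k *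
         (\sum_(i <- s) e i * p i ^+ (r - k)) = (r == 0%N)%:R) ->
     {in s, forall i, (dual_kernel_poly al x).[p i] = 0} ->
     {in s, forall i, (kernel_poly al x).[p i] != 0} ->
     evz x Phi = hilb_denom al x * \sum_(i <- s) e i / (kernel_poly al x).[p i].

Let T s : {poly K} := theta_num K Phi (scale s).
Let V s : {poly K} := theta_den K al (scale s).
Let lead s : K := theta_lead K al (scale s) (coscale s).
Let subl s : K := 3^-1 * (\sum_l (gcd_vec (omit al l))%:R ^+ 2 * (scale s l)%:R *
    theta_lead_omit K al (scale s) (coscale s) l - (n%:R - 1) * lead s).

(** The order of [theta_den] at y = 0: a simple zero for each pair of nonzero weights, a double one
    for each weight 0. It does not depend on s, so the same coefficient can be divided by at s =
    0. *)
Let order := (\sum_(j | (0 < al j)%N) \sum_(k | (0 < al k)%N) 1 +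
   \sum_(k | al k == 0%N) 2)%N.

Lemma order_theta_den s : order_at0 order (V s).
Proof.
rewrite /V /theta_den -mulrA -[order]add0n; apply: order_at0M.
  exists ((2%:P - 'X) ^+ n.-1); first by rewrite expr0 mul1r.
  rewrite horner_exp hornerD hornerN hornerX hornerC subr0 expf_neq0 //.
  by rewrite pnatr_eq0.
apply: order_at0M.
  apply: order_at0_prod => j al_j; apply: order_at0_prod => k al_k.
  rewrite -!exprM -exprD; apply: order_at0_1subX.
  by rewrite addn_gt0 muln_gt0 scale_gt0 al_k.
apply: order_at0_prod => k _; have := order_at0_1subX K (scale_gt0 s k).
by move=> o1; apply: (order_at0M o1 o1).
Qed.

Let cp_1subX k e : coef_polynomial (fun s => (1 - 'X : {poly K}) ^+ (scale s k * e)).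
Proof.
move=> i; have c0 : (1 - 'X : {poly K})`_0 = 1 by rewrite coefB coef1 coefX subr0.
have [p pE] := coef_polynomialX e (coef_polynomial_exp 1 (1 + prod_weights * k.+1) c0) i.
by exists p => s; rewrite exprM /scale pE.
Qed.

Let cp_1subX1 k : coef_polynomial (fun s => (1 - 'X : {poly K}) ^+ scale s k).
Proof. by move=> i; have [p pE] := cp_1subX k 1 i; exists p => s; rewrite -pE muln1. Qed.

Let cp_num : coef_polynomial T.
Proof.
apply: coef_polynomialM; last first.
  apply: coef_polynomial_prod => k; apply: coef_polynomialB; last exact: cp_1subX.
  exact: coef_polynomial_cst.
apply: coef_polynomialM; first exact: coef_polynomial_cst.
apply: coef_polynomial_sum => m.
apply: coef_polynomialM; first exact: coef_polynomial_cst.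
by apply: coef_polynomial_prod => k; apply: coef_polynomialX.
Qed.

Let cp_den : coef_polynomial V.
Proof.
have c1 : coef_polynomial (fun=> 1 : {poly K}) := coef_polynomial_cst 1.
apply: coef_polynomialM; last first.
  by apply: coef_polynomial_prod => k; apply: coef_polynomialX; apply: coef_polynomialB.
apply: coef_polynomialM; first exact: coef_polynomial_cst.
apply: coef_polynomial_prod => j; apply: coef_polynomial_prod => k.
apply: coef_polynomialB => //.
by apply: coef_polynomialM; apply: coef_polynomialX.
Qed.

Let num_den s i : good_scale s -> (i < order + 4)%N ->
  (T s)`_i = (V s * even_series (lead s) (subl s))`_i.
Proof.
move=> gs.
have EB j := @coscaleE s j gs; have Bi j k := @scale_indep s j k gs.
move=> lt_i; apply: (@even_jet_series K (@theta K n al (scale s) (coscale s)) (lead s)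
  (subl s) (T s) (V s) order) => //; [exact: theta_even|exact: jet_theta| |].
  exact: (order_at0_coef (order_theta_den s)).1.
exact: theta_numE.
Qed.

(** For good s, [lead] and [subl] are solved from coefficients of numerator and denominator. These
    are polynomials in s, and the divisor is nonzero at s = 0, so the congruence modulo y^(order+4)
    persists at s = 0. *)
Lemma theta_family_limit : exists h0 h2 : K,
  [/\ rational_limit good_scale lead h0, rational_limit good_scale subl h2
    & exists m, order_at0 m (V 0) /\
        forall i, (i < m + 4)%N -> (T 0)`_i = (V 0 * even_series h0 h2)`_i].
Proof.
have V_neq0 s : (V s)`_order != 0 := (order_at0_coef (order_theta_den s)).2.
have V_eq0 s i : (i < order)%N -> (V s)`_i = 0 := (order_at0_coef (order_theta_den s)).1 i.
have limT i := coef_polynomial_limit good_scale i cp_num.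
have limV i := coef_polynomial_limit good_scale i cp_den.
have ES (a c : K) i : (even_series a c)`_i =
    (i == 0%N)%:R * a + ((i == 2%N)%:R + (i == 3%N)%:R) / 4 * c.
  by rewrite coefD coefC coefZ coefD !coefXn; case: i => [|i] /=; ring.
have coef_shift (v g : {poly K}) i : (forall k, (k < order)%N -> v`_k = 0) ->
    (v * g)`_(order + i) = \sum_(k < i.+1) v`_(order + k) * g`_(i - k).
  move=> v0; rewrite coefM -addnS big_split_ord /= big1 ?add0r => [|k _].
    by apply: eq_bigr => k _; rewrite subnDl.
  by rewrite v0 ?mul0r.
have leadE s : good_scale s -> lead s = (T s)`_order / (V s)`_order.
  move=> gs; rewrite num_den //; last by rewrite -{1}[order]addn0 ltn_add2l.
  have := coef_shift (V s) (even_series (lead s) (subl s)) 0%N (V_eq0 s).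
  rewrite addn0 => ->; rewrite big_ord1 ES addn0 mul1r addr0 mul0r mul0r addr0.
  by rewrite mulrAC mulfV ?mul1r.
(* As [even_series] has no linear term, the coefficient of index order + 2 is V_(order+2) lead +
   V_order subl / 4. *)
have sublE s : good_scale s -> subl s =
    4 * ((T s)`_(order + 2) - (V s)`_(order + 2) * lead s) / (V s)`_order.
  move=> gs; rewrite num_den ?ltn_add2l // (coef_shift (V s)); last exact: V_eq0.
  rewrite !big_ord_recr big_ord0 /= !ES /= addn0.
  by have := V_neq0 s; move: (V s)`_order (lead s) (subl s) => v a c v0; field.
pose h0 := (T 0)`_order / (V 0)`_order.
pose h2 := 4 * ((T 0)`_(order + 2) - (V 0)`_(order + 2) * h0) / (V 0)`_order.
have lim0 : rational_limit good_scale lead h0.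
  apply: eq_rational_limit (rational_limitM (limT order)
    (rational_limitV (V_neq0 0%N) (limV order))).
  by apply: eventuallyT => s gs; rewrite leadE.
have lim2 : rational_limit good_scale subl h2.
  rewrite /h2 -mulN1r.
  apply: eq_rational_limit (rational_limitM (rational_limitM (rational_limit_cst _ 4)
    (rational_limitD (limT (order + 2)) (rational_limitM (rational_limit_cst _ (-1))
      (rational_limitM (limV (order + 2)) lim0))))
    (rational_limitV (V_neq0 0%N) (limV order))).
  by apply: eventuallyT => s gs; rewrite sublE // mulN1r.
exists h0, h2; split=> //.
exists order; split=> [|i lt_i]; first exact: order_theta_den.
apply: (rational_limit_uniq good_scale_unbounded (limT i)).
have limES k : rational_limit good_scale (fun s => (even_series (lead s) (subl s))`_k)
    (even_series h0 h2)`_k.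
  rewrite ES; apply: eq_rational_limit (rational_limitD (rational_limitM
    (rational_limit_cst _ _) lim0) (rational_limitM (rational_limit_cst _ _) lim2)).
  by apply: eventuallyT => s _; rewrite ES.
rewrite coefM; apply: eq_rational_limit (rational_limit_sum (index_enum 'I_i.+1)
  (P := xpredT) (fun (k : 'I_i.+1) _ => rational_limitM (limV k) (limES (i - k)%N))).
by apply: eventuallyT => s gs; rewrite num_den // coefM.
Qed.

End Limit.
End Family.

(** * Polynomials in several variables and their values *)

Lemma digits_inj D n (u v : 'I_n -> nat) :
  (forall i, u i < D)%N -> (forall i, v i < D)%N ->
  (\sum_i u i * D ^ i = \sum_i v i * D ^ i)%N -> u =1 v.
Proof.
elim: n u v => [|n IH] u v uD vD; first by move=> _ [].
have shift (w : 'I_n.+1 -> nat) : (\sum_(i < n.+1) w i * D ^ i =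
    (\sum_(i < n) w (lift ord0 i) * D ^ i) * D + w ord0)%N.
  rewrite big_ord_recl expn0 muln1 addnC big_distrl /=; congr (_ + _)%N.
  by apply: eq_bigr => i _; rewrite /bump /= add1n expnSr mulnA.
rewrite !shift => E; have D_gt0 : (0 < D)%N by apply: leq_ltn_trans (uD ord0).
have E0 : u ord0 = v ord0.
  by have := congr1 (modn^~ D) E; rewrite !modnMDl !modn_small.
have E1 : (\sum_(i < n) u (lift ord0 i) * D ^ i = \sum_(i < n) v (lift ord0 i) * D ^ i)%N.
  by have := congr1 (divn^~ D) E; rewrite !divnMDl // !divn_small // !addn0.
move=> i; case: (unliftP ord0 i) => [j|] -> //.
by apply: IH E1 j => {}j.
Qed.

Section MevalInj.
Variables (K : numFieldType) (n : nat).

(* Kronecker's substitution sends distinct monomials of [p] to distinct powers. *)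
Lemma meval_nat_eq0 (p : {mpoly K[n]}) :
  (forall v : 'I_n -> nat, p.@[fun i => (v i)%:R] = 0) -> p = 0.
Proof.
move=> p0; pose D := msize p; pose code (m : 'X_{1..n}) := (\sum_i m i * D ^ i)%N.
have mD m i : m \in msupp p -> (m i < D)%N.
  move=> /msize_mdeg_lt; apply: leq_ltn_trans.
  by rewrite mdegE (bigD1 i) //= leq_addr.
have code_inj : {in msupp p &, injective code}.
  move=> m m' pm pm' E; apply/mnmP.
  by apply: (@digits_inj D) => // i; apply: mD.
pose f : {poly K} := \sum_(m <- msupp p) p@_m *: 'X^(code m).
have f0 : f = 0.
  apply: poly_nat_eq0 => t; rewrite -[RHS](p0 (fun i => (t ^ (D ^ i))%N)).
  rewrite mevalE horner_sum; apply: eq_bigr => m _.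
  rewrite hornerZ hornerXn; congr (_ * _); rewrite /code -prodrXr.
  by apply: eq_bigr => i _; rewrite natrX -exprM mulnC.
apply/mpolyP => m; rewrite mcoeff0.
have [pm|/memN_msupp_eq0 //] := boolP (m \in msupp p).
have /(congr1 (fun f : {poly K} => f`_(code m))) := f0.
rewrite coef0 coef_sum (bigD1_seq m) ?msupp_uniq //= coefZ coefXn eqxx mulr1.
rewrite big_seq_cond big1 ?addr0 // => m' /andP[pm' neq_m].
rewrite coefZ coefXn; case: eqVneq => [/esym/code_inj E|]; last by rewrite mulr0.
by rewrite E ?eqxx in neq_m.
Qed.

Lemma meval_nat_inj (p q : {mpoly K[n]}) :
  (forall v : 'I_n -> nat, p.@[fun i => (v i)%:R] = q.@[fun i => (v i)%:R]) -> p = q.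
Proof.
move=> pq; apply/eqP; rewrite -subr_eq0; apply/eqP/meval_nat_eq0 => v.
by rewrite mevalB pq subrr.
Qed.

Lemma meval_segment (p : {mpoly K[n]}) (v w : 'I_n -> K) : exists f : {poly K},
  forall s, f.[s] = p.@[fun i => (1 - s) * v i + s * w i].
Proof.
pose h i : {poly K} := (1 - 'X) * (v i)%:P + 'X * (w i)%:P.
exists (\sum_(m <- msupp p) p@_m *: \prod_i h i ^+ m i) => s.
rewrite mevalE horner_sum; apply: eq_bigr => m _.
rewrite hornerZ horner_prod; congr (_ * _); apply: eq_bigr => i _.
by rewrite horner_exp /h !hornerE.
Qed.

Lemma dhomog_sum (I : Type) (r : seq I) (P : pred I) (F : I -> {mpoly K[n]}) d :
  (forall i, P i -> F i \is d.-homog) -> \sum_(i <- r | P i) F i \is d.-homog.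
Proof.
move=> Fd; elim/big_rec: _ => [|i p Pi pd]; first exact: dhomog0.
by apply: dhomogD => //; apply: Fd.
Qed.

Lemma dhomog_comp_linear m (p : {mpoly K[m]}) (lq : m.-tuple {mpoly K[n]}) d :
  (forall i, tnth lq i \is 1.-homog) -> p \is d.-homog -> p \mPo lq \is d.-homog.
Proof.
move=> lq1 /dhomogP pd; rewrite comp_mpolyEX big_seq.
apply: dhomog_sum => t /pd td; apply: dhomogZ; rewrite comp_mpolyX.
rewrite -td /= mdegE; elim/big_rec2: _ => [|i e q _ qe]; first exact: dhomog1.
apply: dhomogM => //; rewrite -[X in X.-homog]mul1n; exact: dhomogMn.
Qed.

End MevalInj.

Section RealPart.
Variables (R : rcfType) (n : nat).
Local Notation toC := (real_complex R).

Definition re_mpoly (q : {mpoly R[i][n]}) : {mpoly R[n]} :=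
  \sum_(m <- msupp q) complex.Re q@_m *: 'X_[m].

Lemma re_mpoly_eval q (v : 'I_n -> R) :
  (re_mpoly q).@[v] = complex.Re q.@[toC \o v].
Proof.
rewrite [in RHS]mevalE /re_mpoly (raddf_sum (meval v)) raddf_sum; apply: eq_bigr => m _ /=.
rewrite mevalZ mevalX.
have -> : \prod_i (v i)%:C%C ^+ m i = (\prod_i v i ^+ m i)%:C%C.
  by rewrite rmorph_prod; apply: eq_bigr => i _; rewrite rmorphXn.
by case: (q@_m) => x y; simpc.
Qed.

Lemma re_mpoly_homog q d : q \is d.-homog -> re_mpoly q \is d.-homog.
Proof.
move=> /dhomogP qd; rewrite /re_mpoly big_seq; apply: dhomog_sum => m /qd md.
by apply: dhomogZ; rewrite dhomogX; apply/eqP.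
Qed.

End RealPart.

Section Join.
Variables (T : Type) (n : nat).

Definition join2 (f g : 'I_n -> T) (k : 'I_(n + n)) : T :=
  match split k with inl j => f j | inr j => g j end.

Lemma join2l f g j : join2 f g (lshift n j) = f j.
Proof. by rewrite /join2 -[lshift n j]/(unsplit (inl j)) unsplitK. Qed.

Lemma join2r f g j : join2 f g (rshift n j) = g j.
Proof. by rewrite /join2 -[rshift n j]/(unsplit (inr j)) unsplitK. Qed.

Lemma join2_eta (h : 'I_(n + n) -> T) k :
  join2 (fun j => h (lshift n j)) (fun j => h (rshift n j)) k = h k.
Proof. by rewrite -[k in RHS]splitK /join2; case: (split k). Qed.

Lemma eq_join2 f g f' g' : f =1 f' -> g =1 g' -> join2 f g =1 join2 f' g'.
Proof. by move=> ff' gg' k; rewrite /join2; case: (split k). Qed.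

End Join.

(** * Invariants of the circle *)

Section Invariants.
Variables (R : realType) (n : nat) (a : 'I_n -> int).
Local Notation C := (R[i]).
Local Notation toC := (real_complex R).
Local Notation MR := {mpoly R[n + n]}.
Local Notation MC := {mpoly C[n + n]}.
Local Notation al := (fun j => `|a j|%N).

(* [zhat z j] is [z j] or its conjugate, so that the circle always acts on it
   with the nonnegative weight [`|a j|]. *)
Definition zhat (z : 'I_n -> C) (j : 'I_n) : C :=
  if 0 <= a j then z j else (z j)^*%C.

Let eps (j : 'I_n) : C := if 0 <= a j then 'i%C else - 'i%C.

(** [phi] expresses [zhat] and its conjugate in the real coordinates, and [psi] is the inverse
    substitution. The sign in [eps] decides which of z_j and its conjugate comes first. *)
Let phi : (n + n).-tuple MC := [tuple join2
  (fun j => 'X_(lshift n j) + eps j *: 'X_(rshift n j))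
  (fun j => 'X_(lshift n j) - eps j *: 'X_(rshift n j)) k | k < n + n].
Let psi : (n + n).-tuple MC := [tuple join2
  (fun j => 2^-1 *: ('X_(lshift n j) + 'X_(rshift n j)))
  (fun j => (2 * eps j)^-1 *: ('X_(lshift n j) - 'X_(rshift n j))) k | k < n + n].

Let phi_pt (v : 'I_(n + n) -> C) : 'I_(n + n) -> C := join2
  (fun j => v (lshift n j) + eps j * v (rshift n j))
  (fun j => v (lshift n j) - eps j * v (rshift n j)).
Let psi_pt (v : 'I_(n + n) -> C) : 'I_(n + n) -> C := join2
  (fun j => 2^-1 * (v (lshift n j) + v (rshift n j)))
  (fun j => (2 * eps j)^-1 * (v (lshift n j) - v (rshift n j))).

Let eps_neq0 j : eps j != 0.
Proof.
have i0 : ('i%C : C) != 0 by rewrite eq_complex /= eqxx oner_eq0.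
by rewrite /eps; case: ifP; rewrite ?oppr_eq0.
Qed.

Let phi_eval (p : MC) v : (p \mPo phi).@[v] = p.@[phi_pt v].
Proof.
rewrite comp_mpoly_meval; apply: meval_eq => k; rewrite tnth_mktuple /phi_pt /join2.
by case: (split k) => j; rewrite ?mevalB ?mevalD mevalZ !mevalXU.
Qed.

Let psi_eval (p : MC) v : (p \mPo psi).@[v] = p.@[psi_pt v].
Proof.
rewrite comp_mpoly_meval; apply: meval_eq => k; rewrite tnth_mktuple /psi_pt /join2.
by case: (split k) => j; rewrite mevalZ ?mevalB ?mevalD !mevalXU.
Qed.

Let phi_ptK v : phi_pt (psi_pt v) =1 v.
Proof.
have two_neq0 : (2 : C) != 0 by rewrite pnatr_eq0.
move=> k; rewrite -[RHS]join2_eta; apply: eq_join2 => j; rewrite /psi_pt join2l join2r.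
  by field; rewrite eps_neq0.
by field; rewrite eps_neq0.
Qed.

Let psi_ptK v : psi_pt (phi_pt v) =1 v.
Proof.
have two_neq0 : (2 : C) != 0 by rewrite pnatr_eq0.
move=> k; rewrite -[RHS]join2_eta; apply: eq_join2 => j; rewrite /phi_pt join2l join2r.
  by field.
by field; rewrite eps_neq0.
Qed.

Let phi_real z : phi_pt (toC \o coords z) =1 join2 (zhat z) (fun j => (zhat z j)^*%C).
Proof.
apply: eq_join2 => j; rewrite /= /coords -[lshift n j]/(unsplit (inl j))
  -[rshift n j]/(unsplit (inr j)) !unsplitK /zhat /eps; case: ifP => _;
  case: (z j) => x y; simpc; apply/eqP; rewrite eq_complex /=
    ?mul0r ?mul1r ?mulr0 ?mulr1 ?subr0 ?sub0r ?add0r ?addr0 ?opprK ?eqxx //.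
Qed.

Let homog1 (T : nzRingType) k : ('X_k : {mpoly T[n + n]}) \is 1.-homog.
Proof. by rewrite dhomogX /= mdeg1. Qed.

Let phi_homog k : tnth phi k \is 1.-homog.
Proof.
rewrite tnth_mktuple /join2.
have epsX (j k' : 'I_n) : eps j *: 'X_(rshift n k') \is 1.-homog by apply/dhomogZ/homog1.
case: (split k) => j; apply: dhomogD => //; try exact: homog1.
by rewrite dhomogN.
Qed.

Let psi_homog k : tnth psi k \is 1.-homog.
Proof.
rewrite tnth_mktuple /join2.
case: (split k) => j; apply: dhomogZ; apply: dhomogD; rewrite ?dhomogN; exact: homog1.
Qed.

Let zmon (z : 'I_n -> C) (m : 'X_{1..n + n}) : C :=
  'X_[m].@[join2 (zhat z) (fun j => (zhat z j)^*%C)].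

Let zmonE z m : zmon z m = (\prod_j zhat z j ^+ m (lshift n j)) *
  \prod_j (zhat z j)^*%C ^+ m (rshift n j).
Proof.
rewrite /zmon mevalX big_split_ord /=; congr (_ * _).
  by apply: eq_bigr => j _; rewrite join2l.
by apply: eq_bigr => j _; rewrite join2r.
Qed.

Let wl (m : 'X_{1..n + n}) := (\sum_j al j * m (lshift n j))%N.
Let wr (m : 'X_{1..n + n}) := (\sum_j al j * m (rshift n j))%N.

Lemma conjc_circle (t : C) : `|t| = 1 -> t^*%C = t^-1.
Proof. by move=> t1; rewrite invc_norm t1 expr1n invr1 mul1r. Qed.

Lemma conjcXz (t : C) (k : int) : (t ^ k)^*%C = (t^*%C) ^ k.
Proof. exact: (fmorphXz (@conjc R : {rmorphism C -> C})). Qed.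

Let zhat_act (t : C) z j : `|t| = 1 -> zhat (circle_act a t z) j = t ^+ al j * zhat z j.
Proof.
move=> t1; rewrite /zhat /circle_act; case: (ger0P (a j)) => aj.
  by rewrite -[in LHS](gez0_abs aj) -exprnP.
rewrite rmorphM /= conjcXz conjc_circle //; congr (_ * _).
by rewrite exprz_inv exprnP abszE ltr0_norm.
Qed.

Let zmon_act t z m : `|t| = 1 ->
  zmon (circle_act a t z) m = t ^+ wl m * t^-1 ^+ wr m * zmon z m.
Proof.
move=> t1; rewrite !zmonE.
under eq_bigr do rewrite zhat_act // exprMn -exprM.
under [X in _ * X]eq_bigr do rewrite zhat_act // rmorphM rmorphXn /= conjc_circle // exprMn -exprM.
rewrite !big_split /= !prodrXr; ring.
Qed.

Let conj_zhat_eval z (p : MC) : (p \mPo phi).@[toC \o coords z] =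
  \sum_(m <- msupp p) p@_m * zmon z m.
Proof.
rewrite phi_eval (meval_eq _ (phi_real z)) mevalE.
by apply: eq_bigr => m _; rewrite /zmon mevalX.
Qed.

Let coords_surj (v : 'I_(n + n) -> R) : exists z, v =1 coords z.
Proof.
exists (fun j => Complex (v (lshift n j)) (v (rshift n j))) => k.
by rewrite -[LHS]join2_eta /coords /join2; case: (split k).
Qed.

Let phi_inj (p q : MC) :
  (forall z, (p \mPo phi).@[toC \o coords z] = (q \mPo phi).@[toC \o coords z]) -> p = q.
Proof.
move=> pq; have pq' : p \mPo phi = q \mPo phi.
  apply: meval_nat_inj => v; have [z zE] := coords_surj (fun i => (v i)%:R).
  have E (r : MC) : r.@[fun i => (v i)%:R] = r.@[toC \o coords z].
    by apply: meval_eq => i; rewrite /= -zE rmorph_nat.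
  exact: etrans (E _) (etrans (pq z) (esym (E _))).
apply: meval_nat_inj => v.
have E (r : MC) : r.@[fun i => (v i)%:R] = (r \mPo phi).@[psi_pt (fun i => (v i)%:R)].
  by rewrite phi_eval; apply: meval_eq => i; rewrite phi_ptK.
by rewrite !E pq'.
Qed.

(** For k < l take t <> 1 with t^(l-k+1) = 1; then t^(l-k) = 1/t is not 1. *)
Let exists_circle k l : k != l -> exists2 t : C, `|t| = 1 & t ^+ k * t^-1 ^+ l != 1.
Proof.
wlog lt_kl : k l / (k < l)%N.
  move=> IH; case: (ltngtP k l) => // [lt_kl|lt_lk] _; first by apply: IH; rewrite // ltn_eqF.
  have [|t t1 tlk] := IH l k lt_lk; first by rewrite ltn_eqF.
  have t0 : t != 0 by rewrite -normr_eq0 t1 oner_neq0.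
  exists t => //; apply: contra_neq tlk; rewrite !exprVn => /(canRL (mulfVK (expf_neq0 _ t0))).
  by rewrite mul1r => ->; rewrite mulfV ?expf_neq0.
move=> _; pose m := (l - k).+1.
have : ~~ all (root ('X - 1)) (unity_roots C m).
  apply/negP => mu1.
  have /eqP : 'X - 1 = 0 :> {poly C}.
    apply: roots_geq_poly_eq0 mu1 (unity_roots_uniq C (ltn0Sn _)) _.
    by rewrite size_unity_roots // -polyC1 size_XsubC /m ltnS subn_gt0.
  by rewrite -size_poly_eq0 -polyC1 size_XsubC.
case/allPn => t; rewrite mem_unity_roots // /root !hornerE subr_eq0 => /eqP tm t_neq1.
have t0 := unity_root_neq0 (ltn0Sn _) tm.
have t1 : `|t| = 1.
  by apply/eqP; rewrite -(@pexpr_eq1 _ _ m) ?normr_ge0 // -normrX tm normr1.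
exists t => //; apply: contra_neq t_neq1; rewrite exprVn.
rewrite -{1}(subnKC (ltnW lt_kl)) exprD invfM mulrA mulfV ?expf_neq0 // mul1r => tlk.
by rewrite -[t]mul1r -{1}invr1 -tlk invrK -exprSr tm.
Qed.

Let zpoly (p : MR) : MC := map_mpoly toC p \mPo psi.

Lemma map_mpoly_eval (K K' : comNzRingType) m (f : {rmorphism K -> K'})
    (p : {mpoly K[m]}) (v : 'I_m -> K) : (map_mpoly f p).@[f \o v] = f p.@[v].
Proof.
rewrite /map_mpoly [in RHS]mevalE /mmap (raddf_sum (meval _)) rmorph_sum; apply: eq_bigr => t _ /=.
rewrite mmap1_id mul_mpolyC mevalZ mevalX rmorphM rmorph_prod; congr (_ * _).
by apply: eq_bigr => i _; rewrite rmorphXn.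
Qed.

Let zpolyE (p : MR) z : toC p.@[coords z] = \sum_(m <- msupp (zpoly p)) (zpoly p)@_m * zmon z m.
Proof.
by rewrite -conj_zhat_eval phi_eval psi_eval (meval_eq _ (psi_ptK _)) map_mpoly_eval.
Qed.

Let zsum_eval (I : Type) (s : seq I) (Q : pred I) (c : I -> C) (m : I -> 'X_{1..n + n}) z :
  ((\sum_(i <- s | Q i) c i *: 'X_[m i]) \mPo phi).@[toC \o coords z] =
  \sum_(i <- s | Q i) c i * zmon z (m i).
Proof.
rewrite phi_eval (meval_eq _ (phi_real z)) (raddf_sum (meval _)).
by apply: eq_bigr => i _; rewrite /= mevalZ.
Qed.

(** The action of t multiplies the coefficient of m by t^(wl m - wr m). Invariance and uniqueness of
    coefficients make this factor 1 on the support. *)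
Let zpoly_inv (p : MR) m : Defs.invariant a p -> m \in msupp (zpoly p) -> wl m = wr m.
Proof.
move=> p_inv Pm; set P := zpoly p in Pm; apply/eqP; apply: contraTT Pm => neq_w.
have [t t1 t_neq1] := exists_circle neq_w; rewrite -mcoeff_eq0.
have PE : \sum_(m <- msupp P) (P@_m * (t ^+ wl m * t^-1 ^+ wr m)) *: 'X_[m] = P.
  apply: phi_inj => z; rewrite [LHS]zsum_eval [RHS]conj_zhat_eval.
  rewrite -zpolyE -(p_inv t t1) zpolyE.
  by apply: eq_bigr => m' _; rewrite zmon_act // !mulrA.
apply: contra_neqT t_neq1; rewrite mcoeff_eq0 negbK => Pm.
have /(congr1 (mcoeff m)) := PE; rewrite (raddf_sum (mcoeff m)) (bigD1_seq m) ?msupp_uniq //=.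
rewrite mcoeffZ mcoeffX eqxx mulr1 big1 ?addr0 => [|m' /negPf neq_m]; last first.
  by rewrite mcoeffZ mcoeffX neq_m mulr0.
rewrite -[RHS]mulr1; apply: mulfI.
by rewrite -mcoeff_msupp.
Qed.

Section Basis.
Variables (M i : nat).
Hypothesis le_iM : (i <= M)%N.

Local Notation expo := ({ffun 'I_n -> 'I_M.+1} * {ffun 'I_n -> 'I_M.+1})%type.

(** The bound M on exponents makes the type finite. It is kept apart from i so that the degrees i
    and i - 2 and the truncated series share one type. *)
Definition balanced : {set expo} := [set uv : expo |
  (\sum_j uv.1 j + \sum_j uv.2 j == i)%N &&
  (\sum_j al j * uv.1 j == \sum_j al j * uv.2 j)%N].

Let mon (uv : expo) : 'X_{1..n + n} :=
  [multinom join2 (fun j => uv.1 j : nat) (fun j => uv.2 j : nat) k | k < n + n].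

Let monl uv j : mon uv (lshift n j) = uv.1 j. Proof. by rewrite mnmE join2l. Qed.
Let monr uv j : mon uv (rshift n j) = uv.2 j. Proof. by rewrite mnmE join2r. Qed.

Let mon_inj : injective mon.
Proof.
move=> [u v] [u' v'] E; congr (_, _); apply/ffunP => j; apply/val_inj.
  by have := monl (u, v) j; rewrite E monl.
by have := monr (u, v) j; rewrite E monr.
Qed.

Let mdeg_mon uv : mdeg (mon uv) = (\sum_j uv.1 j + \sum_j uv.2 j)%N.
Proof.
rewrite mdegE big_split_ord /=; congr (_ + _)%N; apply: eq_bigr => j _.
  by rewrite monl.
by rewrite monr.
Qed.

Let mon_surj m : mdeg m = i -> wl m = wr m -> exists2 uv, uv \in balanced & m = mon uv.
Proof.
move=> mi mw; have m_le k : (m k < M.+1)%N.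
  by rewrite ltnS (leq_trans _ le_iM) // -mi mdegE (bigD1 k) //= leq_addr.
exists ([ffun j => inord (m (lshift n j))], [ffun j => inord (m (rshift n j))]).
  rewrite inE /= -mi mdegE big_split_ord /= /wl /wr in mw *.
  apply/andP; split; apply/eqP; first by congr (_ + _)%N; apply: eq_bigr => j _; rewrite ffunE inordK.
  transitivity (wl m); first by apply: eq_bigr => j _; rewrite ffunE inordK.
  by rewrite /wl mw; apply: eq_bigr => j _; rewrite ffunE inordK.
apply/mnmP => k; rewrite mnmE -[LHS]join2_eta; apply: eq_join2 => j /=.
  by rewrite ffunE inordK.
by rewrite ffunE inordK.
Qed.

Let swap (uv : expo) : expo := (uv.2, uv.1).

Let swapK : involutive swap. Proof. by case. Qed.

Let swap_balanced uv : (swap uv \in balanced) = (uv \in balanced).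
Proof. by rewrite !inE /= addnC [X in _ && X]eq_sym. Qed.

Let zmon_swap z uv : zmon z (mon (swap uv)) = (zmon z (mon uv))^*%C.
Proof.
rewrite !zmonE rmorphM !rmorph_prod mulrC /=; congr (_ * _); apply: eq_bigr => j _.
  by rewrite rmorphXn /= monl monr.
by rewrite rmorphXn /= conjcK monl monr.
Qed.

(** For a monomial z^m this is Re z^m + Im z^m, and for its conjugate Re z^m - Im z^m. The factor 1
    - i thus gives one real invariant per balanced pair, without choosing representatives under
    [swap]. *)
Let basis_elt (uv : expo) : MR := re_mpoly ((1 - 'i%C) *: ('X_[mon uv] \mPo phi)).

Let ReE (x : C) : toC (complex.Re x) = (x + x^*%C) / 2.
Proof. exact: ReJ_add. Qed.

Let basis_elt_eval z uv : toC (basis_elt uv).@[coords z] =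
  ((1 - 'i%C) * zmon z (mon uv) + (1 + 'i%C) * zmon z (mon (swap uv))) / 2.
Proof.
rewrite re_mpoly_eval ReE mevalZ phi_eval (meval_eq _ (phi_real z)) -/(zmon z (mon uv)).
by rewrite zmon_swap rmorphM /= -['i%C in X in _ = X]opprK; congr ((_ + _ * _) / _); simpc.
Qed.

Let lin_eval z (r : expo -> R) :
  toC (\sum_(x in balanced) r x *: basis_elt x).@[coords z] =
  \sum_(x in balanced) ((1 - 'i%C) * toC (r x) + (1 + 'i%C) * toC (r (swap x))) / 2
     * zmon z (mon x).
Proof.
rewrite (raddf_sum (meval _)) rmorph_sum /=.
pose F x : C := (1 - 'i%C) * toC (r x) * zmon z (mon x) / 2.
pose G x : C := (1 + 'i%C) * toC (r x) * zmon z (mon (swap x)) / 2.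
transitivity (\sum_(x in balanced) F x + \sum_(x in balanced) G x).
  rewrite -big_split; apply: eq_bigr => x _ /=.
  by rewrite mevalZ rmorphM /= basis_elt_eval /F /G; ring.
rewrite [X in _ + X](reindex_inj (inv_inj swapK)) /=.
rewrite [X in _ + X](eq_bigl (mem balanced)); last by move=> x; rewrite swap_balanced.
by rewrite -big_split; apply: eq_bigr => x _; rewrite /F /G /= swapK; ring.
Qed.

Lemma balanced_basis : exists b : expo -> MR,
  [/\ {in balanced, forall x, Defs.invariant a (b x) /\ b x \is i.-homog},
      forall r : expo -> R, \sum_(x in balanced) r x *: b x = 0 ->
        {in balanced, forall x, r x = 0}
    & forall p, Defs.invariant a p -> p \is i.-homog ->
        exists r : expo -> R, p = \sum_(x in balanced) r x *: b x].
Proof.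
exists basis_elt; split.
- move=> x; rewrite inE => /andP[/eqP deg_x /eqP w_x]; split.
    move=> t t1 z; apply: (@complexI R); rewrite !basis_elt_eval !zmon_act //.
    have wlx : wl (mon x) = wr (mon x).
      rewrite /wl /wr (eq_bigr (fun j => al j * x.1 j)%N); last by move=> j _; rewrite monl.
      by rewrite w_x; apply: eq_bigr => j _; rewrite monr.
    have wls : wl (mon (swap x)) = wr (mon (swap x)).
      rewrite /wl /wr (eq_bigr (fun j => al j * x.2 j)%N); last by move=> j _; rewrite monl.
      by rewrite -w_x; apply: eq_bigr => j _; rewrite monr.
    have t0 : t != 0 by rewrite -normr_eq0 t1 oner_neq0.
    by rewrite wlx wls -!exprMn mulfV // !expr1n !mul1r.
  apply: re_mpoly_homog; apply: dhomogZ; apply: dhomog_comp_linear phi_homog _.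
  by rewrite dhomogX /= mdeg_mon deg_x.
- move=> r r0 x Bx.
  pose d x : C := ((1 - 'i%C) * toC (r x) + (1 + 'i%C) * toC (r (swap x))) / 2.
  have d0 : \sum_(x in balanced) d x *: 'X_[mon x] = 0.
    apply: phi_inj => z; rewrite [LHS]zsum_eval -lin_eval r0 meval0 phi_eval meval0.
    exact: rmorph0.
  have : d x = 0.
    have /(congr1 (mcoeff (mon x))) := d0.
    rewrite mcoeff0 (raddf_sum (mcoeff (mon x))) (bigD1 x) //=.
    rewrite mcoeffZ mcoeffX eqxx mulr1 big1 ?addr0 // => y /andP[_ /negPf neq_y].
    by rewrite mcoeffZ mcoeffX (inj_eq mon_inj) neq_y mulr0.
  move/eqP; rewrite mulf_eq0 invr_eq0 (pnatr_eq0 C 2) orbF => /eqP.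
  move: (r x) (r (swap x)) => s t; simpc => -[].
  move=> E1 E2; have : 2 * s = (s + t) - (- s + t) by ring.
  rewrite E1 E2 subrr.
  by move/eqP; rewrite mulf_eq0 pnatr_eq0 => /eqP.
move=> p p_inv p_hom.
(* As p is its own real part, it may be expanded with the averaged coefficients c', which satisfy
   c'(swap x) = conj(c' x) by construction. *)
pose c x := (zpoly p)@_(mon x); pose c' x : C := (c x + (c (swap x))^*%C) / 2.
(* The solution r of ((1 - i) r(x) + (1 + i) r(swap x)) / 2 = c'(x). *)
exists (fun x => complex.Re (c' x) - complex.Im (c' x)).
apply: meval_nat_inj => v; have [z zE] := coords_surj (fun k => (v k)%:R).
rewrite !(meval_eq _ zE); apply: (@complexI R); rewrite lin_eval.
have P_hom : zpoly p \is i.-homog.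
  apply: dhomog_comp_linear psi_homog _; apply/dhomogP => m.
  rewrite mcoeff_msupp mcoeff_map_mpoly => pm; apply: (dhomog_mf p_hom).
  by rewrite mcoeff_msupp; apply: contraNneq pm => ->; rewrite eqxx.
have PE : zpoly p = \sum_(x in balanced) c x *: 'X_[mon x].
  apply/mpolyP => m; rewrite [RHS](raddf_sum (mcoeff m)).
  have [Pm|] := boolP (m \in msupp (zpoly p)); last first.
    move=> Pm; rewrite (memN_msupp_eq0 Pm) big1 // => x _; rewrite /= mcoeffZ mcoeffX.
    by case: eqVneq => [E|]; rewrite ?mulr0 // /c E (memN_msupp_eq0 Pm) mul0r.
  have [x Bx mE] := mon_surj (dhomog_mf P_hom Pm) (zpoly_inv p_inv Pm).
  rewrite (bigD1 x) //= mcoeffZ mcoeffX -mE eqxx mulr1 /c -mE big1 ?addr0 //.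
  move=> y /andP[_ /negPf neq_y].
  by rewrite mcoeffZ mcoeffX mE (inj_eq mon_inj) neq_y mulr0.
have pE : toC p.@[coords z] = \sum_(x in balanced) c x * zmon z (mon x).
  by rewrite zpolyE -conj_zhat_eval PE zsum_eval.
have two_neq0 : (2 : C) != 0 by rewrite pnatr_eq0.
transitivity ((toC p.@[coords z] + (toC p.@[coords z])^*%C) / 2).
  by rewrite conjc_real; move: (toC _) => y; field.
rewrite pE rmorph_sum /= mulrDl !mulr_suml.
rewrite [X in _ + X](reindex_inj (inv_inj swapK)) /=.
rewrite [X in _ + X](eq_bigl (mem balanced)); last by move=> x; rewrite swap_balanced.
rewrite -big_split; apply: eq_bigr => x _ /=.
rewrite rmorphM /= -zmon_swap swapK -mulrDl.
transitivity (c' x * zmon z (mon x)); first by rewrite /c'; ring.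
congr (_ * _); have c's : c' (swap x) = (c' x)^*%C.
  rewrite /c' swapK rmorphM rmorphD /= conjcK addrC; congr (_ * _).
  by have := conjc_inv (2 : C); rewrite conjc_nat => <-.
rewrite c's; case: (c' x) => s t /=.
apply: (mulIf two_neq0); rewrite divfK //.
apply/eqP; rewrite eq_complex; simpc; rewrite /=.
by apply/andP; split; apply/eqP; ring.
Qed.

End Basis.

End Invariants.

(** * Dimensions of the on-shell components *)

Section OnShell.
Variables (R : realType) (n : nat) (a : 'I_n -> int).
Hypothesis a_neq0 : exists j, a j != 0.
Local Notation C := (R[i]).
Local Notation MR := {mpoly R[n + n]}.
Local Notation J := (moment_map R a).
Local Notation invariant := (Defs.invariant a).

Lemma invariant_sum (I : Type) (s : seq I) (P : pred I) (p : I -> MR) :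
  (forall i, P i -> invariant (p i)) -> invariant (\sum_(i <- s | P i) p i).
Proof.
move=> p_inv t t1 z; rewrite !(raddf_sum (meval _)); apply: eq_bigr => i Pi.
exact: p_inv.
Qed.

Lemma invariantZ c (p : MR) : invariant p -> invariant (c *: p).
Proof. by move=> p_inv t t1 z; rewrite !mevalZ p_inv. Qed.

Lemma invariantM (p q : MR) : invariant p -> invariant q -> invariant (p * q).
Proof. by move=> p_inv q_inv t t1 z; rewrite !mevalM p_inv // q_inv. Qed.

Lemma moment_map_invariant : invariant J.
Proof.
move=> t t1 z; apply: (@complexI R); rewrite !moment_map_eval; congr (_ * _).
apply: eq_bigr => j _; congr (_ * _); rewrite /circle_act rmorphM /= mulrACA.
have -> : t ^ a j * (t ^ a j)^* = 1.
  rewrite -normCK; case: (a j) => m; first by rewrite -exprnP normrX t1 !expr1n.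
  by rewrite NegzE -exprz_inv -exprnP normrX normfV t1 invr1 !expr1n.
by rewrite mul1r.
Qed.

Lemma moment_map_homog : J \is 2.-homog.
Proof.
have X2 k : ('X_k ^+ 2 : MR) \is 2.-homog.
  have X1 : ('X_k : MR) \is 1.-homog by rewrite dhomogX /= mdeg1.
  by rewrite expr2; have := dhomogM X1 X1.
apply: dhomogZ; apply: dhomog_sum => j _; apply: dhomogZ.
by apply: dhomogD.
Qed.

Lemma moment_map_neq0_pt : exists z, J.@[coords z] != 0.
Proof.
have [j aj] := a_neq0; pose z k : C := (k == j)%:R; exists z.
rewrite -(inj_eq (@complexI R)) moment_map_eval (bigD1 j) //= big1 ?addr0 => [|k /negPf kj].
  have -> : z j = 1 by rewrite /z eqxx.
  rewrite rmorph1 !mulr1 mulf_neq0 ?invr_eq0 ?pnatr_eq0 //.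
  by rewrite intr_eq0.
by rewrite /z kj mul0r mulr0.
Qed.

Lemma moment_map_neq0 : J != 0.
Proof. by have [z] := moment_map_neq0_pt; apply: contraNneq => ->; rewrite meval0. Qed.

Lemma coords_affine (s : R) (z w : 'I_n -> C) k :
  coords (fun j => (1 - s)%:C%C * z j + s%:C%C * w j) k =
  (1 - s) * coords z k + s * coords w k.
Proof.
rewrite /coords; case: (split k) => j; case: (z j) => x y; case: (w j) => x' y'; simpc => //=.
Qed.

Lemma circle_act_affine (t : C) (s : R) (z w : 'I_n -> C) :
  circle_act a t (fun j => (1 - s)%:C%C * z j + s%:C%C * w j) =
  (fun j => (1 - s)%:C%C * circle_act a t z j + s%:C%C * circle_act a t w j).
Proof. by apply: funext => j; rewrite /circle_act mulrDr mulrCA [X in _ + X]mulrCA. Qed.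

(** J may vanish at z, so the cancellation takes place on the segment from z to a point w with J(w)
    <> 0: there J is a nonzero polynomial in the parameter, and its product with the difference of
    the two restrictions of q is 0. *)
Lemma invariant_div (q : MR) : invariant (q * J) -> invariant q.
Proof.
move=> qJ t t1 z; have [w Jw] := moment_map_neq0_pt.
have [f fE] := meval_segment q (coords (circle_act a t z)) (coords (circle_act a t w)).
have [g gE] := meval_segment q (coords z) (coords w).
have [h hE] := meval_segment J (coords z) (coords w).
pose pt s := fun j => (1 - s)%:C%C * z j + s%:C%C * w j.
have fE' s : f.[s] = q.@[coords (circle_act a t (pt s))].
  by rewrite fE; apply: meval_eq => k; rewrite circle_act_affine coords_affine.
have gE' s : g.[s] = q.@[coords (pt s)].
  by rewrite gE; apply: meval_eq => k; rewrite coords_affine.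
have hE' s : h.[s] = J.@[coords (pt s)].
  by rewrite hE; apply: meval_eq => k; rewrite coords_affine.
have h_neq0 : h != 0.
  have pt1 : coords (pt 1) =1 coords w.
    by move=> k; rewrite coords_affine subrr mul0r add0r mul1r.
  by apply: contraNneq Jw => h0; rewrite -(meval_eq _ pt1) -hE' h0 horner0.
have fgh : (f - g) * h = 0.
  apply: poly_nat_eq0 => m; rewrite hornerM hornerD hornerN fE' gE' hE' mulrBl.
  by rewrite -[X in X - _](mulrC J.@[_]) -{1}(moment_map_invariant t1) mulrC -!mevalM qJ // subrr.
have fg : f = g.
  by apply/eqP; rewrite -subr_eq0; move/eqP: fgh; rewrite mulf_eq0 (negPf h_neq0) orbF.
have pt0 : coords (pt 0) =1 coords z by move=> k; rewrite coords_affine subr0 mul1r mul0r addr0.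
have pt0' : coords (circle_act a t (pt 0)) =1 coords (circle_act a t z).
  by move=> k; rewrite circle_act_affine coords_affine subr0 mul1r mul0r addr0.
by rewrite -(meval_eq _ pt0) -(meval_eq _ pt0') -fE' -gE' fg.
Qed.

(** J has degree 2, so only the component of q of degree k with k + 2 = i matters. The last clause
    covers i < 2, where i - 2 is truncated to 0. *)
Lemma moment_ideal_homog i (p : MR) : p \is i.-homog -> moment_ideal_inv a p ->
  exists q : MR, [/\ p = q * J, invariant q, q \is (i - 2).-homog & (i < 2)%N -> q = 0].
Proof.
move=> p_hom [[q pE] p_inv].
pose q' := \sum_(k < msize q | (k + 2 == i)%N) pihomog mdeg k q.
have pE' : p = q' * J.
  have := pihomog_dE p_hom; rewrite {1}pE {1}(pihomog_partitionE (leqnn (msize q))).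
  rewrite mulr_suml raddf_sum /= => <-; rewrite mulr_suml [RHS]big_mkcond /=.
  apply: eq_bigr => k _; have kJ : pihomog mdeg k q * J \is (k + 2).-homog.
    by apply: dhomogM (pihomogP _ _ _) moment_map_homog.
  by case: eqP => [<-|/eqP neq_k]; [apply: pihomog_dE|apply: pihomog_ne0 kJ].
exists q'; split=> //.
- by apply: invariant_div; rewrite -pE'.
- by apply: dhomog_sum => k /eqP <-; rewrite addnK; apply: pihomogP.
by move=> lt_i2; rewrite /q' big_pred0 // => k; apply/eqP; lia.
Qed.

Lemma invariant_basis M i : (i <= M)%N -> exists b : 'I_#|balanced a M i| -> MR,
  [/\ forall k, invariant (b k) /\ b k \is i.-homog,
      forall r : 'I_#|balanced a M i| -> R, \sum_k r k *: b k = 0 -> forall k, r k = 0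
    & forall p, invariant p -> p \is i.-homog ->
        exists r : 'I_#|balanced a M i| -> R, p = \sum_k r k *: b k].
Proof.
move=> le_iM; have [b [b_inv b_free b_gen]] := balanced_basis R a le_iM.
exists (fun k => b (enum_val k)); split.
- by move=> k; apply: b_inv; apply: enum_valP.
- move=> r r0 k; pose r' x := \sum_(l | enum_val l == x) r l.
  have r'E l : r' (enum_val l) = r l.
    rewrite /r' (eq_bigl (pred1 l)) ?big_pred1_eq // => l'.
    by rewrite (inj_eq enum_val_inj).
  rewrite -r'E; apply: b_free; last exact: enum_valP.
  by rewrite big_enum_val -[RHS]r0; apply: eq_bigr => l _; rewrite r'E.
move=> p p_inv p_hom; have [r ->] := b_gen p p_inv p_hom.
by exists (fun k => r (enum_val k)); rewrite big_enum_val.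
Qed.

(** In the coordinates of [b], the rows of M span the ideal. An on-shell basis completes them to a
    basis of the row space, so its size is unique, and the complement M^C supplies one. Both facts
    are needed to evaluate [xget]. *)
Lemma onshell_dimE_abstract i c c' (b : 'I_c -> MR) (b' : 'I_c' -> MR) :
  (forall k, invariant (b k) /\ b k \is i.-homog) ->
  (forall r : 'I_c -> R, \sum_k r k *: b k = 0 -> forall k, r k = 0) ->
  (forall p, invariant p -> p \is i.-homog -> exists r : 'I_c -> R, p = \sum_k r k *: b k) ->
  (forall k, moment_ideal_inv a (b' k) /\ b' k \is i.-homog) ->
  (forall r : 'I_c' -> R, \sum_k r k *: b' k = 0 -> forall k, r k = 0) ->
  (forall p, moment_ideal_inv a p -> p \is i.-homog ->
     exists r : 'I_c' -> R, p = \sum_k r k *: b' k) ->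
  (onshell_dim R a i + c')%N = c.
Proof.
move=> b_inv b_free b_gen b'_inv b'_free b'_gen.
pose lin d (f : 'I_d -> MR) (v : 'rV[R]_d) := \sum_k v 0 k *: f k.
have lin_inj v : lin c b v = 0 -> v = 0.
  by move=> /b_free v0; apply/rowP => k; rewrite mxE v0.
have lin_sub v w : lin c b (v - w) = lin c b v - lin c b w.
  by rewrite -sumrB; apply: eq_bigr => k _; rewrite !mxE scalerBl.
have lin_coord d (f : 'I_d -> MR) (F : 'M[R]_(d, c)) :
    (forall k, f k = lin c b (row k F)) -> forall v, lin d f v = lin c b (v *m F).
  move=> fF v; rewrite /lin; under [RHS]eq_bigr do rewrite mxE scaler_suml.
  rewrite exchange_big /=; apply: eq_bigr => k _; rewrite fF scaler_sumr.
  by apply: eq_bigr => l _; rewrite mxE scalerA.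
have coordP (p : MR) : invariant p -> p \is i.-homog -> exists v, p = lin c b v.
  move=> p_inv p_hom; have [r ->] := b_gen p p_inv p_hom.
  by exists (\row_k r k); apply: eq_bigr => k _; rewrite mxE.
have coordsP d (f : 'I_d -> MR) : (forall k, invariant (f k) /\ f k \is i.-homog) ->
    exists F : 'M[R]_(d, c), forall k, f k = lin c b (row k F).
  move=> f_inv; have [v vE] := choice (fun k => coordP _ (f_inv k).1 (f_inv k).2).
  by exists (\matrix_(k < d) v k) => k; rewrite rowK.
have [M ME] : exists M : 'M[R]_(c', c), forall k, b' k = lin c b (row k M).
  by apply: coordsP => k; have [[_ ?] ?] := b'_inv k.
have ideal_lin v : moment_ideal_inv a (lin c' b' v).
  split; last by apply: invariant_sum => k _; apply: invariantZ; case: (b'_inv k) => -[].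
  have [q qE] := choice (fun k => (b'_inv k).1.1).
  exists (\sum_k v 0 k *: q k); rewrite mulr_suml; apply: eq_bigr => k _.
  by rewrite -scalerAl -qE.
have lin_hom d (f : 'I_d -> MR) v : (forall k, f k \is i.-homog) -> lin d f v \is i.-homog.
  by move=> f_hom; apply: dhomog_sum => k _; apply: dhomogZ.
have M_free : row_free M.
  rewrite -kermx_eq0; apply/rowV0P => v /sub_kermxP vM.
  have : lin c' b' v = 0 by rewrite (lin_coord _ _ _ ME) vM /lin big1 // => k _; rewrite mxE scale0r.
  by move=> /b'_free v0; apply/rowP => k; rewrite mxE v0.
have dim_uniq d (e : 'I_d -> MR) : onshell_basis a i e -> (d + c')%N = c.
  case=> e_inv e_free e_gen; have [F FE] := coordsP d e e_inv.
  have A_free : row_free (col_mx F M).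
    rewrite -kermx_eq0; apply/rowV0P => v /sub_kermxP.
    rewrite -[v]hsubmxK mul_row_col => vFM.
    have E : lin d e (lsubmx v) = lin c' b' (- rsubmx v).
      rewrite (lin_coord _ _ _ FE) (lin_coord _ _ _ ME) mulNmx.
      by congr (lin c b _); apply/eqP; rewrite -subr_eq0 opprK vFM.
    have v1 : lsubmx v = 0.
      apply/rowP => k; rewrite [RHS]mxE; apply: (e_free (fun k => (lsubmx v) 0 k)).
      by rewrite -/(lin d e (lsubmx v)) E.
    move: vFM; rewrite v1 mul0mx add0r => vM.
    have -> : rsubmx v = 0.
      by apply: (row_free_inj M_free); rewrite /= vM mul0mx.
    by rewrite row_mx0.
  have A_full : row_full (col_mx F M).
    rewrite -sub1mx; apply/row_subP => k.
    have [| |r r_id] := e_gen (lin c b (row k 1%:M)).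
    - by apply: invariant_sum => l _; apply: invariantZ; case: (b_inv l).
    - by apply: lin_hom => l; case: (b_inv l).
    have [|r' r'E] := b'_gen _ r_id.
      have -> : lin c b (row k 1%:M) - \sum_(l < d) r l *: e l =
          lin c b (row k 1%:M - (\row_l r l) *m F).
        rewrite lin_sub -(lin_coord _ _ _ FE); congr (_ - _).
        by apply: eq_bigr => l _; rewrite mxE.
      by apply: lin_hom => l; case: (b_inv l).
    apply/submxP; exists (row_mx (\row_l r l) (\row_l r' l)).
    rewrite mul_row_col; apply/eqP; rewrite -subr_eq0; apply/eqP/lin_inj.
    rewrite opprD addrA lin_sub lin_sub -(lin_coord _ _ _ FE) -(lin_coord _ _ _ ME).
    rewrite [X in X - _](_ : _ = \sum_k r' k *: b' k).
      by apply/eqP; rewrite subr_eq0; apply/eqP/eq_bigr => l _; rewrite mxE.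
    rewrite -r'E; congr (_ - _).
    by apply: eq_bigr => l _; rewrite mxE.
  by have /eqP r1 := A_free; have /eqP r2 := A_full; apply: etrans (esym r1) r2.
have rankM : \rank M = c' by apply/eqP.
have le_c'c : (c' <= c)%N by have := rank_leq_col M; rewrite rankM.
suff -> : onshell_dim R a i = (c - c')%N by rewrite subnK.
apply: xget_unique => [|d [e /dim_uniq <-]]; last by rewrite addnK.
pose F := row_base (M^C)%MS.
have rankC : \rank (M^C)%MS = (c - c')%N by rewrite mxrank_compl rankM.
rewrite -rankC; exists (fun k => lin c b (row k F)).
have FE (v : 'rV[R]_(\rank (M^C)%MS)) : \sum_k v 0 k *: lin c b (row k F) = lin c b (v *m F).
  by rewrite -(lin_coord _ (fun k => lin c b (row k F))).
split.
- move=> k; split; first by apply: invariant_sum => l _; apply: invariantZ; case: (b_inv l).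
  by apply: lin_hom => l; case: (b_inv l).
- move=> r r_id; have [|r' r'E] := b'_gen _ r_id.
    by apply: dhomog_sum => k _; apply: dhomogZ; apply: lin_hom => l; case: (b_inv l).
  pose v := \row_k r k; pose v' := \row_k r' k.
  have E : v *m F = v' *m M.
    apply/eqP; rewrite -subr_eq0; apply/eqP/lin_inj.
    rewrite lin_sub -FE -(lin_coord _ _ _ ME); apply/eqP; rewrite subr_eq0; apply/eqP.
    transitivity (\sum_k r k *: lin c b (row k F)); first by apply: eq_bigr => k _; rewrite mxE.
    by rewrite r'E; apply: eq_bigr => k _; rewrite mxE.
  have vF0 : v *m F = 0.
    apply/eqP; rewrite -submx0 -(capmx_compl M) sub_capmx E submxMl -E.
    by rewrite (submx_trans (submxMl _ _)) // eq_row_base.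
  have v0 : v = 0 by apply: (row_free_inj (row_base_free (M^C)%MS)); rewrite vF0 mul0mx.
  by move=> k; have /rowP/(_ k) := v0; rewrite !mxE.
move=> p p_inv p_hom; have [v ->] := coordP p p_inv p_hom.
have : (v <= M + M^C)%MS by rewrite submx_full // addsmx_compl_full.
case/sub_addsmxP => -[u1 u2] /= vE.
have /submxP[r rE] : (u2 *m M^C <= F)%MS by rewrite eq_row_base submxMl.
exists (fun k => r 0 k); rewrite FE -rE -lin_sub vE addrK -(lin_coord _ _ _ ME).
exact: ideal_lin.
Qed.

(** Multiplication by J is injective and, by [invariant_div], maps the invariants of degree i - 2
    onto the degree i part of the ideal. *)
Lemma onshell_dimE M i : (i <= M)%N ->
  (onshell_dim R a i + (if (i < 2)%N then 0 else #|balanced a M (i - 2)|))%N =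
  #|balanced a M i|.
Proof.
move=> le_iM; have [b [b_inv b_free b_gen]] := invariant_basis le_iM.
case: ifP => lt_i2.
  apply: (@onshell_dimE_abstract i _ 0 b (fun=> 0)) => // [[]//|r _ []//|p p_id p_hom].
  have [q [-> _ _ q0]] := moment_ideal_homog p_hom p_id.
  by exists (fun=> 0); rewrite big_ord0 q0 // mul0r.
have le_2i : (2 <= i)%N by rewrite leqNgt lt_i2.
have [|b' [b'_inv b'_free b'_gen]] := @invariant_basis M (i - 2).
  by rewrite (leq_trans (leq_subr _ _)).
apply: (@onshell_dimE_abstract i _ _ b (fun k => b' k * J)) => //.
- move=> k; have [b'k_inv b'k_hom] := b'_inv k; split.
    by split; [exists (b' k)|apply: invariantM => //; apply: moment_map_invariant].
  by have := dhomogM b'k_hom moment_map_homog; rewrite subnK.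
- move=> r r0; apply: b'_free; apply: (mulIf moment_map_neq0); rewrite mul0r -[RHS]r0.
  by rewrite mulr_suml; apply: eq_bigr => k _; rewrite scalerAl.
move=> p p_id p_hom; have [q [-> q_inv q_hom _]] := moment_ideal_homog p_hom p_id.
have [r ->] := b'_gen q q_inv q_hom; exists r.
by rewrite mulr_suml; apply: eq_bigr => k _; rewrite scalerAl.
Qed.

End OnShell.

(** * The on-shell Hilbert series as a fraction *)

Section HilbertSeries.
Variables (R : realType) (n : nat) (a : 'I_n -> int).
Hypothesis a_neq0 : exists j, a j != 0.
Local Notation al := (fun j => `|a j|%N).
Local Notation SX := ({poly {poly R}}).

Let truncated (N : nat) : SX :=
  \prod_j \sum_(m < N.+1) ('X *: 'X^(al j)) ^+ m.

Let truncated_sum N : truncated N = \sum_(u : {ffun 'I_n -> 'I_N.+1})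
  'X^(\sum_j u j) *: 'X^(\sum_j al j * u j).
Proof.
rewrite /truncated bigA_distr_bigA; apply: eq_bigr => u _ /=.
under eq_bigr do rewrite exprZn -exprM.
rewrite scaler_prod !prodrXr; congr (_ *: _).
Qed.

Let pairing_truncated N i : (i <= N)%N ->
  (coef_pairing (truncated N) (truncated N))`_i = #|balanced a N i|%:R.
Proof.
move=> le_iN.
have pair_sum (I : finType) (c : I -> {poly R}) (e : I -> nat) (B : SX) :
    coef_pairing (\sum_u c u *: 'X^(e u)) B = \sum_u c u * B`_(e u).
  pose N' := (\max_u (e u).+1 + size B)%N.
  rewrite (@coef_pairingE _ N'); last first.
    move=> r le_r; rewrite [B`_r]nth_default ?mulr0 //.
    by apply: leq_trans le_r; rewrite leq_addl.
  under eq_bigr do rewrite coef_sum mulr_suml.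
  rewrite exchange_big /=; apply: eq_bigr => u _.
  have lt_u : (e u < N')%N.
    have le_u : ((e u).+1 <= \max_v (e v).+1)%N by rewrite (bigD1 u) //= leq_maxl.
    by rewrite (leq_trans le_u) // leq_addr.
  rewrite (bigD1 (Ordinal lt_u)) //= big1 ?addr0 => [|r /negPf neq_r].
    by rewrite coefZ coefXn eqxx mulr1.
  by rewrite coefZ coefXn (neq_r : (r == e u :> nat) = false) mulr0 mul0r.
rewrite {1}truncated_sum pair_sum truncated_sum coef_sum.
transitivity (\sum_(u : {ffun 'I_n -> 'I_N.+1}) \sum_(v : {ffun 'I_n -> 'I_N.+1})
   ((u, v) \in balanced a N i)%:R : R).
  apply: eq_bigr => u _; rewrite coef_sum mulr_sumr coef_sum; apply: eq_bigr => v _.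
  rewrite coefZ coefXn inE /= mulr_natr mulrnAr -exprD.
  by case: eqP => _; rewrite ?mulr0n ?andbF ?coef0 // andbT mulr1n coefXn eq_sym.
rewrite pair_bigA /= -sum1_card natr_sum [RHS]big_mkcond /=.
by apply: eq_bigr => -[u v] _ /=; case: (_ \in _).
Qed.

Let zeros_poly : {poly R} := \prod_(j | al j == 0%N) (1 - 'X) ^+ 2.

Definition onshell_num (Phi : {mpoly int[n]}) : {poly R} :=
  (1 - 'X^2) * evz (fun=> 'X) Phi.

Definition onshell_den : {poly R} := hilb_denom al (fun=> 'X) * zeros_poly.

(** Each weight 0 contributes a truncation of 1 / (1 - x) to both arguments of the pairing;
    [zeros_poly] cancels its square up to degree N. *)
Let pairing_factor N k : (k <= N)%N ->
  (hilb_denom al (fun=> 'X : {poly R}) * zeros_poly *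
     coef_pairing (truncated N) (truncated N))`_k =
  (hilb_denom al (fun=> 'X) * coef_pairing (trunc_inverse al (fun=> 'X) N)
     (trunc_inverse al (fun=> 'X) N))`_k.
Proof.
move=> le_kN; set A := trunc_inverse al _ N.
pose s : {poly R} := \prod_(j | al j == 0%N) \sum_(m < N.+1) 'X^m.
have tE : truncated N = s%:P * A.
  rewrite /truncated (bigID (fun j => al j == 0%N)) /=; congr (_ * _); last first.
    by apply: eq_bigl => j; rewrite -lt0n.
  rewrite /s rmorph_prod; apply: eq_bigr => j /eqP /= ->.
  rewrite rmorph_sum; apply: eq_bigr => m _ /=.
  by rewrite expr0 alg_polyC -rmorphXn.
have -> : coef_pairing (truncated N) (truncated N) = s ^+ 2 * coef_pairing A A.
  rewrite tE coef_pairingZr /coef_pairing expr2 -mulrA; congr (_ * _).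
  rewrite -/(coef_pairing (s%:P * A) A) coef_pairingEr mulr_sumr.
  by apply: eq_bigr => r _; rewrite coefCM mulrA.
rewrite -mulrA mulrCA [zeros_poly * _]mulrA.
have zs : eq_upto N.+1 (zeros_poly * s ^+ 2) 1.
  rewrite /zeros_poly /s -prodrXl -big_split /= => r lt_r.
  transitivity ((\prod_(j | al j == 0%N) (1 : {poly R}))`_r); last by rewrite big1.
  move: r lt_r; apply: eq_upto_prod => j _ r lt_r.
  rewrite -exprMn -opprB mulNr -subrX1 opprB sqrrB expr1n mul1r !coefD coefN coefMn.
  by rewrite -exprM !coefXn !ltn_eqF ?mul0rn ?oppr0 ?addr0 // (leq_trans lt_r) // leq_pmulr.
have := eq_upto_mul zs (fun r _ => erefl ((hilb_denom al (fun=> 'X) * coef_pairing A A)`_r)).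
by move/(_ k); rewrite mul1r ltnS => <- //; congr (polyseq _)`_k; ring.
Qed.

Lemma hilbert_expansion (Phi : {mpoly int[n]}) :
  (exists N0, forall N k, (N0 <= N)%N -> (k <= N)%N ->
     let x := fun=> 'X : {poly R} in
     (hilb_denom al x * coef_pairing (trunc_inverse al x N) (trunc_inverse al x N))`_k
       = (evz x Phi)`_k) ->
  expansion_at0 (onshell_num Phi) onshell_den (fun i => (onshell_dim R a i)%:R).
Proof.
move=> [N0 PhiE]; split.
  rewrite -horner_coef0 /onshell_den hornerM -/(horner_eval 0 (hilb_denom _ _)).
  rewrite rmorph_hilb_denom mulf_neq0 //.
    apply/prodf_neq0 => j al_j; apply/prodf_neq0 => k al_k.
    by rewrite /= /horner_eval hornerX expr0n gtn_eqF // mul0r subr0 oner_neq0.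
  rewrite horner_prod; apply/prodf_neq0 => j _.
  by rewrite horner_exp hornerD hornerN hornerX hornerC subr0 expr1n oner_neq0.
move=> k; pose N := maxn k N0.
have le_kN : (k <= N)%N by rewrite leq_maxl.
pose Pr := coef_pairing (truncated N) (truncated N).
have dimE i : (i <= k)%N -> (onshell_dim R a i)%:R = ((1 - 'X^2) * Pr)`_i.
  move=> le_ik; have le_iN := leq_trans le_ik le_kN.
  have := onshell_dimE R a_neq0 le_iN; rewrite mulrBl mul1r coefB coefXnM.
  rewrite pairing_truncated // => <-; rewrite natrD; case: ltnP => lt_i2.
    by rewrite addr0 subr0.
  by rewrite pairing_truncated ?addrK // (leq_trans (leq_subr _ _)).
have E : eq_upto k.+1 (onshell_den * Pr) (evz (fun=> 'X) Phi).
  move=> i; rewrite ltnS => le_ik.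
  by rewrite pairing_factor ?PhiE ?leq_maxr // (leq_trans le_ik).
transitivity ((onshell_den * ((1 - 'X^2) * Pr))`_k).
  by rewrite /conv coefM; apply: eq_bigr => j _; rewrite dimE // leq_subr.
rewrite mulrCA /onshell_num.
exact: (eq_upto_mul (fun r _ => erefl ((1 - 'X^2 : {poly R})`_r)) E).
Qed.

End HilbertSeries.

(** * Power series attached to a fraction *)

Section PowerSeries.
Variable R : realType.
Implicit Types (p q : {poly R}) (u : nat -> R).

Lemma conv_poly N p u k : (k < N)%N -> conv p u k = (p * \poly_(i < N) u i)`_k.
Proof.
move=> lt_kN; rewrite /conv coefM; apply: eq_bigr => j _; rewrite coef_poly.
by rewrite (leq_ltn_trans (leq_subr _ _)).
Qed.

Lemma poly_order p : p != 0 -> exists m, order_at0 m p.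
Proof.
move=> p0; have [m [r r0 pE]] := multiplicity_XsubC p 0.
exists m, r; first by rewrite pE subr0 mulrC.
by move: r0; rewrite p0.
Qed.

(** The quotient is built one degree at a time; its polynomial approximations [U N] agree on their
    common range since r(0) <> 0. *)
Lemma series_quotient p q m : order_at0 m q -> (forall i, (i < m)%N -> p`_i = 0) ->
  exists u, forall k, conv q u k = p`_k.
Proof.
move=> [r -> r0] p_m; pose p' := drop_poly m p.
have pE : p = 'X^m * p'.
  apply/polyP => i; rewrite coefXnM coef_drop_poly.
  by case: ltnP => [/p_m //|le_mi]; rewrite subnK.
have /choice[U UE] N : exists U : {poly R}, forall i, (i < N)%N -> (r * U)`_i = p'`_i.
  elim: N => [|N [U UE]]; first by exists 0.
  exists (U + ((p'`_N - (r * U)`_N) / r`_0) *: 'X^N) => i.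
  rewrite ltnS mulrDr coefD -scalerAr coefZ coefMXn leq_eqVlt => /predU1P[->|lt_iN].
    by rewrite ltnn subnn divfK -?horner_coef0 // addrC subrK.
  by rewrite lt_iN mulr0 addr0 UE.
have U_stable i N : (i < N)%N -> (U N)`_i = (U i.+1)`_i.
  move=> lt_iN; apply/eqP; rewrite -subr_eq0 -coefB; apply/eqP.
  apply: (coef_mul_eq0 r0 (m := i.+1)) => // k lt_k.
  by rewrite mulrBr coefB !UE ?subrr // (leq_trans lt_k).
exists (fun i => (U i.+1)`_i) => k.
rewrite (@conv_poly k.+1) // pE -mulrA !coefXnM; case: ltnP => // le_mk.
rewrite -(UE k.+1); last by rewrite ltnS leq_subr.
rewrite !coefM; apply: eq_bigr => j _; rewrite coef_poly.
have lt_j : (k - m - j < k.+1)%N by rewrite ltnS; lia.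
by rewrite lt_j -(U_stable _ k.+1).
Qed.

(** [onshell_laurent] allows any fraction with the given expansion at 0. Two such fractions are
    equal, so the Laurent coefficients can be computed from one of them. *)
Lemma expansion_at1_indep M P Q P' Q' u g :
  expansion_at0 P Q u -> expansion_at0 P' Q' u ->
  expansion_at1 M P' Q' g -> expansion_at1 M P Q g.
Proof.
move=> [Q0 Qu] [Q'0 Q'u] [Q'_neq0 g'].
have cross : Q * P' = Q' * P.
  apply/polyP => k; pose V := \poly_(i < k.+1) u i.
  have QV : eq_upto k.+1 (Q * V) P by move=> i lt_i; rewrite -conv_poly // Qu.
  have Q'V : eq_upto k.+1 (Q' * V) P' by move=> i lt_i; rewrite -conv_poly // Q'u.
  have E := eq_upto_mul (fun r _ => erefl Q`_r) Q'V (ltnSn k).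
  have E' := eq_upto_mul (fun r _ => erefl Q'`_r) QV (ltnSn k).
  by rewrite -E -E' mulrCA.
have Q_neq0 : Q != 0 by apply: contraNneq Q0 => ->; rewrite coef0.
split=> // k; set q := Q \Po _; set p := P \Po _.
have q'_neq0 : Q' \Po (1 - 'X) != 0.
  have -> : (1 - 'X : {poly R}) = - ('X - 1%:P) by rewrite opprB polyC1.
  by rewrite comp_poly2_eq0 ?Q'_neq0 // size_polyN size_XsubC.
(* Cancelling y^e in Q'(1 - y) costs e coefficients, which sets the truncation at k + e + 1. *)
have [e [r q'E r0]] := poly_order q'_neq0.
pose N := (k + e).+1; pose G := \poly_(i < N) g i.
have lt_kN : (k < N)%N by rewrite ltnS leq_addr.
rewrite (conv_poly _ _ lt_kN) -/G; apply/eqP; rewrite -subr_eq0 -coefB; apply/eqP.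
apply: (coef_mul_eq0 r0 (m := k.+1)) => // i; rewrite ltnS => le_ik.
have -> : (r * (q * G - 'X^M * p))`_i = ('X^e * r * (q * G - 'X^M * p))`_(i + e).
  by rewrite -mulrA coefXnM ltnNge leq_addl addnK.
rewrite -q'E mulrBr coefB; apply/eqP; rewrite subr_eq0; apply/eqP.
have q'G : eq_upto N ((Q' \Po (1 - 'X)) * G) ('X^M * (P' \Po (1 - 'X))).
  by move=> l lt_l; rewrite -conv_poly // g'.
have lt_ieN : (i + e < N)%N by rewrite ltnS leq_add2r.
rewrite mulrCA (eq_upto_mul (fun r _ => erefl q`_r) q'G lt_ieN).
congr (polyseq _)`_(i + e); rewrite mulrCA [RHS]mulrCA; congr (_ * _).
by rewrite /q /p -!rmorphM /= cross.
Qed.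

End PowerSeries.

(** * The first Laurent coefficients *)

Section LaurentHead.
Variables (R : realType) (n : nat) (a : 'I_n -> int).
Hypothesis a_neq0 : exists j, a j != 0.
Local Notation C := (R[i]).
Local Notation toC := (real_complex R).
Local Notation al := (fun j => `|a j|%N).
Variable Phi : {mpoly int[n]}.
Hypothesis expansion :
  expansion_at0 (onshell_num R Phi) (onshell_den R a) (fun i => (onshell_dim R a i)%:R).
Variables (m : nat) (h0 h2 : C).
Hypothesis den_order : order_at0 m (theta_den C al (scale al 0)).
Hypothesis num_den : forall i, (i < m + 4)%N ->
  (theta_num C Phi (scale al 0))`_i = (theta_den C al (scale al 0) * even_series h0 h2)`_i.

Let p : {poly R} := 'X^(2 * n - 2) * (onshell_num R Phi \Po (1 - 'X)).
Let q : {poly R} := onshell_den R a \Po (1 - 'X).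
Let D : {poly C} := (2%:P - 'X) ^+ n.-1.

Let n_gt0 : (0 < n)%N.
Proof. by case: n a a_neq0 => // ? [[]]. Qed.

Let scaleE (S : nzRingType) : (fun k => (1 - 'X : {poly S}) ^+ scale al 0 k) = (fun=> 1 - 'X).
Proof. by apply: funext => k; rewrite scale0. Qed.

Let map_1subX : map_poly toC (1 - 'X) = 1 - 'X.
Proof. by rewrite rmorphB rmorph1 /= map_polyX. Qed.

Let num_shift : p = 'X^(2 * n - 2) * ((1 - (1 - 'X) ^+ 2) * evz (fun=> 1 - 'X) Phi).
Proof.
rewrite /p /onshell_num; congr (_ * _).
have := evz_morph (comp_poly (1 - 'X : {poly R})) (fun=> 'X) Phi.
rewrite comp_polyM comp_polyB comp_polyC comp_Xn_poly => ->; congr (_ * mmap _ _ _).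
by apply: funext => k /=; rewrite comp_polyX.
Qed.

Let den_shift : q = hilb_denom al (fun=> 1 - 'X) * \prod_(j | al j == 0%N) 'X ^+ 2.
Proof.
rewrite /q /onshell_den comp_polyM; congr (_ * _).
  have := rmorph_hilb_denom al (comp_poly (1 - 'X : {poly R})) (fun=> 'X) => /= ->.
  by congr hilb_denom; apply: funext => k /=; rewrite comp_polyX.
have := rmorph_prod (comp_poly (1 - 'X : {poly R})) (index_enum 'I_n)
  (fun j => al j == 0%N) (fun=> (1 - 'X) ^+ 2) => /= ->.
apply: eq_bigr => j _; have := rmorphXn (comp_poly (1 - 'X : {poly R})) 2 (1 - 'X) => /= ->.
by rewrite comp_polyB comp_polyC comp_polyX opprB addrC subrK.
Qed.

(** At s = 0 the product of the 1 - x_k^2 is ((2 - y) y)^n. One factor is the 1 - x^2 due to J; the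
    other n - 1, together with the y^(n-1) of [theta_num], give D y^(2n-2). This matches the order
    of the pole. *)
Let numE : theta_num C Phi (scale al 0) = D * map_poly toC p.
Proof.
have evE : map_poly toC (evz (fun=> 1 - 'X) Phi) = evz (fun=> 1 - 'X) Phi.
  have := evz_morph (map_poly toC) (fun=> 1 - 'X) Phi => /= ->.
  by congr mmap; apply: funext => k /=; exact: map_1subX.
rewrite num_shift !rmorphM /= evE map_polyXn rmorphB rmorph1 rmorphXn /= map_1subX.
rewrite /theta_num scaleE (eq_bigr (fun=> (2%:P - 'X) * 'X)) => [|k _]; last first.
  by rewrite scale0 mul1n polyC_natr; ring.
rewrite (_ : 1 - (1 - 'X) ^+ 2 = (2%:P - 'X) * 'X :> {poly C}); last by rewrite polyC_natr; ring.
rewrite prodr_const cardT size_enum_ord /D.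
have -> : (2 * n - 2 = n.-1 + n.-1)%N by move: n_gt0; lia.
have -> : ((2%:P - 'X) * 'X) ^+ n = (2%:P - 'X) * 'X * ((2%:P - 'X) * 'X) ^+ n.-1 :> {poly C}.
  by rewrite -exprS prednK.
rewrite exprMn exprD.
move: ((2%:P - 'X) ^+ _) ('X^_) (evz _ _) => x y z; ring.
Qed.

Let denE : theta_den C al (scale al 0) = D * map_poly toC q.
Proof.
rewrite den_shift rmorphM /= /theta_den scaleE /D -mulrA; congr (_ * (_ * _)).
  have := rmorph_hilb_denom al (map_poly toC) (fun=> 1 - 'X) => /= ->.
  by congr hilb_denom; apply: funext => k /=; rewrite map_1subX.
rewrite rmorph_prod; apply: eq_bigr => j _ /=.
by rewrite scale0 expr1 map_polyXn opprB addrC subrK.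
Qed.

Let D0 : D.[0] != 0.
Proof.
rewrite horner_exp hornerD hornerN hornerX hornerC subr0 expf_neq0 //.
by rewrite pnatr_eq0.
Qed.

Let toC0 : toC 0 = 0. Proof. by []. Qed.

Let den_coef : (forall i, (i < m)%N -> q`_i = 0) /\ q`_m != 0.
Proof.
have [den_lt den_m] := order_at0_coef den_order.
have q_lt i : (i < m)%N -> (map_poly toC q)`_i = 0.
  by apply: (coef_mul_eq0 D0) => k lt_k; rewrite -denE den_lt.
split=> [i /q_lt|].
  by rewrite coef_map => /= /complexI.
apply: contra den_m => /eqP qm; rewrite denE coefM big1 // => j _.
have [lt_m|ge_m] := ltnP (m - j) m; first by rewrite q_lt ?mulr0.
have -> : (m - j = m)%N by have := leq_subr j m; lia.
by rewrite coef_map /= qm toC0 mulr0.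
Qed.

Let num_coef i : (i < m + 4)%N ->
  toC p`_i = (map_poly toC q * even_series h0 h2)`_i.
Proof.
move=> lt_i; rewrite -[toC _]coef_map /=; apply/eqP; rewrite -subr_eq0 -coefB; apply/eqP.
apply: (coef_mul_eq0 D0 (m := m + 4)) => // k lt_k.
by rewrite mulrBr coefB -numE mulrA -denE num_den // subrr.
Qed.

Lemma laurent_exists : exists gamma : nat -> R, onshell_laurent a gamma.
Proof.
have [q_lt q_m] := den_coef.
have q_neq0 : q != 0 by apply: contraNneq q_m => ->; rewrite coef0.
have q_ord : order_at0 m q.
  exists (drop_poly m q); last by rewrite horner_coef0 coef_drop_poly.
  apply/polyP => i; rewrite coefXnM coef_drop_poly.
  by case: ltnP => [/q_lt //|le_mi]; rewrite subnK.
have [|gamma gammaE] := series_quotient (p := p) q_ord.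
  move=> i lt_im; apply: (@complexI R); rewrite toC0 num_coef ?(leq_trans lt_im) ?leq_addr //.
  rewrite coefM big1 // => j _; rewrite coef_map /= q_lt ?toC0 ?mul0r //.
  by apply: leq_ltn_trans lt_im; rewrite -ltnS.
exists gamma, (onshell_num R Phi), (onshell_den R a); split=> //; split=> //.
by apply: contraNneq q_neq0 => den0; rewrite /q den0 comp_poly0.
Qed.

(** Strong induction on i: in the coefficient of index m + i all other terms agree, and q_m is
    nonzero. *)
Lemma laurent_head gamma i : onshell_laurent a gamma -> (i < 4)%N ->
  toC (gamma i) = (even_series h0 h2)`_i.
Proof.
move=> [P [Q [PQu PQg]]]; have [_ gammaE] := expansion_at1_indep expansion PQu PQg.
have [q_lt q_m] := den_coef.
elim/ltn_ind: i => i IH lt_i4.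
have := gammaE (m + i)%N; rewrite -/p -/q => /(congr1 toC).
rewrite num_coef ?ltn_add2l // /conv coefM rmorph_sum -addnS !big_split_ord /=.
rewrite [X in X + _ = _ -> _]big1 => [|j _]; last by rewrite q_lt ?mul0r ?toC0.
rewrite [X in _ = X + _ -> _]big1 => [|j _]; last by rewrite coef_map /= q_lt ?toC0 ?mul0r.
rewrite !add0r.
rewrite !big_ord_recl /= !addn0 !addKn coef_map /= rmorphM.
rewrite [X in _ + X = _](eq_bigr (fun j : 'I_i =>
  (map_poly toC q)`_(m + bump 0 j) * (even_series h0 h2)`_(m + i - (m + bump 0 j)))).
  by move/addIr/(mulfI _); apply; rewrite fmorph_eq0.
move=> j _; rewrite rmorphM coef_map /= IH //.
  by rewrite subnDl /bump /=; have := ltn_ord j; lia.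
by rewrite subnDl /bump /=; lia.
Qed.

End LaurentHead.

(** * Alternants and interpolation *)

Section Alternants.
Variable S : comNzRingType.

Definition alternant_mx m (x : 'I_m -> S) (e : 'I_m -> nat) : 'M[S]_m :=
  \matrix_(i, j) x i ^+ e j.

Definition staircase m (j : 'I_m) : nat := (m - j.+1)%N.

(** Newton's form involves no division, so the ring is arbitrary and nodes may coincide. *)
Lemma newton_interpolation (x : nat -> S) (p : {poly S}) m : exists c : nat -> S,
  forall i, (i < m)%N -> p.[x i] = \sum_(k < m) (\prod_(l < k) (x i - x l)) * c k.
Proof.
have [c [q pE]] : exists (c : nat -> S) (q : {poly S}), p = \sum_(k < m)
    (\prod_(l < k) ('X - (x l)%:P)) * (c k)%:P + q * \prod_(l < m) ('X - (x l)%:P).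
  elim: m => [|m [c [q ->]]].
    by exists (fun=> 0), p; rewrite !big_ord0 add0r mulr1.
  have /factor_theorem[q' q'E] : root (q - (q.[x m])%:P) (x m).
    by rewrite /root !hornerE subrr.
  exists (fun k => if k == m then q.[x m] else c k), q'.
  rewrite [X in _ = X + _]big_ord_recr [X in _ = _ + q' * X]big_ord_recr /= eqxx.
  rewrite mulrCA -q'E.
  rewrite [in RHS](eq_bigr (fun k : 'I_m => (\prod_(l < k) ('X - (x l)%:P)) * (c k)%:P)).
    by ring.
  by move=> k _; rewrite (ltn_eqF (ltn_ord k)).
exists c => i lt_im; rewrite {1}pE hornerD hornerM horner_prod.
rewrite [X in _ + _ * X](bigD1 (Ordinal lt_im)) //= hornerXsubC subrr mul0r mulr0 addr0.
rewrite horner_sum; apply: eq_bigr => k _; rewrite hornerM hornerC horner_prod.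
by congr (_ * _); apply: eq_bigr => l _; rewrite hornerXsubC.
Qed.

Definition newton_mx m (x : 'I_m -> S) : 'M[S]_m :=
  \matrix_(i, k) \prod_(l < m | (l < k)%N) (x i - x l).

Lemma alternant_newton m (x : 'I_m -> S) e : exists H : 'M[S]_m,
  alternant_mx x e = newton_mx x *m H.
Proof.
case: m x e => [|m] x e; first by exists 0; apply/matrixP => -[].
have /choice[c cE] (j : 'I_m.+1) := newton_interpolation (fun i => x (inord i)) 'X^(e j) m.+1.
exists (\matrix_(k, j) c j k); apply/matrixP => i j; rewrite !mxE.
have := cE j i (ltn_ord i); rewrite hornerXn inord_val => ->.
apply: eq_bigr => k _; rewrite !mxE; congr (_ * _).
rewrite (big_ord_widen m.+1 (fun l => x i - x (inord l))); last by rewrite ltnW.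
by apply: eq_bigr => l _; rewrite inord_val.
Qed.

Lemma det_newton m (x : 'I_m -> S) :
  \det (newton_mx x) = \prod_(i < m) \prod_(l < m | (l < i)%N) (x i - x l).
Proof.
rewrite det_trig; first by apply: eq_bigr => i _; rewrite mxE.
apply/is_trig_mxP => i k lt_ik; rewrite mxE (bigD1 i) //= subrr mul0r.
by [].
Qed.

Lemma det_staircase m (x : 'I_m -> S) :
  \det (alternant_mx x (@staircase m)) =
  (-1) ^+ perm (@rev_ord_inj m) * \prod_(i < m) \prod_(l < m | (l < i)%N) (x i - x l).
Proof.
have -> : alternant_mx x (@staircase m) =
    (row_perm (perm (@rev_ord_inj m)) (Vandermonde m (\row_i x i)))^T.
  by apply/matrixP => i j; rewrite !mxE permE.
rewrite det_tr row_permE det_mulmx det_perm det_Vandermonde.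
congr (_ * _); rewrite (exchange_big_dep xpredT) //=.
by apply: eq_bigr => i _; apply: eq_bigr => l _; rewrite !mxE.
Qed.

(** The Newton matrix is a triangular left factor of the alternant matrix, and its determinant is
    the Vandermonde product up to sign. *)
Lemma alternant_staircase m (x : 'I_m -> S) e : exists h,
  \det (alternant_mx x e) = \det (alternant_mx x (@staircase m)) * h.
Proof.
have [H ->] := alternant_newton x e; rewrite det_staircase -det_newton.
by set b := perm (@rev_ord_inj m); exists ((-1) ^+ b * \det H);
  rewrite det_mulmx mulrACA -expr2 sqrr_sign mul1r.
Qed.

End Alternants.

Lemma det_staircase_neq0 (F : fieldType) m (x : 'I_m -> F) : injective x ->
  \det (alternant_mx x (@staircase m)) != 0.
Proof.
move=> x_inj; rewrite det_staircase mulf_neq0 ?signr_eq0 //.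
apply/prodf_neq0 => i _; apply/prodf_neq0 => l lt_li; rewrite subr_eq0.
by apply: contraTneq lt_li => /x_inj ->; rewrite ltnn.
Qed.

Section Lagrange.
Variable F : fieldType.

Definition lagrange_lead m (x f : 'I_m -> F) : F :=
  \sum_j f j / \prod_(k | k != j) (x j - x k).

(* The leading coefficient of the interpolation polynomial of [f] at the nodes
   [x] is a ratio of two alternants. *)
Lemma det_lagrange m (x f : 'I_m.+1 -> F) : injective x ->
  \det (\matrix_(i, j) (if j == ord0 then f i else x i ^+ staircase j)) =
  lagrange_lead x f * \det (alternant_mx x (@staircase m.+1)).
Proof.
move=> x_inj; have x_neq i k : k != i -> x i - x k != 0.
  by move=> neq_ki; rewrite subr_eq0 eq_sym (inj_eq x_inj).
pose w j := \prod_(k | k != j) (x j - x k).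
have w_neq0 j : w j != 0 by apply/prodf_neq0 => k /x_neq.
pose L := \sum_j (f j / w j) *: \prod_(k | k != j) ('X - (x k)%:P).
have size_w j : size (\prod_(k | k != j) ('X - (x k)%:P)) = m.+1.
  rewrite -(big_filter _ (fun k => k != j)) size_prod_XsubC size_filter -sum1_count.
  by rewrite (sum1_card (predC1 j)) cardC1 card_ord.
have sL : (size L <= m.+1)%N.
  apply: (leq_trans (size_sum _ _ _)); apply/bigmax_leqP => j _.
  apply: leq_trans (size_scale_leq _ _) _.
  by rewrite size_w.
have Lx i : L.[x i] = f i.
  rewrite horner_sum (bigD1 i) //= [X in _ + X]big1 ?addr0 => [|j neq_ji].
    rewrite hornerZ horner_prod; under eq_bigr do rewrite hornerXsubC.
    by rewrite divfK.
  by rewrite hornerZ horner_prod (bigD1 i) 1?eq_sym //= hornerXsubC subrr mul0r mulr0.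
have Lm : L`_m = lagrange_lead x f.
  rewrite coef_sum; apply: eq_bigr => j _; rewrite coefZ.
  have /monicP : \prod_(k | k != j) ('X - (x k)%:P) \is monic by exact: monic_prod_XsubC.
  by rewrite lead_coefE size_w /= => ->; rewrite mulr1.
(* Column 0 of the right factor lists the coefficients of L from the top degree down, as the
   staircase powers decrease. The factor is triangular with determinant L_m. *)
have -> : \matrix_(i, j) (if j == ord0 then f i else x i ^+ staircase j) =
    alternant_mx x (@staircase m.+1) *m
    \matrix_(i, j) (if j == ord0 then L`_(m - i) else (i == j)%:R).
  apply/matrixP => i j; rewrite !mxE; case: eqP => [j0|/eqP j_neq0].
    rewrite -Lx (horner_coef_wide _ sL) (reindex_inj rev_ord_inj) /=.
    by apply: eq_bigr => k _; rewrite !mxE j0 eqxx mulrC.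
  rewrite (bigD1 j) //= !mxE (negPf j_neq0) eqxx mulr1 big1 ?addr0 // => k neq_kj.
  by rewrite !mxE (negPf j_neq0) (negPf neq_kj) mulr0.
rewrite det_mulmx mulrC; congr (_ * _); rewrite det_trig; last first.
  apply/is_trig_mxP => i j lt_ij; rewrite mxE ifF; last by apply/eqP => j0; rewrite j0 in lt_ij.
  by rewrite (_ : (i == j) = false) //; apply/eqP => ij; rewrite ij ltnn in lt_ij.
rewrite big_ord_recl mxE eqxx subn0 Lm big1 ?mulr1 // => i _.
by rewrite mxE eqxx.
Qed.

End Lagrange.

Section ExponentAlternants.
Variable F : fieldType.

Definition alternantz m (x : 'I_m -> F) (e : 'I_m -> int) : F :=
  \det (\matrix_(i, j) x i ^ e j).

Lemma alternantz_nat m (x : 'I_m -> F) e : (forall j, 0 <= e j) ->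
  alternantz x e = \det (alternant_mx x (fun j => `|e j|%N)).
Proof.
by move=> e_ge0; congr (\det _); apply/matrixP => i j; rewrite !mxE -{1}(gez0_abs (e_ge0 j)).
Qed.

Lemma alternantz_shift m (x : 'I_m -> F) e (N : nat) :
  N = 0%N \/ (forall i, x i != 0) ->
  alternantz x (fun j => e j + N%:Z) = (\prod_i x i) ^+ N * alternantz x e.
Proof.
case=> [->|x_neq0].
  by rewrite expr0 mul1r; congr (\det _); apply/matrixP => i j; rewrite !mxE addr0.
have -> : (\prod_i x i) ^+ N = \prod_i (\row_k (x k ^+ N)) 0 i.
  by rewrite -prodrXl; apply: eq_bigr => i _; rewrite mxE.
rewrite -det_diag -det_mulmx; congr (\det _); apply/matrixP => i j.
by rewrite mul_diag_mx !mxE expfzDr // mulrC.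
Qed.

End ExponentAlternants.

Lemma map_alternant_mx (S S' : comNzRingType) (f : {rmorphism S -> S'}) m (x : 'I_m -> S) e :
  map_mx f (alternant_mx x e) = alternant_mx (fun i => f (x i)) e.
Proof. by apply/matrixP => i j; rewrite !mxE rmorphXn. Qed.

(** * Values of Schur polynomials *)

Section SchurValues.
Variable R : realType.

Definition schur_exp m (rho : 'I_m -> int) (j : 'I_m) : int := rho j + m%:Z - (j.+1)%:Z.

Lemma alternantzE m (rho : 'I_m -> int) :
  @alternant R m rho = alternantz (fun i => tofrac 'X_i) (schur_exp rho).
Proof. by []. Qed.

Lemma alternant0E m :
  @alternant R m (fun=> 0) = tofrac (\det (alternant_mx (fun i => 'X_i) (@staircase m))).
Proof.
rewrite alternantzE -det_map_mx map_alternant_mx /=; congr (\det _).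
apply/matrixP => i j; rewrite !mxE /schur_exp add0r /staircase.
by rewrite subzn ?ltn_ord.
Qed.

Lemma meval_det_alternant m (x : 'I_m -> R) e :
  (\det (alternant_mx (fun i => 'X_i) e)).@[x] = \det (alternant_mx x e).
Proof.
rewrite -(det_map_mx (meval x)) map_alternant_mx; congr (\det _).
by apply/matrixP => i j; rewrite !mxE /= mevalXU.
Qed.

Lemma det_staircase_X_neq0 m :
  \det (alternant_mx (fun i => 'X_i : {mpoly R[m]}) (@staircase m)) != 0.
Proof.
have : \det (alternant_mx (fun i : 'I_m => i%:R : R) (@staircase m)) != 0.
  by apply: det_staircase_neq0 => i j /eqP; rewrite eqr_nat => /eqP/val_inj.
by rewrite -meval_det_alternant; apply: contraNneq => ->; rewrite meval0.
Qed.

(** Multiplying by the N-th power of the product of the variables clears negative exponents. If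
    there are none, N = 0, so that points with a zero coordinate are allowed. *)
Lemma has_value_schur m (rho : 'I_m -> int) (x : 'I_m -> R) :
  \det (alternant_mx x (@staircase m)) != 0 ->
  (forall j, 0 <= schur_exp rho j) \/ (forall i, x i != 0) ->
  has_value (schur_frac R rho) x
    (alternantz x (schur_exp rho) / \det (alternant_mx x (@staircase m))).
Proof.
set e := schur_exp rho => dx ex.
have [N N_e N_x] : exists2 N : nat, (forall j, 0 <= e j + N%:Z :> int) &
    N = 0%N \/ (forall i, x i != 0).
  case: ex => ex; first by exists 0%N; [move=> j; rewrite addr0|left].
  exists (\sum_j `|e j|)%N; last by right.
  by move=> j; rewrite (bigD1 j) //=; lia.
pose p := \det (alternant_mx (fun i => 'X_i : {mpoly R[m]}) (fun j => `|(e j + N%:Z)%R|%N)).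
pose q := (\prod_i ('X_i : {mpoly R[m]})) ^+ N * \det (alternant_mx (fun i => 'X_i) (@staircase m)).
have X_neq0 i : tofrac ('X_i : {mpoly R[m]}) != 0.
  rewrite tofrac_eq0; apply/eqP => /(congr1 (meval (fun=> 1))).
  by rewrite mevalXU meval0; apply/eqP/oner_neq0.
have qx : q.@[x] = (\prod_i x i) ^+ N * \det (alternant_mx x (@staircase m)).
  rewrite mevalM meval_det_alternant rmorphXn rmorph_prod; congr (_ ^+ _ * _).
  by apply: eq_bigr => i _; rewrite /= mevalXU.
have xN : (\prod_i x i) ^+ N != 0.
  by case: N_x => [->|x_neq0]; [rewrite expr0 oner_neq0|rewrite expf_neq0 //; apply/prodf_neq0].
exists p, q; split; first by rewrite qx mulf_neq0.
  rewrite /schur_frac alternant0E alternantzE.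
  have := alternantz_shift e (or_intror X_neq0 : N = 0%N \/ _).
  have pE : alternantz (fun i => tofrac 'X_i) (fun j => e j + N%:Z) = tofrac p.
    by rewrite (alternantz_nat _ N_e) -det_map_mx map_alternant_mx.
  rewrite pE => ->.
  have XN : (\prod_i tofrac ('X_i : {mpoly R[m]})) ^+ N != 0.
    by rewrite expf_neq0 //; apply/prodf_neq0.
  rewrite tofracM tofracXn rmorph_prod invfM mulrACA mulfV // mul1r.
  by [].
rewrite qx meval_det_alternant -alternantz_nat // alternantz_shift //.
by rewrite invfM mulrACA mulfV // mul1r.
Qed.

End SchurValues.

Lemma schur_exp_delta m (j : 'I_m) : schur_exp (@idx_delta m) j = (2 * staircase j)%N%:Z.
Proof. by have := ltn_ord j; rewrite /schur_exp /idx_delta /staircase; lia. Qed.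

Section SchurLimit.
Variables (R : realType) (good : pred nat).

Lemma schurP m (rho : 'I_m -> int) (x : 'I_m -> R) v :
  has_value (schur_frac R rho) x v -> schur rho x = v.
Proof.
by move=> xv; apply: has_value_uniq (xv); rewrite /schur; apply: (xgetPex 0); exists v.
Qed.

Lemma schur_defined_ge0 m (rho : 'I_m -> int) (x : 'I_m -> R) :
  (forall j, 0 <= schur_exp rho j) -> schur_defined rho x.
Proof.
move=> e_ge0; have [h hE] := alternant_staircase (fun i => 'X_i : {mpoly R[m]})
  (fun j => `|schur_exp rho j|%N).
exists (h.@[x] / (1 : {mpoly R[m]}).@[x]), h, 1; split=> //; first by rewrite meval1 oner_neq0.
rewrite /schur_frac alternant0E alternantzE (alternantz_nat _ e_ge0) -map_alternant_mx.
rewrite det_map_mx hE rmorphM rmorph1 divr1 mulrAC mulfV ?mul1r //.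
by rewrite tofrac_eq0 det_staircase_X_neq0.
Qed.

(** All exponents are doubled, so the alternant is the Vandermonde determinant of the squares. *)
Lemma has_value_delta m (x : 'I_m -> R) : has_value (schur_frac R (@idx_delta m)) x
  (\prod_(i < m) \prod_(l < m | (l < i)%N) (x i + x l)).
Proof.
pose p : {mpoly R[m]} := \prod_(i < m) \prod_(l < m | (l < i)%N) ('X_i + 'X_l).
exists p, 1; split; first by rewrite meval1 oner_neq0.
  rewrite rmorph1 divr1 /schur_frac alternant0E.
  apply: (canLR (mulfK _)); first by rewrite tofrac_eq0 det_staircase_X_neq0.
  rewrite alternantzE alternantz_nat; last by move=> j; rewrite schur_exp_delta.
  rewrite -map_alternant_mx det_map_mx -rmorphM; congr tofrac.
  have -> : alternant_mx (fun i : 'I_m => 'X_i : {mpoly R[m]})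
      (fun j => `|schur_exp (@idx_delta m) j|%N) =
    alternant_mx (fun i => 'X_i ^+ 2) (@staircase m).
    by apply/matrixP => i j; rewrite !mxE -exprM schur_exp_delta.
  rewrite !det_staircase mulrCA; congr (_ * _); rewrite -big_split /=.
  apply: eq_bigr => i _; rewrite -big_split /=; apply: eq_bigr => l _.
  by rewrite subr_sqr mulrC.
rewrite meval1 divr1 !rmorph_prod; apply: eq_bigr => i _; rewrite rmorph_prod.
by apply: eq_bigr => l _; rewrite /= mevalD !mevalXU.
Qed.

Lemma schur_delta m (x : 'I_m -> R) :
  schur (@idx_delta m) x = \prod_(i < m) \prod_(l < m | (l < i)%N) (x i + x l).
Proof. exact/schurP/has_value_delta. Qed.

Lemma eventually_limit_neq0 (f : nat -> R) v : v != 0 -> rational_limit good f v ->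
  eventually R good (fun s => f s != 0).
Proof.
move=> v0 [p [q [q0 pq0 fpq]]].
have p_neq0 : p != 0.
  have : p.[0] != 0 by rewrite pq0 mulf_neq0.
  by apply: contraNneq => ->; rewrite horner0.
apply: (eventually_and fpq (eventually_poly _ p_neq0)) => s <-.
by rewrite mulf_eq0 negb_or => /andP[].
Qed.

(** A fraction P/Q regular at x takes, at the nearby distinct nodes, the value given by
    determinants, and so computes the limit even if coordinates of x coincide. *)
Lemma schur_limit m (rho : 'I_m -> int) (x : 'I_m -> R) (y : 'I_m -> nat -> R) :
  schur_defined rho x -> (forall i, rational_limit good (y i) (x i)) ->
  eventually R good (fun s => \det (alternant_mx (y^~ s) (@staircase m)) != 0 /\
    ((forall j, 0 <= schur_exp rho j) \/ (forall i, y i s != 0))) ->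
  rational_limit good (fun s => alternantz (y^~ s) (schur_exp rho) /
    \det (alternant_mx (y^~ s) (@staircase m))) (schur rho x).
Proof.
move=> [v xv] yx ys; rewrite (schurP xv); have [P [Q [Qx fE ->]]] := xv.
have Qlim := rational_limit_meval Q yx.
apply: eq_rational_limit (rational_limitM (rational_limit_meval P yx) (rational_limitV Qx Qlim)).
apply: (eventually_and ys (eventually_limit_neq0 Qx Qlim)) => s [dy ey] Qy.
apply: (@has_value_uniq _ _ (schur_frac R rho) (y^~ s)); last exact: has_value_schur.
by exists P, Q.
Qed.

End SchurLimit.

Lemma big_neq_lift (T : Type) (idx : T) (op : Monoid.com_law idx) m (l : 'I_m)
    (P : pred 'I_m) (G : 'I_m -> T) :
  \big[op/idx]_(j | (j != l) && P j) G j =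
  \big[op/idx]_(i < m.-1 | P (lift l i)) G (lift l i).
Proof.
rewrite (reindex_omap (lift l) (unlift l)) /=.
  by apply: eq_bigl => i; rewrite liftK eqxx andbT eq_sym neq_lift.
by move=> j; case: unliftP => [i ->|->]; rewrite ?eqxx.
Qed.

(** * Residue sums as ratios of alternants *)

Section SchurRatios.
Variable F : fieldType.

Definition power_lagrange m (e : int) (x : 'I_m -> F) : F :=
  lagrange_lead (fun i => x i ^+ 2) (fun i => x i ^ e).

Lemma alternantz_delta m (x : 'I_m -> F) : alternantz x (schur_exp (@idx_delta m)) =
  \det (alternant_mx (fun i => x i ^+ 2) (@staircase m)).
Proof.
rewrite alternantz_nat; last by move=> j; rewrite schur_exp_delta.
by congr (\det _); apply/matrixP => i j; rewrite !mxE -exprM schur_exp_delta.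
Qed.

(** The exponents are 2m - 3, then the doubled staircase: the alternant of the squares with its
    first column replaced. *)
Lemma alternantz_two m (x : 'I_m -> F) : injective (fun i => x i ^+ 2) -> (0 < m)%N ->
  alternantz x (schur_exp (@idx_two m)) =
  power_lagrange (m%:Z *+ 2 - 3%:Z) x * alternantz x (schur_exp (@idx_delta m)).
Proof.
case: m x => // m x x_inj _; rewrite alternantz_delta -det_lagrange //.
congr (\det _); apply/matrixP => i j; rewrite !mxE; case: eqP => [->|/eqP j_neq0].
  by congr (_ ^ _); rewrite /schur_exp /idx_two /=; lia.
have j_gt0 : (0 < j)%N by rewrite lt0n.
rewrite -exprM exprnP; congr (_ ^ _); rewrite /schur_exp /idx_two /staircase ltnNge j_gt0 /=.
by have := ltn_ord j; lia.
Qed.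

(** The exponents start with 2m - 4, 2m - 5. Exchanging these two columns restores the doubled
    staircase outside the first column, at the price of a sign. *)
Lemma alternantz_three m (x : 'I_m -> F) : injective (fun i => x i ^+ 2) -> (1 < m)%N ->
  alternantz x (schur_exp (@idx_three m)) =
  - (power_lagrange (m%:Z *+ 2 - 5%:Z) x * alternantz x (schur_exp (@idx_delta m))).
Proof.
case: m x => [|[|m]] // x x_inj _; rewrite alternantz_delta -det_lagrange //.
set B := \matrix_(i, j) _; have -> : - \det B = \det (B *m perm_mx (tperm 0 1)).
  by rewrite det_mulmx det_perm odd_tperm /= expr1 mulrN1.
rewrite -xcolE; congr (\det _); apply/matrixP => i j; rewrite !mxE permE /=.
case: (j =P 0) => [->|/eqP j_neq0] /=.
  rewrite -exprM exprnP; congr (_ ^ _); rewrite /schur_exp /idx_three /staircase /= modn_small //; lia.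
case: (j =P 1) => [->|/eqP j_neq1] /=.
  by congr (_ ^ _); rewrite /schur_exp /idx_three /= modn_small //; lia.
rewrite (negPf j_neq0).
have j_gt1 : (1 < j)%N by case: j j_neq0 j_neq1 => -[|[]].
rewrite -exprM exprnP; congr (_ ^ _); rewrite /schur_exp /idx_three /staircase ltnNge j_gt1 /=.
by have := ltn_ord j; lia.
Qed.

(** Omitting l multiplies the j-th term by x_j^2 - x_l^2, and these factors sum over l to m x_j^2
    minus the sum of squares. The condition on [e + 2] is for x_j = 0, because 0 ^ 0 = 1. *)
Lemma sum_power_lagrange_omit m (e : int) (x : 'I_m -> F) :
  injective (fun i => x i ^+ 2) -> e != 0 -> e + 2 != 0 ->
  \sum_l power_lagrange e (omit x l) =
  m%:R * power_lagrange (e + 2) x - (\sum_l x l ^+ 2) * power_lagrange e x.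
Proof.
case: m x => [|m] x x_inj e0 e2.
  by rewrite !big_ord0 /power_lagrange /lagrange_lead !big_ord0 !mulr0 subrr.
pose w j := \prod_(k | k != j) (x j ^+ 2 - x k ^+ 2).
have w_neq j l : l != j -> x j ^+ 2 - x l ^+ 2 != 0.
  by move=> neq_lj; rewrite subr_eq0 eq_sym (inj_eq x_inj).
have omitE l : power_lagrange e (omit x l) =
    \sum_(j | j != l) x j ^ e * (x j ^+ 2 - x l ^+ 2) / w j.
  under eq_bigl do rewrite -[_ != l]andbT.
  rewrite (big_neq_lift _ l xpredT); apply: eq_bigr => i _.
  rewrite -mulrA; congr (_ * _); rewrite /w.
  rewrite (bigD1 l) ?neq_lift //= invfM mulrA mulfV ?mul1r ?w_neq ?neq_lift //.
  congr (_^-1); under [RHS]eq_bigl do rewrite andbC.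
  rewrite (big_neq_lift _ l (fun k => k != lift l i)).
  by apply: eq_bigl => k; rewrite (inj_eq lift_inj).
rewrite (eq_bigr _ (fun l _ => omitE l)) (exchange_big_dep xpredT) //=.
rewrite /power_lagrange /lagrange_lead !mulr_sumr -sumrB; apply: eq_bigr => j _.
rewrite -/(w j) -mulr_suml -mulr_sumr.
rewrite (eq_bigl (fun l => l != j)) => [|l]; last by rewrite eq_sym.
have -> : \sum_(l | l != j) (x j ^+ 2 - x l ^+ 2) = m.+1%:R * x j ^+ 2 - \sum_l x l ^+ 2.
  transitivity (\sum_l (x j ^+ 2 - x l ^+ 2)).
    by rewrite [RHS](bigD1 j) //= subrr add0r.
  by rewrite sumrB sumr_const card_ord mulr_natl.
have -> : x j ^ (e + 2) = x j ^ e * x j ^+ 2.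
  have [->|xj] := eqVneq (x j) 0; last by rewrite expfzDr.
  by rewrite expr0n mulr0 exp0rz (negPf e2).
by ring.
Qed.

End SchurRatios.

(** * Limits of the residue sums *)

Section ChangeOfField.
Variables (K L : numFieldType) (f : {rmorphism K -> L}) (good : pred nat).

Lemma eventually_rmorph P : eventually K good P -> eventually L good P.
Proof.
move=> [D D_neq0 DP]; exists (map_poly f D); first by rewrite map_poly_eq0.
move=> x + s xs; rewrite xs -(rmorph_nat f) horner_map fmorph_eq0 => Ds.
exact: DP Ds s erefl.
Qed.

Lemma rational_limit_rmorph u v : rational_limit good u v ->
  rational_limit good (fun s => f (u s)) (f v).
Proof.
move=> [p [q [q0 pq0 upq]]]; exists (map_poly f p), (map_poly f q).
have f0 r : (map_poly f r).[0] = f r.[0] by rewrite -{1}(rmorph0 f) horner_map.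
rewrite !f0 fmorph_eq0 pq0 rmorphM; split=> //.
apply: (eventually_and (eventually_rmorph upq) (eventually_rmorph upq)) => s E _.
by rewrite -(rmorph_nat f) !horner_map -E rmorphM.
Qed.

End ChangeOfField.

Lemma rmorph_theta_lead (K L : fieldType) (f : {rmorphism K -> L}) n (al B E : 'I_n -> nat) :
  f (theta_lead K al B E) = theta_lead L al B E.
Proof.
rewrite rmorph_sum; apply: eq_bigr => j _.
rewrite rmorphM fmorphV rmorph_nat rmorph_prod; congr (_ * _); apply: eq_bigr => k _.
by rewrite /kappa fmorph_div rmorphB !rmorphXn !rmorph_nat.
Qed.

Lemma theta_lead_omitE (K : fieldType) n (al B E : 'I_n -> nat) l :
  theta_lead_omit K al B E l = theta_lead K (omit al l) (omit B l) (omit E l).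
Proof.
rewrite /theta_lead_omit /theta_lead; under eq_bigl do rewrite andbC.
rewrite (big_neq_lift _ l (fun j => (0 < al j)%N)); apply: eq_bigr => j _.
congr (_ * _); under eq_bigl do rewrite andbC.
rewrite (big_neq_lift _ l (fun k => k != lift l j)).
by apply: eq_bigl => k; rewrite (inj_eq lift_inj).
Qed.

(** With y_j = al j / B j, [kappa j k] is y_j^2 / (B_k (y_j^2 - y_k^2)). The m - 1 squares and 1 /
    al j = 1 / (B_j y_j) combine to y_j^(2m-3). A weight 0 may be included in the sum: its term is
    0, the exponent being odd. *)
Lemma theta_lead_lagrange (K : numFieldType) m (al B E : 'I_m -> nat) :
  (forall j, 0 < B j)%N -> (forall j, 0 < al j -> E j * al j = B j)%N ->
  injective (fun j => ((al j)%:R / (B j)%:R : K) ^+ 2) ->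
  theta_lead K al B E = (\prod_j (B j)%:R)^-1 *
    power_lagrange (m%:Z *+ 2 - 3%:Z) (fun j => (al j)%:R / (B j)%:R).
Proof.
move=> B_gt0 EB y_inj; pose y j : K := (al j)%:R / (B j)%:R.
have B_neq0 j : (B j)%:R != 0 :> K by rewrite pnatr_eq0 -lt0n.
rewrite /theta_lead big_mkcond /power_lagrange /lagrange_lead mulr_sumr.
apply: eq_bigr => j _; case: posnP => [al0|al_j].
  by rewrite al0 mul0r exp0rz (_ : _ == 0 = false) ?mul0r ?mulr0 //; lia.
have al_neq0 : (al j)%:R != 0 :> K by rewrite pnatr_eq0 -lt0n.
have kE k : k != j -> kappa K al B E j k =
    (B k)%:R^-1 * (y j ^+ 2 / (y j ^+ 2 - y k ^+ 2)).
  move=> neq_kj; have E_j : (E j)%:R = (B j)%:R / (al j)%:R :> K.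
    by rewrite -EB // natrM mulfK.
  rewrite /kappa natrM E_j /y.
  have := y_inj k j; rewrite /= => yj.
  have d_neq0 : ((al j)%:R / (B j)%:R) ^+ 2 - ((al k)%:R / (B k)%:R) ^+ 2 != 0 :> K.
    by rewrite subr_eq0; apply: contraNneq neq_kj => /esym/yj ->.
  have -> : (B k)%:R ^+ 2 - ((B j)%:R / (al j)%:R * (al k)%:R) ^+ 2 =
    ((B k)%:R * (B j)%:R / (al j)%:R) ^+ 2 *
    (((al j)%:R / (B j)%:R) ^+ 2 - ((al k)%:R / (B k)%:R) ^+ 2) :> K.
    by field; rewrite ?al_neq0 ?B_neq0.
  move: (_ - _) d_neq0 => d d_neq0.
  by field; rewrite ?al_neq0 ?B_neq0 ?d_neq0.
rewrite (eq_bigr _ kE) big_split prodf_div prodfV /=.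
rewrite -[((al j)%:R / (B j)%:R) ^ _]/(y j ^ _).
rewrite -[\prod_(k | k != j) (((al j)%:R / _) ^+ 2 - _)]/(\prod_(k | k != j) (y j ^+ 2 - y k ^+ 2)).
rewrite [in RHS](bigD1 j) //= invfM.
have -> : \prod_(i | i != j) y j ^+ 2 = y j ^ (m%:Z *+ 2 - 2).
  rewrite prodr_const cardC1 card_ord -exprM exprnP; congr (_ ^ _).
  by have := ltn_ord j; lia.
have -> : y j ^ (m%:Z *+ 2 - 2) = (al j)%:R / (B j)%:R * y j ^ (m%:Z *+ 2 - 3).
  rewrite -/(y j) -[X in X * _]expr1z -expfzDr ?mulf_neq0 ?invr_neq0 //.
  by congr (_ ^ _); lia.
move: (\prod_(_ | _) _)^-1 (\prod_(_ | _) _)^-1 (_ ^ _) => b w z.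
by field; rewrite al_neq0 B_neq0.
Qed.

Section RatioLimits.
Variables (R : realType) (good : pred nat).

Definition evaluable m (rho : 'I_m -> int) (x : 'I_m -> R) :=
  (forall j, 0 <= schur_exp rho j) \/ (forall i, x i != 0).

Lemma schur_ratio_limit m (rho : 'I_m -> int) (x : 'I_m -> R) (y : 'I_m -> nat -> R) :
  schur_defined rho x -> evaluable rho x -> schur (@idx_delta m) x != 0 ->
  (forall i, rational_limit good (y i) (x i)) ->
  (forall s, good s -> injective (fun i => y i s ^+ 2)) ->
  rational_limit good (fun s => alternantz (y^~ s) (schur_exp rho) /
    alternantz (y^~ s) (schur_exp (@idx_delta m))) (schur rho x / schur (@idx_delta m) x).
Proof.
move=> xrho ev delta yx y_inj.
have staircase_neq0 s : good s -> \det (alternant_mx (y^~ s) (@staircase m)) != 0.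
  by move=> gs; apply: det_staircase_neq0 => i j yij; apply: (y_inj s gs); rewrite yij.
have delta_ge0 (j : 'I_m) : 0 <= schur_exp (@idx_delta m) j by rewrite schur_exp_delta.
have ys : eventually R good (fun s => \det (alternant_mx (y^~ s) (@staircase m)) != 0 /\
    evaluable rho (y^~ s)).
  case: ev => [ev|ev].
    by apply: eventuallyT => s gs; split; [exact: staircase_neq0|left].
  have px : \prod_i x i != 0 by apply/prodf_neq0.
  have := eventually_limit_neq0 px (rational_limit_prod (P := xpredT) _ (fun i _ => yx i)).
  move=> py; apply: (eventually_and py (eventuallyT R staircase_neq0)) => s /prodf_neq0 y0 ds.
  by split=> //; right=> i; apply: y0.
have dlim : rational_limit good (fun s => alternantz (y^~ s) (schur_exp (@idx_delta m)) /
    \det (alternant_mx (y^~ s) (@staircase m))) (schur (@idx_delta m) x).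
  apply: schur_limit => //; first exact: schur_defined_ge0.
  by apply: eventuallyT => s gs; split; [exact: staircase_neq0|left].
apply: eq_rational_limit (rational_limitM (schur_limit xrho yx ys) (rational_limitV delta dlim)).
apply: eventuallyT => s gs; rewrite invf_div mulrA divfK //.
exact: staircase_neq0.
Qed.

Let alternantz_delta_neq0 m (y : 'I_m -> R) : injective (fun i => y i ^+ 2) ->
  alternantz y (schur_exp (@idx_delta m)) != 0.
Proof. by move=> y_inj; rewrite alternantz_delta det_staircase_neq0. Qed.

Lemma power_lagrange_limit2 m (x : 'I_m -> R) (y : 'I_m -> nat -> R) : (0 < m)%N ->
  schur_defined (@idx_two m) x -> evaluable (@idx_two m) x -> schur (@idx_delta m) x != 0 ->
  (forall i, rational_limit good (y i) (x i)) ->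
  (forall s, good s -> injective (fun i => y i s ^+ 2)) ->
  rational_limit good (fun s => power_lagrange (m%:Z *+ 2 - 3%:Z) (y^~ s))
    (schur (@idx_two m) x / schur (@idx_delta m) x).
Proof.
move=> m_gt0 xrho ev delta yx y_inj.
apply: eq_rational_limit (schur_ratio_limit xrho ev delta yx y_inj).
apply: eventuallyT => s gs; rewrite alternantz_two //; last exact: y_inj.
by rewrite mulfK // alternantz_delta_neq0 //; exact: y_inj.
Qed.

Lemma power_lagrange_limit3 m (x : 'I_m -> R) (y : 'I_m -> nat -> R) : (1 < m)%N ->
  schur_defined (@idx_three m) x -> evaluable (@idx_three m) x -> schur (@idx_delta m) x != 0 ->
  (forall i, rational_limit good (y i) (x i)) ->
  (forall s, good s -> injective (fun i => y i s ^+ 2)) ->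
  rational_limit good (fun s => power_lagrange (m%:Z *+ 2 - 5%:Z) (y^~ s))
    (- (schur (@idx_three m) x / schur (@idx_delta m) x)).
Proof.
move=> m_gt1 xrho ev delta yx y_inj; rewrite -[- (_ / _)]mulN1r.
have := rational_limitM (rational_limit_cst good (-1))
  (schur_ratio_limit xrho ev delta yx y_inj); apply: eq_rational_limit.
apply: eventuallyT => s gs; rewrite alternantz_three //; last exact: y_inj.
by rewrite mulN1r mulNr opprK mulfK // alternantz_delta_neq0 //; exact: y_inj.
Qed.

Lemma theta_lead_limit m (al : 'I_m -> nat) (B E : nat -> 'I_m -> nat)
    (x := fun j => (al j)%:R : R) : (0 < m)%N ->
  (forall s j, 0 < B s j)%N ->
  (forall s j, good s -> (0 < al j)%N -> (E s j * al j = B s j)%N) ->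
  (forall j, rational_limit good (fun s => (B s j)%:R) (1 : R)) ->
  (forall s, good s -> injective (fun j => ((al j)%:R / (B s j)%:R : R) ^+ 2)) ->
  schur_defined (@idx_two m) x -> evaluable (@idx_two m) x -> schur (@idx_delta m) x != 0 ->
  rational_limit good (fun s => theta_lead R al (B s) (E s))
    (schur (@idx_two m) x / schur (@idx_delta m) x).
Proof.
move=> m_gt0 B_gt0 EB B1 y_inj xtwo ev delta.
pose y j s : R := (al j)%:R / (B s j)%:R.
have yx j : rational_limit good (y j) (x j).
  have := rational_limitM (rational_limit_cst good (x j)) (rational_limitV (oner_neq0 _) (B1 j)).
  by rewrite invr1 mulr1.
have Plim := rational_limit_prod (P := xpredT) (index_enum 'I_m) (fun j _ => B1 j).
rewrite big1 // in Plim.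
have := rational_limitM (rational_limitV (oner_neq0 _) Plim)
  (power_lagrange_limit2 m_gt0 xtwo ev delta yx y_inj).
rewrite invr1 mul1r; apply: eq_rational_limit; apply: eventuallyT => s gs.
by rewrite (theta_lead_lagrange (B_gt0 s) (fun j => EB s j gs) (y_inj s gs)).
Qed.

End RatioLimits.

(** * The scaled weights *)

Section Weights.
Variables (R : realType) (n : nat) (al : 'I_n -> nat).
Let x j : R := (al j)%:R.
Let good := good_scale al.
Let y j s : R := (al j)%:R / (scale al s j)%:R.

Lemma scale_limit j : rational_limit good (fun s => (scale al s j)%:R) (1 : R).
Proof.
pose c := (1 + prod_weights al * j.+1)%N.
have := rational_limit_poly good (1 + c%:R *: 'X : {poly R}).
rewrite !(hornerD, hornerC, hornerZ, hornerX) mulr0 addr0.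
apply: eq_rational_limit; apply: eventuallyT => s _.
by rewrite !(hornerD, hornerC, hornerZ, hornerX) /scale natrD natrM.
Qed.

Lemma node_limit j : rational_limit good (y j) (x j).
Proof.
have := rational_limitM (rational_limit_cst good (x j))
  (rational_limitV (oner_neq0 _) (scale_limit j)).
by rewrite invr1 mulr1.
Qed.

Lemma weights_one_zero : schur (@idx_delta n) x != 0 ->
  forall j k, al j = 0%N -> al k = 0%N -> j = k.
Proof.
rewrite schur_delta => /prodf_neq0 nz.
have lt_nz (j k : 'I_n) : (k < j)%N -> ~~ ((al j == 0%N) && (al k == 0%N)).
  move=> lt_kj; have /prodf_neq0/(_ k lt_kj) := nz j isT.
  by rewrite -natrD pnatr_eq0 addn_eq0.
move=> j k j0 k0; apply/val_inj/eqP; case: ltngtP => // /lt_nz; by rewrite j0 k0.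
Qed.

(** [scale_indep] separates two ratios as soon as one of the weights is nonzero; two weights 0 would
    annihilate the product of the sums x_i + x_l. *)
Lemma node_inj s : schur (@idx_delta n) x != 0 -> good s ->
  injective (fun j => y j s ^+ 2).
Proof.
move=> /weights_one_zero one_zero gs j k /eqP.
have B_neq0 i : (scale al s i)%:R != 0 :> R by rewrite pnatr_eq0 -lt0n scale_gt0.
rewrite eqrXn2 ?divr_ge0 ?ler0n // eqr_div // -!natrM eqr_nat mulnC [X in _ == X]mulnC => /eqP E.
apply/eqP; case: (posnP (al j)) => [j0|al_j].
  case: (posnP (al k)) => [k0|al_k]; first by rewrite (one_zero j k).
  by apply/negPn/negP => neq_jk; have := scale_indep gs al_k neq_jk; rewrite E eqxx.
apply/negPn/negP; rewrite eq_sym => neq_kj.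
by have := scale_indep gs al_j neq_kj; rewrite E eqxx.
Qed.

End Weights.

Section Evaluable.
Variable R : realType.

Lemma idx_two_ge0 m : (1 < m)%N -> forall j : 'I_m, 0 <= schur_exp (@idx_two m) j.
Proof.
by move=> m_gt1 j; have lt_j := ltn_ord j; rewrite /schur_exp /idx_two; case: ltnP; lia.
Qed.

Lemma idx_three_ge0 m : (2 < m)%N -> forall j : 'I_m, 0 <= schur_exp (@idx_three m) j.
Proof.
by move=> m_gt2 j; have lt_j := ltn_ord j; rewrite /schur_exp /idx_three; case: ltnP; lia.
Qed.

(* For m = 1 the exponent is -1, and 1/X has no value at 0. *)
Lemma evaluable_two m (z : 'I_m -> R) : (0 < m)%N ->
  schur_defined (@idx_two m) z -> evaluable (@idx_two m) z.
Proof.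
case: m z => [|[|m]] z // _; last by left; exact: idx_two_ge0.
case=> v [P [Q [Qz fE _]]]; right=> i; rewrite ord1.
have X_neq0 : tofrac ('X_0 : {mpoly R[1]}) != 0.
  rewrite tofrac_eq0; apply/eqP => /(congr1 (meval (fun=> 1))).
  by rewrite mevalXU meval0; apply/eqP/oner_neq0.
have Q_neq0 : tofrac Q != 0.
  by rewrite tofrac_eq0; apply: contraNneq Qz => ->; rewrite meval0.
suff QE : Q = P * 'X_0.
  by apply: contraNneq Qz => z0; rewrite QE mevalM mevalXU z0 mulr0.
have : tofrac 1 / tofrac 'X_0 = tofrac P / tofrac Q :> {fraction {mpoly R[1]}}.
  rewrite -fE /schur_frac alternant0E alternantzE /alternantz !det_mx11 !mxE.
  by rewrite expr0 tofrac1 divr1 div1r.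
by move/eqP; rewrite (eqr_div _ _ X_neq0 Q_neq0) -!tofracM tofrac_eq mul1r => /eqP.
Qed.

(** For n = 1 the Schur function is 1/X, but the single weight is then 1. *)
Lemma schur_two_defined n (al : 'I_n -> nat) : (0 < n)%N -> gcd_vec al = 1%N ->
  schur_defined (@idx_two n) (fun j => (al j)%:R : R).
Proof.
move=> n_gt0; have [n_gt1 _|] := ltnP 1 n.
  by apply: schur_defined_ge0; exact: idx_two_ge0.
move=> n_le1; have n1 : n = 1%N by lia.
move=> gcd_al; move: al gcd_al; rewrite n1 => be; rewrite /gcd_vec big_ord_recl big_ord0 gcdn0 => be1.
eexists; apply: has_value_schur; first by apply: det_staircase_neq0 => i j _; rewrite !ord1.
by right=> i; rewrite ord1 be1 oner_neq0.
Qed.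

End Evaluable.

Section ScaledWeights.
Variables (R : realType) (n : nat) (al : 'I_n -> nat).
Let x j : R := (al j)%:R.
Let y j s : R := (al j)%:R / (scale al s j)%:R.
Local Notation good := (good_scale al).

Lemma lead_limit : (0 < n)%N -> gcd_vec al = 1%N -> schur (@idx_delta n) x != 0 ->
  rational_limit good (fun s => theta_lead R al (scale al s) (coscale al s))
    (schur (@idx_two n) x / schur (@idx_delta n) x).
Proof.
move=> n_gt0 gcd_al delta; have two := schur_two_defined R n_gt0 gcd_al.
apply: theta_lead_limit => //.
- by move=> s j; exact: coscaleE.
- exact: scale_limit.
- by move=> s gs; exact: (node_inj delta gs).
exact: evaluable_two.
Qed.

Hypothesis n_gt1 : (1 < n)%N.
Hypothesis delta : schur (@idx_delta n) x != 0.
Hypothesis two_omit : forall l, schur_defined (@idx_two n.-1) (omit x l).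
Hypothesis delta_omit : forall l, schur (@idx_delta n.-1) (omit x l) != 0.

Let v l := schur (@idx_two n.-1) (omit x l) / schur (@idx_delta n.-1) (omit x l).

Let n1_gt0 : (0 < n.-1)%N. Proof. by move: n_gt1; lia. Qed.

Let omit_inj s l : good s -> injective (fun j => omit (y^~ s) l j ^+ 2).
Proof. by move=> gs j k /(node_inj delta gs)/lift_inj. Qed.

Lemma lead_omit_limit l :
  rational_limit good (fun s => theta_lead_omit R al (scale al s) (coscale al s) l) (v l).
Proof.
have := @theta_lead_limit R good n.-1 (omit al l) (fun s => omit (scale al s) l)
  (fun s => omit (coscale al s) l) n1_gt0.
move=> lim; apply: eq_rational_limit (lim _ _ _ _ _ _ _).
- by apply: eventuallyT => s _; rewrite theta_lead_omitE.
- by move=> s j; exact: scale_gt0.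
- by move=> s j; exact: coscaleE.
- by move=> j; exact: scale_limit.
- by move=> s gs; exact: omit_inj.
- exact: two_omit.
- exact: evaluable_two n1_gt0 (two_omit l).
exact: delta_omit.
Qed.

(** The limit of [sum_power_lagrange_omit] at e = 2n - 5. This is the exponent 2(n - 1) - 3 of
    [idx_two] in n - 1 variables and, up to sign, that of [idx_three] in n variables. *)
Lemma sum_omit_limits : schur_defined (@idx_three n) x ->
  \sum_l v l = n%:R * (schur (@idx_two n) x / schur (@idx_delta n) x) +
    (\sum_j x j ^+ 2) * (schur (@idx_three n) x / schur (@idx_delta n) x).
Proof.
move=> three.
have ev3 : evaluable (@idx_three n) x.
  (* For n = 2 an exponent of [idx_three] is -1. Each weight is then the only entry of some omitted
     vector, at which the one-variable function 1/X of [idx_two] is defined. *)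
  have [n_gt2|n_le2] := ltnP 2 n; first by left; exact: idx_three_ge0.
  right=> i; have n2 : n = 2%N by lia.
  have [j [k ijk]] : exists j k, i = lift j k.
    move: i; rewrite n2 => i; case: (unliftP (ord0 : 'I_2) i) => [k ->|->].
      by exists ord0, k.
    by exists ord_max, ord0; apply: val_inj.
  have [ge0|nz] := evaluable_two n1_gt0 (two_omit j); last by rewrite ijk; exact: nz.
  have := ge0 k; have lt_k := ltn_ord k; rewrite /schur_exp /idx_two; case: ltnP; lia.
have two : schur_defined (@idx_two n) x.
  by apply: schur_defined_ge0; exact: idx_two_ge0.
have yx j : rational_limit good (y j) (x j) := node_limit R al j.
have y_inj s : good s -> injective (fun j => y j s ^+ 2) := @node_inj R n al s delta.
have e_omit : (n.-1)%:Z *+ 2 - 3%:Z = n%:Z *+ 2 - 5%:Z :> int by lia.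
have lim l : rational_limit good
    (fun s => power_lagrange (n%:Z *+ 2 - 5%:Z) (omit (y^~ s) l)) (v l).
  rewrite -e_omit; have := @power_lagrange_limit2 R good n.-1 (omit x l)
    (fun j s => omit (y^~ s) l j) n1_gt0 (two_omit l) (evaluable_two n1_gt0 (two_omit l))
    (delta_omit l).
  apply; first by move=> j; exact: yx.
  by move=> s gs; exact: omit_inj.
have lim2 := power_lagrange_limit2 (ltnW n_gt1) two (evaluable_two (ltnW n_gt1) two) delta yx y_inj.
have lim3 := power_lagrange_limit3 n_gt1 three ev3 delta yx y_inj.
have limS := rational_limit_sum (P := xpredT) (index_enum 'I_n) (fun j _ => rational_limitX 2 (yx j)).
apply: (rational_limit_uniq (good_scale_unbounded al)).
  exact: rational_limit_sum (fun l _ => lim l).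
have := rational_limitD (rational_limitM (rational_limit_cst good n%:R) lim2)
  (rational_limitM (rational_limit_cst good (-1)) (rational_limitM limS lim3)).
rewrite mulrN mulN1r opprK; apply: eq_rational_limit; apply: eventuallyT => s gs.
rewrite sum_power_lagrange_omit; last 3 first.
- exact: y_inj.
- by lia.
- by lia.
by rewrite mulN1r (_ : n%:Z *+ 2 - 5%:Z + 2 = n%:Z *+ 2 - 3%:Z) //; lia.
Qed.

End ScaledWeights.

Theorem theorem5p1 (R : realType) (n : nat) (a : 'I_n -> int)
  (a_neq0 : exists j, a j != 0)
  (gcd_a : gcd_vec (fun j => `|a j|%N) = 1%N) :
  let alpha : 'I_n -> nat := fun j => `|a j|%N in
  let alphaR : 'I_n -> R := fun j => (alpha j)%:R in
  let g : 'I_n -> nat := fun j => gcd_vec (omit alpha j) in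
  let S : R := \sum_(i < n) alphaR i ^+ 2 in
  (exists gamma : nat -> R, onshell_laurent a gamma) /\
  (forall gamma : nat -> R, onshell_laurent a gamma ->
   [/\ schur (@idx_delta n) alphaR != 0 ->
         gamma 0%N = schur (@idx_two n) alphaR / schur (@idx_delta n) alphaR,
       gamma 1%N = 0,
       gamma 2%N = gamma 3%N
     & (1 < n)%N ->
       schur (@idx_delta n) alphaR != 0 ->
       schur_defined (@idx_three n) alphaR ->
       (forall j : 'I_n,
          schur_defined (@idx_two n.-1) (omit alphaR j) /\
          schur (@idx_delta n.-1) (omit alphaR j) != 0) ->
       gamma 2%N =
         gamma 0%N / 12%:R
         + schur (@idx_three n) alphaR / (12%:R * schur (@idx_delta n) alphaR) * S
         + \sum_(j < n)
             ((g j)%:R ^+ 2 - 1) * schur (@idx_two n.-1) (omit alphaR j)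
             / (12%:R * schur (@idx_delta n.-1) (omit alphaR j))]).
Proof.
move=> alpha alphaR g S.
have n_gt0 : (0 < n)%N by have [j _] := a_neq0; have := ltn_ord j; lia.
have al_gt0 : exists j, (0 < alpha j)%N.
  by have [j aj] := a_neq0; exists j; rewrite /alpha absz_gt0.
have [Phi [PhiR PhiP]] := hilb_numeratorP al_gt0.
have expansion := @hilbert_expansion R n a a_neq0 Phi (PhiR R).
(* The roots of unity require complex numbers here; the Schur limits are real and are carried over
   by [toC]. *)
have [h0 [h2 [lim0 lim2 [m [den_order num_den]]]]] :=
  theta_family_limit (R[i]) al_gt0 gcd_a PhiP.
split; first exact: (laurent_exists a_neq0 expansion den_order num_den).
move=> gamma gammaP.
pose toC : {rmorphism R -> R[i]} := real_complex R.
have head i : (i < 4)%N -> toC (gamma i) = (even_series h0 h2)`_i :=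
  laurent_head a_neq0 expansion den_order num_den gammaP.
have ES i : (even_series h0 h2)`_i =
    (i == 0%N)%:R * h0 + ((i == 2%N)%:R + (i == 3%N)%:R) / 4 * h2.
  by rewrite coefD coefC coefZ coefD !coefXn; case: i => [|i] /=; ring.
have head0 : toC (gamma 0%N) = h0 by rewrite head // ES /=; ring.
have head2 : toC (gamma 2%N) = h2 / 4 by rewrite head // ES /=; ring.
have lead (delta : schur (@idx_delta n) alphaR != 0) :
    h0 = toC (schur (@idx_two n) alphaR / schur (@idx_delta n) alphaR).
  apply: (rational_limit_uniq (good_scale_unbounded alpha) lim0).
  apply: eq_rational_limit (rational_limit_rmorph toC (lead_limit n_gt0 gcd_a delta)).
  by apply: eventuallyT => s _; rewrite rmorph_theta_lead.
have gamma0 (delta : schur (@idx_delta n) alphaR != 0) :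
    gamma 0%N = schur (@idx_two n) alphaR / schur (@idx_delta n) alphaR.
  by apply: (@complexI R); rewrite -[LHS]/(toC _) head0 lead.
split=> //.
- by apply: (@complexI R); rewrite -[LHS]/(toC _) head // ES /= -[RHS]/(0 : R[i]); ring.
- apply: (@complexI R); rewrite -[LHS]/(toC _) -[RHS]/(toC _).
  by rewrite !head // !ES /=; ring.
move=> n_gt1 delta three two_delta.
have two_omit l := (two_delta l).1; have delta_omit l := (two_delta l).2.
have sumv := sum_omit_limits n_gt1 delta two_omit delta_omit three.
pose v l := schur (@idx_two n.-1) (omit alphaR l) / schur (@idx_delta n.-1) (omit alphaR l).
have h2E : h2 = toC (3^-1 * (\sum_l (g l)%:R ^+ 2 * v l -
    (n%:R - 1) * (schur (@idx_two n) alphaR / schur (@idx_delta n) alphaR))).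
  apply: (rational_limit_uniq (good_scale_unbounded alpha) lim2).
  have limv l := lead_omit_limit n_gt1 delta two_omit delta_omit l.
  have lim := rational_limitM (rational_limit_cst (good_scale alpha) 3^-1) (rational_limitD
    (rational_limit_sum (P := xpredT) (index_enum 'I_n) (fun l _ => rational_limitM
       (rational_limitM (rational_limit_cst (good_scale alpha) ((g l)%:R ^+ 2))
          (scale_limit R alpha l)) (limv l)))
    (rational_limitM (rational_limit_cst (good_scale alpha) (- (n%:R - 1)))
      (lead_limit n_gt0 gcd_a delta))).
  have := rational_limit_rmorph toC lim.
  under [X in 3^-1 * (X + _)]eq_bigr do rewrite mulr1.
  rewrite mulNr; apply: eq_rational_limit; apply: eventuallyT => s _.
  rewrite mulNr rmorphM fmorphV rmorph_nat rmorphB rmorph_sum rmorphM rmorph_theta_lead.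
  rewrite rmorphB rmorph1 rmorph_nat; congr (_ * (_ - _)); apply: eq_bigr => l _.
  by rewrite rmorphM rmorphM rmorphXn !rmorph_nat !theta_lead_omitE rmorph_theta_lead.
have toC4 (r : R) : toC (r / 4) = toC r / 4 by rewrite rmorphM fmorphV rmorph_nat.
(* The 1/3 comes from [jet_theta], the 1/4 from [even_series]. *)
have -> : gamma 2%N = 3^-1 * (\sum_l (g l)%:R ^+ 2 * v l -
    (n%:R - 1) * (schur (@idx_two n) alphaR / schur (@idx_delta n) alphaR)) / 4.
  by apply: (@complexI R); rewrite -[LHS]/(toC _) head2 h2E -toC4.
rewrite gamma0 //.
have -> : \sum_(j < n) ((g j)%:R ^+ 2 - 1) * schur (@idx_two n.-1) (omit alphaR j)
    / (12%:R * schur (@idx_delta n.-1) (omit alphaR j)) =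
    12%:R^-1 * (\sum_l (g l)%:R ^+ 2 * v l - \sum_l v l).
  rewrite -sumrB mulr_sumr; apply: eq_bigr => l _; rewrite /v invfM; ring.
(* The sum of the [v l] contains n gamma_0, which together with -(n - 1) gamma_0 leaves the single
   gamma_0 / 12. *)
rewrite [\sum_l v l]sumv invfM.
move: (schur (@idx_delta n) _)^-1 (schur (@idx_two n) _) (schur (@idx_three n) _) => d s2 s3.
rewrite -/S.
by field.
Qed.
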